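(* Let $D,\Omega\subseteq\mathbb{C}^n$ be bounded, $d$-balanced, convex domains, $d=(d_1,\dots,d_n)$, and suppose that $\Omega$ is homogeneous. Then $$\left(h_{D}^{c}(0)\right)^{L}\leq S^{\Omega}_{d,D}(0),$$ where $L=\max_{1\leq i\leq n}d_i$.
   Context: Let $n\geq 2$ and let $d=(d_1,\dots,d_n)$ be an $n$-tuple of positive integers. A domain $\Omega\subseteq\mathbb{C}^n$ is $d$-balanced if for each $z=(z_1,\dots,z_n)\in\Omega$ and each $\lambda\in\mathbb{C}$ with $|\lambda|\leq 1$ one has $(\lambda^{d_1}z_1,\dots,\lambda^{d_n}z_n)\in\Omega$. Its $d$-Minkowski function is $h_{d,\Omega}(z):=\inf\{t>0:(z_1/t^{d_1},\dots,z_n/t^{d_n})\in\Omega\}$, $z\in\mathbb{C}^n$, and for $0<r\leq 1$ one sets $\Omega^d(r):=\{z\in\mathbb{C}^n:h_{d,\Omega}(z)<r\}$. A domain is homogeneous if its group of holomorphic automorphisms acts transitively on it. $\mathcal{O}_u(X,Y)$ denotes the set of injective holomorphic maps $X\to Y$. For a bounded domain $D$ and a bounded, convex, $d$-balanced domain $\Omega$, the $d$-balanced squeezing function is $$S_{d,D}^{\Omega}(z):=\sup\{r\in(0,1]:\Omega^d(r)\subseteq f(D),\ f\in\mathcal{O}_u(D,\Omega),\ f(z)=0\},\quad z\in D.$$ Let $c_D$ be the Carathéodory pseudodistance on $D$, normalized so that on the unit disc $c_{\mathbb{D}}(0,\sigma)=\tanh^{-1}|\sigma|$, and $B_D^c(a,r)=\{w\in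 D:c_D(a,w)<r\}$. The Fridman-type invariant (depending on $\Omega$) is $$h_D^c(a):=\sup\{\tanh r: r>0,\ B_D^c(a,r)\subseteq f(\Omega),\ f\in\mathcal{O}_u(\Omega,D)\}.$$ *)

(* Defs.v *)
From HB Require Import structures.
From mathcomp Require Import all_boot all_order all_algebra.
From mathcomp Require Import all_classical all_reals all_analysis.
From mathcomp Require Import complex.
Import Order.TTheory GRing.Theory Num.Theory.
Import numFieldNormedType.Exports.
Set Implicit Arguments.
Unset Strict Implicit.
Unset Printing Implicit Defensive.
Local Open Scope classical_set_scope.
Local Open Scope ring_scope.
Local Open Scope complex_scope.

(* The library gives a numFieldType its topology and norm only when it is
   abstract or in the form R[i]^o; this makes them visible on R[i] itself. *)
HB.instance Definition _ (R : rcfType) := NormedModule.copy R[i] R[i]^o.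

(* C^n is the row-vector space 'rV[R[i]]_n over the complex numbers R[i]; its
   library norm is the sup norm, and [differentiable] is Frechet
   differentiability with an R[i]-linear differential, that is, complex
   differentiability.  Maps are total functions: "f : X -> Y" becomes a
   condition on the restriction of f to X. *)

Definition domain (R : realType) (n : nat) (D : set 'rV[R[i]]_n) : Prop :=
  [/\ D !=set0, open D & connected D].

Definition holomorphic (R : realType) (n : nat) (W : normedModType R[i])
    (D : set 'rV[R[i]]_n) (f : 'rV[R[i]]_n -> W) : Prop :=
  forall z, D z -> differentiable f z.

(* O(X, Y) *)
Definition holo_map (R : realType) (n : nat) (W : normedModType R[i])
    (X : set 'rV[R[i]]_n) (Y : set W) (f : 'rV[R[i]]_n -> W) : Prop :=
  holomorphic X f /\ f @` X `<=` Y.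

(* O_u(X, Y) *)
Definition holo_inj (R : realType) (n : nat) (X Y : set 'rV[R[i]]_n)
    (f : 'rV[R[i]]_n -> 'rV[R[i]]_n) : Prop :=
  holo_map X Y f /\ set_inj X f.

Definition holo_automorphism (R : realType) (n : nat) (D : set 'rV[R[i]]_n)
    (f : 'rV[R[i]]_n -> 'rV[R[i]]_n) : Prop :=
  holo_map D D f /\
  exists g : 'rV[R[i]]_n -> 'rV[R[i]]_n,
    [/\ holo_map D D g, {in D, cancel f g} & {in D, cancel g f}].

Definition homogeneous (R : realType) (n : nat) (D : set 'rV[R[i]]_n) : Prop :=
  forall z w, D z -> D w -> exists2 f, holo_automorphism D f & f z = w.

Definition d_balanced (R : realType) (n : nat) (d : 'I_n -> nat)
    (D : set 'rV[R[i]]_n) : Prop :=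
  forall z (l : R[i]), D z -> `|l| <= 1 ->
    D (\row_i (l ^+ d i * z ord0 i)).

Definition d_minkowski (R : realType) (n : nat) (d : 'I_n -> nat)
    (D : set 'rV[R[i]]_n) (z : 'rV[R[i]]_n) : R :=
  inf [set t : R | 0 < t /\ D (\row_i (z ord0 i / t%:C ^+ d i))].

(* D^d(r) *)
Definition d_sublevel (R : realType) (n : nat) (d : 'I_n -> nat)
    (D : set 'rV[R[i]]_n) (r : R) : set 'rV[R[i]]_n :=
  [set z | d_minkowski d D z < r].

(* S_{d,D}^Omega(z) *)
Definition squeezing (R : realType) (n : nat) (d : 'I_n -> nat)
    (D Omega : set 'rV[R[i]]_n) (z : 'rV[R[i]]_n) : R :=
  sup [set r : R | [/\ 0 < r, r <= 1 &
    exists f, [/\ holo_inj D Omega f, f z = 0 &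
                  d_sublevel d Omega r `<=` f @` D]]].

Definition tanh (R : realType) (x : R) : R :=
  (expR x - expR (- x)) / (expR x + expR (- x)).

Definition artanh (R : realType) (x : R) : R :=
  ln ((1 + x) / (1 - x)) / 2.

Definition unit_disc (R : realType) : set R[i] := [set s | `|s| < 1].

(* The Poincare distance; [complex.Re `|_|] is the modulus as an element of R,
   and poincare 0 s = artanh |s|. *)
Definition poincare (R : realType) (s t : R[i]) : R :=
  artanh (complex.Re `|(s - t) / (1 - s^* * t)|).

(* The supremum is taken in \bar R: unlike [sup], it has no default value in
   case the set is unbounded. *)
Definition caratheodory (R : realType) (n : nat) (D : set 'rV[R[i]]_n)
    (z w : 'rV[R[i]]_n) : \bar R :=
  ereal_sup [set ((poincare (f z) (f w))%:E)%E |
    f in [set f : 'rV[R[i]]_n -> R[i] | holo_map D (@unit_disc R) f]].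

(* B_D^c(a, r) *)
Definition caratheodory_ball (R : realType) (n : nat) (D : set 'rV[R[i]]_n)
    (a : 'rV[R[i]]_n) (r : R) : set 'rV[R[i]]_n :=
  [set w | D w /\ (caratheodory D a w < r%:E)%E].

(* h_D^c(a), with respect to Omega *)
Definition fridman (R : realType) (n : nat) (D Omega : set 'rV[R[i]]_n)
    (a : 'rV[R[i]]_n) : R :=
  sup [set tanh r | r in [set r : R | 0 < r /\
    exists2 f, holo_inj Omega D f & caratheodory_ball D a r `<=` f @` Omega]].

(* Main.v *)
(** Let [f : Omega -> D] be injective with image containing the Carathéodory
    ball of radius [r], and [rho = tanh r]; by homogeneity [f 0 = 0].  Write
    [l . z] for the weighted action.  By Schwarz-Pick along [l |-> l . z'], the
    ball contains [rho . D], so [F z = f^-1 (rho . z)] is injective from [D] to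
    [Omega].  For [z'] in [Omega] the map [z |-> z^-1 . f (z^L . z')] extends
    holomorphically over [0], because the coordinates of [f (z^L . z')] vanish
    there to order [L >= d i]; it sends the unit circle to the convex set [D],
    hence the disc too.  So [f (eta^L . z')] lies in [eta . D] for [eta < rho],
    which says that the sublevel set of level [rho^L] lies in [F D].

    That [f^-1] is holomorphic is Osgood's theorem.  The underlying function
    theory (Goursat, mean values, Cauchy estimates) is obtained without
    integrals, from dyadic Riemann sums: these are exactly additive under
    quartering, and periodicity of [exp] turns Goursat's lemma on a strip into
    the statement that averages over [2^k]-th roots of unity converge to the
    value at the centre. *)
Require Import Defs.
From HB Require Import structures.
From mathcomp Require Import all_boot all_order all_algebra.
From mathcomp Require Import all_classical all_reals all_analysis.
From mathcomp Require Import complex.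
From mathcomp Require Import ring lra.
Import Order.TTheory GRing.Theory Num.Theory.
Import numFieldNormedType.Exports.
Set Implicit Arguments.
Unset Strict Implicit.
Local Open Scope classical_set_scope.
Local Open Scope ring_scope.

(** At its own centre [a] the difference quotient [dq f a] is only shown to be continuous and
    bounded, not differentiable. This is why Goursat's lemma is extended to bounded integrands with
    one exceptional point, and why the mean value statements allow one. Applied to [dq], they give
    Schwarz's lemma, Cauchy estimates with explicit constants and, from these, the differentiability
    of derivatives.

    The averages must also serve the convexity step. The sample points of [moebius_mean] depend on
    the centre and on the exceptional point, but not on the function. Hence one finite set of points
    on the circle works for all [n] coordinates of a vector-valued map, and the average is a convex
    combination of boundary values. These averages only converge to the value at the centre and [D]
    is open, so the boundary values need a uniform margin inside [D]; compactness of the circle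
    supplies it. *)

Section RealNorm.
Local Open Scope complex_scope.
Context {R : realType}.
Notation C := R[i].

(* The library norm takes its values in the partially ordered field R[i];
   [nr] is the same norm as an element of R. *)
Definition nr (V : normedModType C) (v : V) : R := complex.Re `|v|.

Lemma nrE (V : normedModType C) (v : V) : `|v| = (nr v)%:C.
Proof. by rewrite /nr RRe_real// ger0_real. Qed.

Lemma nr_ge0 (V : normedModType C) (v : V) : 0 <= nr v.
Proof. by rewrite -lecR -nrE normr_ge0. Qed.

Lemma nr0 (V : normedModType C) : nr (0 : V) = 0.
Proof. by rewrite /nr normr0. Qed.

Lemma nr_eq0 (V : normedModType C) (v : V) : (nr v == 0) = (v == 0).
Proof. by rewrite -[RHS]normr_eq0 nrE -(inj_eq (@complexI R)). Qed.

Lemma nr_gt0 (V : normedModType C) (v : V) : (0 < nr v) = (v != 0).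
Proof. by rewrite lt_def nr_ge0 andbT nr_eq0. Qed.

Lemma nrD (V : normedModType C) (v w : V) : nr (v + w) <= nr v + nr w.
Proof. by rewrite -lecR rmorphD/= -!nrE ler_normD. Qed.

Lemma nrN (V : normedModType C) (v : V) : nr (- v) = nr v.
Proof. by rewrite /nr normrN. Qed.

Lemma nr_distC (V : normedModType C) (v w : V) : nr (v - w) = nr (w - v).
Proof. by rewrite /nr distrC. Qed.

Lemma nrB (V : normedModType C) (v w : V) : nr (v - w) <= nr v + nr w.
Proof. by rewrite (le_trans (nrD _ _))// nrN. Qed.

Lemma nrZ (V : normedModType C) (a : C) (v : V) : nr (a *: v) = nr a * nr v.
Proof. by apply: (@complexI R); rewrite rmorphM/= -!nrE normrZ. Qed.

Lemma nrM (a b : C) : nr (a * b) = nr a * nr b.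
Proof. exact: (nrZ a b). Qed.

Lemma nrV (a : C) : nr (a^-1) = (nr a)^-1.
Proof. by apply: (@complexI R); rewrite fmorphV/= -!nrE normfV. Qed.

Lemma nrX (a : C) n : nr (a ^+ n) = nr a ^+ n.
Proof. by apply: (@complexI R); rewrite rmorphXn/= -!nrE normrX. Qed.

Lemma nr1 : nr (1 : C) = 1.
Proof. by rewrite /nr normr1. Qed.

Lemma nrR (x : R) : nr (x%:C : C) = `|x|.
Proof. by rewrite /nr normc_def/= expr0n/= addr0 sqrtr_sqr. Qed.

Lemma nr_sum (V : normedModType C) (I : Type) (s : seq I) (F : I -> V) :
  nr (\sum_(i <- s) F i) <= \sum_(i <- s) nr (F i).
Proof.
elim/big_ind2 : _ => //; first by rewrite nr0.
by move=> x1 x2 y1 y2 h1 h2; rewrite (le_trans (nrD _ _))// lerD.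
Qed.

Lemma nr_lerB (V : normedModType C) (v w : V) : nr v - nr w <= nr (v - w).
Proof. by rewrite lerBlDr (le_trans _ (nrD _ _))// subrK. Qed.

Lemma nr_Re (z : C) : `|complex.Re z| <= nr z.
Proof.
by rewrite /nr normc_def/= -sqrtr_sqr ler_wsqrtr// lerDl sqr_ge0.
Qed.

Lemma nr_Im (z : C) : `|complex.Im z| <= nr z.
Proof.
by rewrite /nr normc_def/= -sqrtr_sqr ler_wsqrtr// lerDr sqr_ge0.
Qed.

Lemma nr_ReIm (z : C) : nr z <= `|complex.Re z| + `|complex.Im z|.
Proof.
rewrite [in X in X <= _](complexE z) (le_trans (nrD _ _))//= nrM !nrR lerD//.
suff -> : nr ('i : C) = 1 by rewrite mul1r.
by rewrite /nr normc_def/= expr0n/= add0r expr1n sqrtr1.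
Qed.

Lemma nr_nbhsP (V : normedModType C) (p : V) (P : set V) :
  nbhs p P <-> exists2 e : R, 0 < e & forall v, nr (v - p) < e -> P v.
Proof.
split=> [/nbhs_ballP[e /= e0 eP]|[e e0 eP]].
  have er : e = (complex.Re e)%:C by rewrite RRe_real// gtr0_real.
  exists (complex.Re e); first by rewrite -ltcR -er.
  move=> v; rewrite -ltcR -er -nrE => h; apply: eP.
  by rewrite -ball_normE /= distrC.
apply/nbhs_ballP; exists (e%:C); first by rewrite /= ltcR.
by move=> v; rewrite -ball_normE /= distrC nrE ltcR => /eP.
Qed.

Lemma nr_openP (V : normedModType C) (P : set V) :
  open P <-> forall p, P p -> exists2 e : R, 0 < e & forall v, nr (v - p) < e -> P v.
Proof.
rewrite openE; split=> h p /h.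
  by rewrite /interior => /nr_nbhsP.
by move=> ?; apply/nr_nbhsP.
Qed.

Lemma nr_contP (V W : normedModType C) (f : V -> W) (p : V) :
  {for p, continuous f} <->
  forall e : R, 0 < e -> exists2 d : R, 0 < d & forall v, nr (v - p) < d -> nr (f v - f p) < e.
Proof.
split=> [h e e0|h].
  have /h : nbhs (f p) [set w | nr (w - f p) < e] by apply/nr_nbhsP; exists e.
  by move=> /nr_nbhsP.
move=> P /nr_nbhsP[e e0 eP]; have [d d0 dP] := h e e0.
by apply/nr_nbhsP; exists d => // v /dP/eP.
Qed.

Lemma nr_diff (V W : normedModType C) (f : V -> W) (p : V) :
  differentiable f p ->
  forall e : R, 0 < e -> exists2 d : R, 0 < d & forall h, nr h < d ->
    nr (f (p + h) - f p - 'd f p h) <= e * nr h.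
Proof.
move=> /diff_locally/eqaddoP h e e0.
have e0' : 0 < (e%:C : C) by rewrite ltcR.
have /nr_nbhsP[d d0 dP] := h _ e0'.
exists d => // v vd; have := dP v; rewrite subr0 => /(_ vd) /=.
rewrite !nrE -rmorphM/= lecR; apply: le_trans.
have -> : (f \o shift p - (cst (f p) + 'd f p)) v = f (v + p) - (f p + 'd f p v) by [].
by rewrite [v + p]addrC opprD addrA.
Qed.

Lemma diff_nr (V W : normedModType C) (f : V -> W) (p : V) (L : {linear V -> W}) :
  continuous L ->
  (forall e : R, 0 < e -> exists2 d : R, 0 < d & forall h, nr h < d ->
    nr (f (p + h) - f p - L h) <= e * nr h) ->
  differentiable f p /\ 'd f p = L :> (V -> W).
Proof.
move=> cL h.
have H : f \o shift p = cst (f p) + L +o_ 0 id.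
  apply/eqaddoP => e e0.
  have er : e = (complex.Re e)%:C by rewrite RRe_real// gtr0_real.
  have e0' : 0 < complex.Re e by rewrite -ltcR -er.
  have [d d0 dP] := h _ e0'.
  apply/nr_nbhsP; exists d => // v; rewrite subr0 => /dP.
  rewrite /= !nrE er -rmorphM/= lecR; apply: le_trans.
  have -> : (f \o shift p - (cst (f p) + L)) v = f (v + p) - (f p + L v) by [].
  by rewrite [v + p]addrC opprD addrA.
have E := diff_unique cL H; split=> //; apply/diff_locallyP.
by rewrite E.
Qed.

Lemma diff_lip (V W : normedModType C) (f : V -> W) (p : V) :
  differentiable f p -> exists2 k : R, 0 < k & forall h, nr ('d f p h) <= k * nr h.
Proof.
move=> df; have /linear_lipschitz[k k0 kP] : continuous ('d f p) by exact: diff_continuous.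
have er : k = (complex.Re k)%:C by rewrite RRe_real// gtr0_real.
exists (complex.Re k); first by rewrite -ltcR -er.
by move=> h; rewrite -lecR rmorphM/= -er -!nrE.
Qed.

Lemma diffC1 (f : C -> C) (p h : C) : 'd f p h = h * 'd f p 1.
Proof. by rewrite -[in LHS](mulr1 h) -[h * 1]/(h *: 1) linearZ. Qed.

End RealNorm.

(** * Goursat's lemma for dyadic Riemann sums *)

Section Goursat.
Local Open Scope complex_scope.
Context {R : realType}.
Notation C := R[i].
Implicit Types (phi : C -> C) (z v w : C).

Lemma half_small (e : R) : 0 < e -> exists m, forall n, (m <= n)%N -> (2^-1 : R) ^+ n <= e.
Proof.
move=> e0; have [m me] : exists m : nat, e^-1 < m%:R.
  by exists (Num.truncn e^-1).+1; rewrite truncnS_gt.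
exists m => n mn.
have n0 : 0 < (n%:R : R) by rewrite (lt_le_trans _ (ltW (lt_le_trans me _))) ?invr_gt0 ?ler_nat.
rewrite exprVn -[leRHS]invrK lef_pV2 ?posrE ?invr_gt0 ?exprn_gt0//.
rewrite (le_trans (ltW me))// -natrX ler_nat (leq_trans mn)// ltnW//.
exact: ltn_expl.
Qed.

(** Left-endpoint sum for the integral of [phi] along the segment from [z] to [z + v]; left
    endpoints make the halving of a segment exact. *)
Definition rsum phi z v (N : nat) : C :=
  \sum_(j < N) phi (z + j%:R / N%:R * v) * (v / N%:R).

(* Signed Riemann sum around the parallelogram [z, z + v, z + v + w, z + w]. *)
Definition psum phi (N : nat) z v w : C :=
  rsum phi z v N + rsum phi (z + v) w N - rsum phi (z + w) v N - rsum phi z w N.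

Lemma rsum_double phi z v N : (0 < N)%N ->
  rsum phi z v (N + N) = rsum phi z (v / 2) N + rsum phi (z + v / 2) (v / 2) N.
Proof.
move=> N0; have NC : (N%:R : C) != 0 by rewrite pnatr_eq0 -lt0n.
have NN : (N + N)%:R = (N%:R * 2 : C) by rewrite natrD; ring.
rewrite /rsum big_split_ord/=; congr (_ + _); apply: eq_bigr => j _; rewrite NN.
  by congr (phi _ * _); field.
by rewrite natrD; congr (phi _ * _); field.
Qed.

(** Each of the four interior half edges is traversed twice, in opposite directions and with the
    same nodes, so the cancellation is exact and not only asymptotic. *)
Lemma psum_split phi N z v w : (0 < N)%N ->
  let v' := v / 2 in let w' := w / 2 in
  psum phi (N + N) z v w = psum phi N z v' w' + psum phi N (z + v') v' w'
   + psum phi N (z + w') v' w' + psum phi N (z + v' + w') v' w'.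
Proof.
move=> N0 v' w'; rewrite /psum !rsum_double// -/v' -/w'.
have -> : z + v' + v' = z + v by rewrite /v'; field.
have -> : z + w' + w' = z + w by rewrite /w'; field.
have -> : z + w' + v' = z + v' + w' by ring.
have -> : z + v' + w' + v' = z + v + w' by rewrite /v'; field.
have -> : z + v' + w' + w' = z + w + v' by rewrite /w'; field.
ring.
Qed.

Definition para z v w (x y : R) : C := z + x%:C * v + y%:C * w.

Lemma natdivC (j N : nat) : (j%:R / N%:R : C) = ((j%:R / N%:R : R)%:C).
Proof. by rewrite rmorphM/= fmorphV/= !rmorph_nat. Qed.

Lemma rsum_sub phi p (a b : C) z v N : (0 < N)%N ->
  rsum phi z v N = rsum (fun u => phi u - (a + b * (u - p))) z v N
    + v * (a + b * (z - p) + b * v * (\sum_(j < N) j%:R / N%:R ^+ 2)).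
Proof.
move=> N0; have NC : (N%:R : C) != 0 by rewrite pnatr_eq0 -lt0n.
have -> : a + b * (z - p) = \sum_(j < N) (a + b * (z - p)) / N%:R.
  by rewrite sumr_const card_ord -[RHS](@mulr_natr C) mulfVK.
rewrite /rsum big_distrr -big_split/= big_distrr -big_split/=.
by apply: eq_bigr => j _; field.
Qed.

(** Left sums of an affine function miss its integral, but for fixed [N] by a term that depends only
    on the slope and the side vector, hence the same on opposite sides. What remains,
    [b * v * w - b * w * v], is zero. *)
Lemma psum_sub phi p (a b : C) z v w N : (0 < N)%N ->
  psum phi N z v w = psum (fun u => phi u - (a + b * (u - p))) N z v w.
Proof.
move=> N0; rewrite /psum !(rsum_sub phi p a b _ _ N0).
by set s := \sum_(j < _) _; ring.
Qed.

Lemma rsum_le phi z v N (m : R) : (0 < N)%N ->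
  (forall x, 0 <= x <= 1 -> nr (phi (z + x%:C * v)) <= m) ->
  nr (rsum phi z v N) <= m * nr v.
Proof.
move=> N0 h; apply: (le_trans (nr_sum _ _)).
have -> : m * nr v = \sum_(j < N) (m * (nr v / N%:R)).
  rewrite -big_distrr/= sumr_const card_ord -(mulr_natr (nr v / _)) mulfVK//.
  by rewrite pnatr_eq0 -lt0n.
apply: ler_sum => j _; rewrite nrM nrM nrV.
have -> : nr (N%:R : C) = N%:R by rewrite -(rmorph_nat (real_complex R)) nrR normr_nat.
apply: ler_wpM2r; first by rewrite divr_ge0 ?nr_ge0.
rewrite natdivC h// divr_ge0//= ler_pdivrMr ?ltr0n// mul1r ler_nat.
exact: ltnW.
Qed.

Lemma psum_le phi z v w N (m : R) : (0 < N)%N ->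
  (forall x y, 0 <= x <= 1 -> 0 <= y <= 1 -> nr (phi (para z v w x y)) <= m) ->
  nr (psum phi N z v w) <= 2 * (nr v + nr w) * m.
Proof.
move=> N0 h.
have h1 : nr (rsum phi z v N) <= m * nr v.
  apply: rsum_le => // x x1; have := h x 0 x1; rewrite /para mul0r addr0; apply.
  by rewrite lexx ler01.
have h2 : nr (rsum phi (z + v) w N) <= m * nr w.
  apply: rsum_le => // x x1; have := h 1 x _ x1; rewrite /para mul1r; apply.
  by rewrite lexx ler01.
have h3 : nr (rsum phi (z + w) v N) <= m * nr v.
  apply: rsum_le => // x x1; have := h x 1 x1; rewrite /para mul1r addrAC; apply.
  by rewrite lexx ler01.
have h4 : nr (rsum phi z w N) <= m * nr w.
  apply: rsum_le => // x x1; have := h 0 x _ x1; rewrite /para mul0r addr0; apply.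
  by rewrite lexx ler01.
rewrite /psum; set a := rsum _ _ _ _; set b := rsum _ _ _ _.
set c := rsum _ _ _ _; set d := rsum _ _ _ _.
have := nrB (a + b - c) d; have := nrB (a + b) c; have := nrD a b.
rewrite -/a -/b -/c -/d in h1 h2 h3 h4 *.
lra.
Qed.

Definition evle (u : nat -> C) (e : R) := exists K, forall k, (K <= k)%N -> nr (u k) <= e.

Lemma goursat phi z v w :
  (forall x y, 0 <= x <= 1 -> 0 <= y <= 1 -> differentiable phi (para z v w x y)) ->
  forall e, 0 < e -> evle (fun k => psum phi (2 ^ k) z v w) e.
Proof.
move=> dphi e e0; apply: contrapT => bad0.
pose Q (m : nat) (p : R * R) k := psum phi (2 ^ k) (para z v w p.1 p.2)
   ((2^-1)^+m * v) ((2^-1)^+m * w).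
(* Each piece of level [m] is granted the share [e / 4 ^+ m]. Four good quarters make a good whole:
   their shares add up, and [psum_split] trades one doubling of the mesh for one subdivision. *)
pose Bad m p := ~ evle (Q m p) (e / 4 ^+ m).
pose near m (p q : R * R) :=
   (p.1 <= q.1 <= p.1 + (2^-1) ^+ m.+1) && (p.2 <= q.2 <= p.2 + (2^-1)^+m.+1).
have step m p : exists q, Bad m p -> Bad m.+1 q /\ near m p q.
  apply: contrapT => H; have [B HB] : Bad m p /\ forall q, near m p q -> ~ Bad m.+1 q.
    split=> [|q npq Bq]; apply: contrapT => H'; apply: H; last by exists q.
    by exists p => B; case: H'.
  have h0 : (0 : R) <= (2^-1)^+m.+1 by rewrite exprn_ge0.
  have n1 := HB p; have n2 := HB (p.1 + (2^-1) ^+ m.+1, p.2).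
  have n3 := HB (p.1, p.2 + (2^-1) ^+ m.+1).
  have n4 := HB (p.1 + (2^-1) ^+ m.+1, p.2 + (2^-1) ^+ m.+1).
  have {}n1 := contrapT (n1 _); have {}n2 := contrapT (n2 _).
  have {}n3 := contrapT (n3 _); have {}n4 := contrapT (n4 _).
  rewrite /near/= !lerDl !lexx !h0/= in n1 n2 n3 n4.
  have [K1 {}n1] := n1 isT; have [K2 {}n2] := n2 isT.
  have [K3 {}n3] := n3 isT; have [K4 {}n4] := n4 isT.
  apply: B; exists (maxn (maxn K1 K2) (maxn K3 K4)).+1 => -[//|k].
  rewrite ltnS !geq_max => /andP[/andP[k1 k2] /andP[k3 k4]].
  move: (n1 k k1) (n2 k k2) (n3 k k3) (n4 k k4); rewrite /Q /=.
  rewrite expnS mul2n -addnn psum_split ?expn_gt0//.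
  have hC : (((2^-1 : R)^+m.+1)%:C : C) = (2^-1)^+m.+1.
    by rewrite rmorphXn/= fmorphV/= rmorph_nat.
  have E (a : C) : (2^-1)^+m * a / 2 = (2^-1)^+m.+1 * a.
    by rewrite exprS; ring.
  have -> : para z v w (p.1 + 2^-1^+m.+1) p.2 = para z v w p.1 p.2 + 2^-1^+m.+1 * v.
    by rewrite /para rmorphD/= hC; ring.
  have -> : para z v w p.1 (p.2 + 2^-1^+m.+1) = para z v w p.1 p.2 + 2^-1^+m.+1 * w.
    by rewrite /para rmorphD/= hC; ring.
  have -> : para z v w (p.1 + 2^-1^+m.+1) (p.2 + 2^-1^+m.+1)
      = para z v w p.1 p.2 + 2^-1^+m.+1 * v + 2^-1^+m.+1 * w.
    by rewrite /para !rmorphD/= hC; ring.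
  rewrite !E.
  set a := psum _ _ _ _ _; set b := psum _ _ _ _ _; set c := psum _ _ _ _ _; set d := psum _ _ _ _ _.
  have -> : e / 4 ^+ m = 4 * (e / 4 ^+ m.+1).
    have h4 : (4 : R)^+m != 0 by rewrite expf_neq0.
    by rewrite exprS; field.
  have := nrD (a + b + c) d; have := nrD (a + b) c; have := nrD a b.
  lra.
have [st /= stP] : {st | forall m p, Bad m p -> Bad m.+1 (st m p) /\ near m p (st m p)}.
  have /= [st H] := @choice (nat * (R * R))%type (R * R)%type (fun mp q => Bad mp.1 mp.2 -> Bad mp.1.+1 q /\ near mp.1 mp.2 q)
    (fun mp => step mp.1 mp.2).
  by apply/cid; exists (fun m p => st (m, p)) => m p; apply: (H (m, p)).
pose s := fix s m := if m is m'.+1 then st m' (s m') else ((0, 0) : R * R).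
have sB m : Bad m (s m).
  elim: m => [|m IH]; last by apply: (stP _ _ IH).1.
  move=> [K HK]; apply: bad0; exists K => k /HK.
  by rewrite /Q /para/= expr0 !mul1r !mul0r !addr0 divr1.
have sN m : near m (s m) (s m.+1) by apply: (stP _ _ (sB m)).2.
(* Nested intervals, one coordinate at a time: the supremum of the lower ends lies in every
   interval. *)
have lim1 (f : R * R -> R) : f (0, 0) = 0 ->
    (forall m, f (s m) <= f (s m.+1) <= f (s m) + 2^-1 ^+ m.+1) ->
    exists2 x, 0 <= x <= 1 & forall m, f (s m) <= x <= f (s m) + 2^-1 ^+ m.
  move=> f0 fs.
  have mono m n : (m <= n)%N -> f (s m) <= f (s n).
    by move=> /subnK <-; elim: (n - m)%N => //= i IH; case/andP: (fs (i + m)%N) => /(le_trans IH).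
  have anti m n : (m <= n)%N -> f (s n) + 2^-1 ^+ n <= f (s m) + 2^-1^+m.
    move=> /subnK <-; elim: (n - m)%N => //= i IH.
    case/andP: (fs (i + m)%N) => _ h.
    rewrite [(i.+1 + m)%N]addSn (le_trans _ IH)//.
    apply: (le_trans (lerD h (lexx _))); rewrite -addrA lerD2l exprS; lra.
  have cross m n : f (s n) <= f (s m) + 2^-1 ^+ m.
    have h k : (0 : R) <= 2^-1 ^+ k by rewrite exprn_ge0.
    case: (leqP m n) => mn; first by rewrite (le_trans _ (anti _ _ mn))// lerDl.
    by rewrite (le_trans (mono _ _ (ltnW mn)))// lerDl.
  have ub m : ubound (range (f \o s)) (f (s m) + 2^-1 ^+ m).
    by move=> _ [n _ <-]; apply: cross.
  have hs : has_sup (range (f \o s)).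
    by split; [exists (f (s 0%N)), 0%N|exists (f (s 0%N) + 2^-1 ^+ 0); exact: ub].
  have P m : f (s m) <= sup (range (f \o s)) <= f (s m) + 2^-1 ^+ m.
    rewrite ge_sup ?andbT//; first by apply: ub_le_sup; [exact: hs.2|exists m].
    exact: hs.1.
  exists (sup (range (f \o s))) => //.
  by have := P 0%N; rewrite /s/= f0 expr0 add0r.
have [x x01 xP] : exists2 x, 0 <= x <= 1 & forall m, (s m).1 <= x <= (s m).1 + 2^-1 ^+ m.
  by apply: (lim1 fst) => // m; case/andP: (sN m).
have [y y01 yP] : exists2 x, 0 <= x <= 1 & forall m, (s m).2 <= x <= (s m).2 + 2^-1 ^+ m.
  by apply: (lim1 snd) => // m; case/andP: (sN m).
pose p := para z v w x y; pose T := nr v + nr w.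
have T0 : 0 <= T by rewrite addr_ge0 ?nr_ge0.
(* With its affine part removed, the integrand is at most [e' * (h * T)] on the piece of level [m],
   where [h = 2^-1 ^+ m], and the perimeter is [2 * (h * T)]. The choice of [e'] keeps the product
   below [h ^+ 2 * e = e / 4 ^+ m]. *)
pose e' := e / (2 * T ^+ 2 + 1).
have T1 : 0 < 2 * T ^+ 2 + 1 by have := sqr_ge0 T; lra.
have e'0 : 0 < e' by rewrite divr_gt0.
have [d d0 dP] := nr_diff (dphi x y x01 y01) e'0.
have T2 : 0 < T + 1 by lra.
have [m mP] := half_small (divr_gt0 d0 T2).
have {mP} := mP m (leqnn _); set h := 2^-1 ^+ m => mh.
have h0 : 0 <= h by rewrite exprn_ge0.
have hT : h * T < d.
  move: mh; rewrite ler_pdivlMr//.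
  move: h0; rewrite le_eqVlt => /predU1P[<-|h0]; first by rewrite !mul0r.
  by rewrite mulrDr mulr1; lra.
apply: (sB m); exists 0%N => k _; rewrite /Q.
rewrite (psum_sub _ p (phi p) ('d phi p 1))// ?expn_gt0//.
have hC : ((h)%:C : C) = 2^-1 ^+ m by rewrite rmorphXn/= fmorphV/= rmorph_nat.
apply: (le_trans (psum_le (m := e' * (h * T)) _ _)); rewrite ?expn_gt0//.
- move=> a b a1 b1; set u := para _ _ _ a b.
  have -> : phi u - (phi p + 'd phi p 1 * (u - p)) = phi (p + (u - p)) - phi p - 'd phi p (u - p).
    have -> : p + (u - p) = u by ring.
    rewrite (diffC1 _ _ (u - p)).
    by ring.
  have up : u - p = ((s m).1 + a * h - x)%:C * v + ((s m).2 + b * h - y)%:C * w.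
    by rewrite /u /p /para !rmorphB !rmorphD !rmorphM/= hC; ring.
  have upT : nr (u - p) <= h * T.
    rewrite up (le_trans (nrD _ _))// !nrM !nrR /T mulrDr.
    by apply: lerD; apply: ler_wpM2r; rewrite ?nr_ge0// ler_norml;
      [have := xP m | have := yP m]; rewrite -/h; nra.
  rewrite (le_trans (dP _ (le_lt_trans upT hT)))//.
  by rewrite ler_wpM2l// ltW.
- rewrite !nrM -hC nrR ger0_norm//.
  have -> : e / 4 ^+ m = h ^+ 2 * (e' * (2 * T^+2 + 1)).
    rewrite /e' mulfVK ?gt_eqF// mulrC; congr (_ * _).
    by rewrite /h -exprM mulnC exprM exprVn -exprVn; congr (_ ^+ _); field.
  rewrite -/T -mulrDr -/T.
  have -> : 2 * (h * T) * (e' * (h * T)) = h ^+ 2 * (e' * (2 * T ^+2)) by ring.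
  by rewrite ler_wpM2l ?sqr_ge0// ler_wpM2l ?(ltW e'0)//; lra.
Qed.

End Goursat.

(** * Goursat's lemma with one exceptional point *)

Section GoursatBad.
Local Open Scope complex_scope.
Context {R : realType}.
Notation C := R[i].
Implicit Types (phi : C -> C) (z v w : C).

(* Bisection exchanges the relative positions 1/3 and 2/3, so an exceptional point
   placed there never meets the boundary of a subdivision. *)
Definition third (x : R) := x = 1 / 3 \/ x = 2 / 3.

Lemma evleD (u1 u2 : nat -> C) e1 e2 : evle u1 e1 -> evle u2 e2 ->
  evle (fun k => u1 k + u2 k) (e1 + e2).
Proof.
move=> [K1 h1] [K2 h2]; exists (maxn K1 K2) => k; rewrite geq_max => /andP[k1 k2].
by rewrite (le_trans (nrD _ _))// lerD ?h1 ?h2.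
Qed.

Lemma evle_S (u : nat -> C) e : evle (fun k => u k.+1) e -> evle u e.
Proof. by move=> [K h]; exists K.+1 => -[//|k]; rewrite ltnS => /h. Qed.

Lemma evle_le (u : nat -> C) e e' : e <= e' -> evle u e -> evle u e'.
Proof. by move=> ee [K h]; exists K => k /h /le_trans; apply. Qed.

Lemma evle_eq (u u' : nat -> C) e : u =1 u' -> evle u e -> evle u' e.
Proof. by move=> uu [K h]; exists K => k /h; rewrite uu. Qed.

(** Three of the quarters avoid the exceptional point and obey [goursat]; the fourth is handled by
    induction. The innermost piece is bounded by [M] times its perimeter, which has been halved [m]
    times. *)
Lemma goursat_punctured_aux phi (M : R) m z v w (al be : R) : third al -> third be ->
  (forall x y, 0 <= x <= 1 -> 0 <= y <= 1 -> (x, y) <> (al, be) ->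
     differentiable phi (para z v w x y)) ->
  (forall x y, 0 <= x <= 1 -> 0 <= y <= 1 -> nr (phi (para z v w x y)) <= M) ->
  forall e, 0 < e ->
  evle (fun k => psum phi (2 ^ k) z v w) (e + 2 * (nr v + nr w) * M * 2^-1 ^+ m).
Proof.
elim: m z v w al be => [|m IH] z v w al be ta tb dphi bphi e e0.
  exists 0%N => k _; rewrite expr0 mulr1 (le_trans (psum_le _ bphi)) ?expn_gt0//.
  by rewrite lerDr ltW.
have M0 : 0 <= M by rewrite (le_trans (nr_ge0 _) (bphi 0 0 _ _))// lexx ler01.
have n12 : (1 / 3 == 2 / 3 :> R) = false by apply/eqP; lra.
pose A := al == 2 / 3; pose B := be == 2 / 3.
have AA : third (2 * al - A%:R).
  by case: ta; rewrite /third /A => ->; rewrite ?n12 ?eqxx; [right|left] => /=; lra.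
have BB : third (2 * be - B%:R).
  by case: tb; rewrite /third /B => ->; rewrite ?n12 ?eqxx; [right|left] => /=; lra.
pose X := 2 * (nr v + nr w) * M * 2^-1 ^+ m.+1.
have X0 : 0 <= X by rewrite !mulr_ge0 ?addr_ge0 ?nr_ge0// exprn_ge0.
have nr2 : nr (2 : C) = 2 by rewrite -[2](rmorph_nat (real_complex R)) nrR normr_nat.
have q (a b : bool) : evle (fun k => psum phi (2 ^ k)
    (z + a%:R * (v / 2) + b%:R * (w / 2)) (v / 2) (w / 2))
    (e / 4 + (if (a == A) && (b == B) then X else 0)).
  have E x y : para (z + a%:R * (v / 2) + b%:R * (w / 2)) (v / 2) (w / 2) x y =
      para z v w ((x + a%:R) / 2) ((y + b%:R) / 2).
    by rewrite /para !rmorphM !rmorphD/= !fmorphV/= !rmorph_nat; field.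
  have in01 (x : R) (c : bool) : 0 <= x <= 1 -> 0 <= (x + c%:R) / 2 <= 1.
    by case: c => /=; lra.
  have e4 : 0 < e / 4 by lra.
  case: ifPn => [/andP[/eqP aA /eqP bB]|ab].
    have -> : X = 2 * (nr (v / 2) + nr (w / 2)) * M * 2^-1 ^+ m.
      by rewrite /X exprS !nrM !nrV nr2; field.
    apply: (IH _ _ _ (2 * al - A%:R) (2 * be - B%:R)) => //.
      move=> x y x1 y1 xy; rewrite E; apply: dphi; rewrite ?in01// => -[xa yb].
      by apply: xy; rewrite -xa -yb aA bB; congr (_, _); field.
    by move=> x y x1 y1; rewrite E bphi ?in01.
  rewrite addr0; apply: goursat => // x y x1 y1; rewrite E; apply: dphi; rewrite ?in01//.
  move=> [xa yb]; case/negP: ab; apply/andP; split; apply/eqP.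
    by move: ta x1 xa; rewrite /A => -[] ->; rewrite ?n12 ?eqxx; case: (a) => //=; lra.
  by move: tb y1 yb; rewrite /B => -[] ->; rewrite ?n12 ?eqxx; case: (b) => //=; lra.
apply: evle_S; have := evleD (evleD (evleD (q false false) (q true false)) (q false true)) (q true true).
rewrite /= !(mul0r, mul1r, addr0) => h; apply: evle_le (evle_eq _ h).
  by rewrite -/X; case: (A); case: (B) => /=; lra.
by move=> k; rewrite expnS mul2n -addnn psum_split ?expn_gt0.
Qed.

Lemma goursat_punctured phi (M : R) z v w (al be : R) : third al -> third be ->
  (forall x y, 0 <= x <= 1 -> 0 <= y <= 1 -> (x, y) <> (al, be) ->
     differentiable phi (para z v w x y)) ->
  (forall x y, 0 <= x <= 1 -> 0 <= y <= 1 -> nr (phi (para z v w x y)) <= M) ->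
  forall e, 0 < e -> evle (fun k => psum phi (2 ^ k) z v w) e.
Proof.
move=> ta tb dphi bphi e e0.
have M0 : 0 <= M by rewrite (le_trans (nr_ge0 _) (bphi 0 0 _ _))// lexx ler01.
pose T := 2 * (nr v + nr w) * M + 1.
have T0 : 0 <= 2 * (nr v + nr w) * M by rewrite !mulr_ge0 ?addr_ge0 ?nr_ge0.
have T1 : 0 < T by rewrite /T; lra.
have e2 : 0 < e / 2 by lra.
have [m mP] := half_small (divr_gt0 e2 T1).
apply: evle_le (goursat_punctured_aux m ta tb dphi bphi e2).
have := mP m (leqnn _); rewrite ler_pdivlMr// /T.
have : 0 <= (2^-1 : R) ^+ m by rewrite exprn_ge0.
lra.
Qed.

End GoursatBad.

(** * The complex exponential and polar coordinates *)

Section Cexp.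
Local Open Scope complex_scope.
Context {R : realType}.
Notation C := R[i].

Definition cexp (z : C) : C :=
  (expR (complex.Re z))%:C * (cos (complex.Im z) +i* sin (complex.Im z)).

Lemma cexp0 : cexp 0 = 1.
Proof. by rewrite /cexp/= expR0 cos0 sin0 mul1r. Qed.

Lemma cexpD (z w : C) : cexp (z + w) = cexp z * cexp w.
Proof.
case: z w => [x y] [x' y']; rewrite /cexp/= expRD cosD sinD rmorphM/=.
rewrite mulrACA; congr (_ * _); apply/eqP; rewrite eq_complex/=; apply/andP; split; apply/eqP; ring.
Qed.

Lemma nr_cexp (z : C) : nr (cexp z) = expR (complex.Re z).
Proof.
rewrite /cexp nrM nrR gtr0_norm ?expR_gt0// /nr normc_def/=.
by rewrite cos2Dsin2 sqrtr1 mulr1.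
Qed.

Lemma cexp_neq0 (z : C) : cexp z != 0.
Proof. by rewrite -nr_gt0 nr_cexp expR_gt0. Qed.

Lemma rdiff (f : R -> R) (p df : R) : is_derive p 1 f df ->
  forall e, 0 < e -> exists2 d, 0 < d & forall h, `|h| < d ->
    `|f (p + h) - f p - h * df| <= e * `|h|.
Proof.
move=> [/derivable_nbhs + <-] e e0 => /eqaddoP/(_ e e0)/nbhs_ballP[d /= d0 dP].
exists d => // h hd; have := dP h; rewrite -ball_normE /= sub0r normrN => /(_ hd).
apply: le_trans.
rewrite -[X in _ <= `|X|]/(f (h *: 1 + p) - (f p + h * 'D_1 f p)) [_ *: _]mulr1.
by rewrite [h + p]addrC opprD addrA.
Qed.

Lemma cexp_diff0 (e : R) : 0 < e -> exists2 d, 0 < d & forall h, nr h < d ->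
   nr (cexp h - 1 - h) <= e * nr h.
Proof.
(* The error terms below add up to at most [8 * e' * nr h], so the constant [14] is generous. *)
move=> e0; have [e' [e'0 e'1 e'2]] : exists e' : R, [/\ 0 < e', e' <= 1 & e' <= e / 14].
  exists (Num.min 1 (e / 14)); rewrite lt_min !ge_min !lexx orbT.
  by split=> //; apply/andP; split; lra.
have [d1 d10 h1] := rdiff (is_derive_expR 0) e'0.
have [d2 d20 h2] := rdiff (is_derive_cos 0) e'0.
have [d3 d30 h3] := rdiff (is_derive_sin 0) e'0.
exists (Num.min (Num.min d1 d2) (Num.min d3 e')); first by rewrite !lt_min d10 d20 d30 e'0.
move=> h; rewrite !lt_min => /andP[/andP[hd1 hd2] /andP[hd3 hd4]].
have := nr_Re h; have := nr_Im h; set x := complex.Re h; set y := complex.Im h => yh xh.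
have := h1 x (le_lt_trans xh hd1); have := h2 y (le_lt_trans yh hd2).
have := h3 y (le_lt_trans yh hd3).
rewrite !add0r expR0 sin0 cos0 oppr0 mulr0 !mulr1 !subr0 ?addr0 => {}h3 {}h2 {}h1.
have hE : cexp h - 1 - h = (expR x * cos y - 1 - x) +i* (expR x * sin y - y).
  rewrite /cexp /x /y; case: (h) => a b /=.
  apply/eqP; rewrite eq_complex/=; apply/andP; split; apply/eqP; ring.
rewrite hE (le_trans (nr_ReIm _))//=.
have -> : expR x * cos y - 1 - x = (expR x - 1 - x) * cos y + (1 + x) * (cos y - 1) by ring.
have -> : expR x * sin y - y = (expR x - 1) * sin y + (sin y - y) by ring.
have cosb : `|cos y| <= 1 by rewrite ler_norml cos_geN1 cos_le1.
set X := expR x in h1 *; set cy := cos y in h2 cosb *; set sy := sin y in h3 *.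
have ax : `|x| <= e' := ltW (le_lt_trans xh hd4).
have ay : `|y| <= e' := ltW (le_lt_trans yh hd4).
have t1 : `|(X - 1 - x) * cy| <= e' * `|x|.
  by rewrite normrM -[leRHS]mulr1 ler_pM.
have t2 : `|(1 + x) * (cy - 1)| <= 2 * (e' * `|y|).
  by rewrite normrM ler_pM// (le_trans (ler_normD _ _))// normr1; lra.
have t3 : `|X - 1| <= 2 * `|x|.
  have -> : X - 1 = (X - 1 - x) + x by ring.
  rewrite (le_trans (ler_normD _ _))//.
  have : e' * `|x| <= `|x| by rewrite ler_piMl.
  lra.
have t4 : `|sy| <= 2 * `|y|.
  have -> : sy = (sy - y) + y by ring.
  rewrite (le_trans (ler_normD _ _))//.
  have : e' * `|y| <= `|y| by rewrite ler_piMl.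
  lra.
have t5 : `|(X - 1) * sy| <= 4 * (e' * `|y|).
  rewrite normrM (le_trans (ler_pM _ _ t3 t4))//.
  have : `|x| * `|y| <= e' * `|y| by rewrite ler_wpM2r.
  nra.
have t6 : e' * `|x| <= e / 14 * nr h by rewrite ler_pM// ltW.
have t7 : e' * `|y| <= e / 14 * nr h by rewrite ler_pM// ltW.
have := ler_normD ((X - 1 - x) * cy) ((1 + x) * (cy - 1)).
have := ler_normD ((X - 1) * sy) (sy - y).
have : 0 <= e * nr h by rewrite mulr_ge0 ?nr_ge0// ltW.
lra.
Qed.

Lemma cexp_diff (z : C) : differentiable cexp z.
Proof.
have cL : continuous ( *%R (cexp z) : C -> C) by exact: scaler_continuous.
apply: (diff_nr (L := *:%R (cexp z)) _ _).1; first exact: cL.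
move=> e e0; have c0 : 0 < nr (cexp z) by rewrite nr_cexp expR_gt0.
have [d d0 dP] := cexp_diff0 (divr_gt0 e0 c0).
exists d => // h /dP; rewrite /= -[_ *: h]/(_ * _) cexpD.
have -> : cexp z * cexp h - cexp z - cexp z * h = cexp z * (cexp h - 1 - h) by ring.
by rewrite nrM mulrAC ler_pdivlMr// mulrC.
Qed.

Lemma cexp_polar (a : C) : a != 0 -> exists2 w, `|complex.Im w| <= pi & cexp w = a.
Proof.
move=> a0; have r0 : 0 < nr a by rewrite nr_gt0.
have cs : (complex.Re a / nr a) ^+ 2 + (complex.Im a / nr a) ^+ 2 = 1.
  rewrite !expr_div_n -mulrDl; suff -> : complex.Re a ^+ 2 + complex.Im a ^+ 2 = nr a ^+ 2.
    by rewrite divff// expf_neq0// gt_eqF.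
  by apply: (@complexI R); rewrite add_Re2_Im2 nrE rmorphXn.
set c := complex.Re a / nr a in cs; set s := complex.Im a / nr a in cs.
have c1 : -1 <= c <= 1 by have := sqr_ge0 s; nra.
have sE : Num.sqrt (1 - c ^+ 2) = `|s| by rewrite -cs addrAC subrr add0r sqrtr_sqr.
pose t := if 0 <= s then acos c else - acos c.
have ct : cos t = c by rewrite /t; case: ifP => _; rewrite ?cosN acosK// in_itv.
have st : sin t = s.
  rewrite /t; case: ifPn => [s0|]; rewrite ?sinN sin_acos// sE.
    by rewrite ger0_norm.
  by rewrite -ltNge => s0; rewrite ltr0_norm// opprK.
exists (ln (nr a) +i* t).
  have c01 := acos_ge0 c1; have c0p := acos_lepi c1.
  by rewrite /= /t; case: ifP => _; rewrite ?normrN ger0_norm.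
rewrite /cexp/= lnK ?posrE// ct st.
have aE : a = complex.Re a +i* complex.Im a by case: (a).
rewrite [in RHS]aE /c /s; apply/eqP; rewrite eq_complex/=; apply/andP; split; apply/eqP; field; rewrite ?gt_eqF //.
Qed.

(** For the difference [t] of the imaginary parts, [cos t = 1] forces [sin (t / 2) = 0], and the
    sine has no zero strictly between [0] and [pi]. *)
Lemma cexp_inj (p q : C) : cexp p = cexp q ->
  `|complex.Im p - complex.Im q| < 2 * pi -> p = q.
Proof.
move=> pq h.
have re : complex.Re p = complex.Re q.
  by apply: expR_inj; rewrite -!nr_cexp pq.
have : cexp (p - q) = 1.
  have : cexp q * cexp (p - q) = cexp q * 1 by rewrite -cexpD addrC subrK pq mulr1.
  by apply/mulfI/cexp_neq0.
case: p q re h {pq} => [x y] [x' y'] /= <- h.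
rewrite /cexp/= subrr expR0 mul1r => -[cy _].
set t := y - y' in h cy.
have : sin (t / 2) = 0.
  have := cosD (t / 2) (t / 2); have -> : t / 2 + t / 2 = t by field.
  rewrite cy => E; have := cos2Dsin2 (t / 2); apply: contra_eq => n0 /=.
  have : 0 < sin (t / 2) ^+ 2 by rewrite exprn_even_gt0.
  by move: E; rewrite -!expr2 => E h1; apply/eqP => h2; lra.
move: h; rewrite ltr_norml => /andP[t1 t2] s0.
have t0 : t = 0.
  apply/eqP; rewrite eq_le; apply/andP; split; rewrite leNgt; apply/negP => tt.
    have : 0 < sin (t / 2) by apply: sin_gt0_pi; apply/andP; split; lra.
    by rewrite s0 ltxx.
  have : 0 < sin (- (t / 2)) by apply: sin_gt0_pi; apply/andP; split; lra.
  by rewrite sinN s0 oppr0 ltxx.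
by move: t0 => /eqP; rewrite subr_eq0 => /eqP ->.
Qed.

End Cexp.

(** * Discrete mean values and Cauchy estimates *)

Section MeanValue.
Local Open Scope complex_scope.
Context {R : realType}.
Notation C := R[i].
Implicit Types (f : C -> C) (z v w u : C).

Definition tpi : C := 0 +i* (2 * pi).

(** The nodes start at an arbitrary point [u] of the circle; this free rotation lets [mean_value]
    place an exceptional point. *)
Definition pt u k (j : nat) : C := u * cexp (j%:R / (2 ^ k)%:R * tpi).

Definition cavg u k f : C := ((2 ^ k)%:R)^-1 * \sum_(j < 2 ^ k) f (pt u k j).

Lemma cexp_tpi : cexp tpi = 1.
Proof.
by rewrite /cexp/= expR0 mul1r mulr_natl cos2pi sin2pi.
Qed.

Lemma nr_pt u k j : nr (pt u k j) = nr u.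
Proof.
rewrite /pt nrM nr_cexp natdivC/= mulr0 !mul0r subr0.
by rewrite expR0 mulr1.
Qed.

Lemma cavg_le u k f (M : R) : (forall z, nr z = nr u -> nr (f z) <= M) ->
  nr (cavg u k f) <= M.
Proof.
move=> h; rewrite /cavg nrM nrV.
have N0 : (0 : R) < (2 ^ k)%:R by rewrite ltr0n expn_gt0.
have -> : nr ((2 ^ k)%:R : C) = (2 ^ k)%:R by rewrite -(rmorph_nat (real_complex R)) nrR normr_nat.
rewrite ler_pdivrMl// (le_trans (nr_sum _ _))//.
have -> : (2 ^ k)%:R * M = \sum_(j < 2 ^ k) M by rewrite sumr_const card_ord mulr_natl.
by apply: ler_sum => j _; apply: h; rewrite nr_pt.
Qed.

Lemma cavgD u k f g : cavg u k (fun z => f z + g z) = cavg u k f + cavg u k g.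
Proof. by rewrite /cavg -mulrDr big_split. Qed.

Lemma cavgZ u k f a : cavg u k (fun z => a * f z) = a * cavg u k f.
Proof. by rewrite /cavg mulrCA -big_distrr. Qed.

Lemma cavg_cst u k a : cavg u k (fun=> a) = a.
Proof.
rewrite /cavg sumr_const card_ord -(mulr_natl a) mulKf//.
Qed.

Lemma cavgB u k f g : cavg u k (fun z => f z - g z) = cavg u k f - cavg u k g.
Proof.
by rewrite cavgD; congr (_ + _); rewrite -mulN1r -cavgZ; congr cavg; apply/funext => z; rewrite mulN1r.
Qed.

Lemma eq_cavg u k f g : (forall z, nr z = nr u -> f z = g z) -> cavg u k f = cavg u k g.
Proof. by move=> h; rewrite /cavg; congr (_ * _); apply: eq_bigr => j _; rewrite h ?nr_pt. Qed.

Definition cavgr u k f (s : R) := cavg u k (fun z => f ((expR s)%:C * z)).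

Lemma cexp_re (s : R) : cexp (s%:C) = (expR s)%:C.
Proof. by rewrite /cexp/= cos0 sin0 mulr1. Qed.

(** In logarithmic coordinates an annulus is a strip of height [2 * pi]. By periodicity its
    horizontal sides carry the same values and cancel; its vertical sides are averages over the two
    boundary circles. *)
Lemma psum_annulus f (s1 s2 t1 : R) k :
  psum (f \o cexp) (2 ^ k) (s1 +i* t1) ((s2 - s1)%:C) tpi =
  tpi * (cavgr (cexp (0 +i* t1)) k f s2 - cavgr (cexp (0 +i* t1)) k f s1).
Proof.
have E (s : R) : s +i* t1 = s%:C + (0 +i* t1) by rewrite /real_complex_def; simpc.
have rE (s : R) : rsum (f \o cexp) (s +i* t1) tpi (2 ^ k) =
    tpi * cavgr (cexp (0 +i* t1)) k f s.
  rewrite /rsum /cavgr /cavg mulrA big_distrr/=; apply: eq_bigr => j _.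
  by rewrite /pt mulrC E !cexpD -mulrA cexp_re.
have rP z : rsum (f \o cexp) (z + tpi) ((s2 - s1)%:C) (2 ^ k) = rsum (f \o cexp) z ((s2 - s1)%:C) (2 ^ k).
  by apply: eq_bigr => j _ /=; rewrite (addrAC z tpi) (cexpD _ tpi) cexp_tpi mulr1.
rewrite /psum rP rE.
have -> : s1 +i* t1 + (s2 - s1)%:C = s2 +i* t1.
  by rewrite (E s1) (E s2) rmorphB/=; ring.
rewrite rE; ring.
Qed.

Lemma tpi_neq0 : tpi != 0.
Proof.
rewrite eq_complex/= negb_and; apply/orP; right.
by rewrite gt_eqF// mulr_gt0// pi_gt0.
Qed.

Lemma annulus_evle f (s1 s2 t1 : R) :
  (forall e, 0 < e -> evle (fun k => psum (f \o cexp) (2 ^ k) (s1 +i* t1) ((s2 - s1)%:C) tpi) e) ->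
  forall e, 0 < e -> evle (fun k => cavgr (cexp (0 +i* t1)) k f s2 - cavgr (cexp (0 +i* t1)) k f s1) e.
Proof.
move=> h e e0.
have t0 : 0 < nr tpi by rewrite nr_gt0 tpi_neq0.
have [K HK] := h _ (mulr_gt0 t0 e0).
by exists K => k /HK; rewrite psum_annulus nrM ler_pM2l.
Qed.

Lemma circle_mean f (s1 t1 : R) :
  (forall z, nr z <= expR s1 -> z != 0 -> differentiable f z) -> {for 0, continuous f} ->
  forall e, 0 < e -> evle (fun k => cavgr (cexp (0 +i* t1)) k f s1 - f 0) e.
Proof.
move=> df cf e e0; have e2 : 0 < e / 2 by lra.
have [d d0 dP] := (nr_contP _ _).1 cf _ e2.
(* On the circle of radius [expR s2 <= d / 2] continuity puts the average within [e / 2] of [f 0];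
   Goursat on the annulus carries the average out to radius [expR s1]. *)
pose s2 := Num.min (s1 - 1) (ln (d / 2)).
have h2 : evle (fun k => cavgr (cexp (0 +i* t1)) k f s1 - cavgr (cexp (0 +i* t1)) k f s2) (e / 2).
  apply: annulus_evle e2 => e' e'0; apply: goursat e'0 => x y x1 y1.
  have s21 : s2 <= s1 - 1 by rewrite ge_min lexx.
  apply: differentiable_comp; first exact: cexp_diff.
  apply: df; last exact: cexp_neq0.
  by rewrite nr_cexp ler_expR /para/=; nra.
have h3 : evle (fun k => cavgr (cexp (0 +i* t1)) k f s2 - f 0) (e / 2).
  exists 0%N => k _; rewrite /cavgr -(cavg_cst (cexp (0 +i* t1)) k (f 0)) -cavgB.
  apply: cavg_le => z; rewrite nr_cexp expR0 => z1; apply/ltW/dP.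
  rewrite subr0 nrM z1 mulr1 nrR gtr0_norm ?expR_gt0//.
  have s2d : s2 <= ln (d / 2) by rewrite ge_min lexx orbT.
  have : expR s2 <= d / 2.
    by rewrite -[leRHS]lnK ?posrE; [rewrite ler_expR|lra].
  lra.
have -> : e = e / 2 + e / 2 by field.
apply: evle_eq (evleD h2 h3) => k; ring.
Qed.

Lemma cavgr0 u k f : cavgr u k f 0 = cavg u k f.
Proof. by rewrite /cavgr expR0; congr cavg; apply/funext => z; rewrite mul1r. Qed.

Lemma mean_value0 f :
  (forall z, nr z <= 1 -> z != 0 -> differentiable f z) -> {for 0, continuous f} ->
  forall e, 0 < e -> evle (fun k => cavg 1 k f - f 0) e.
Proof.
move=> df cf e e0; have := @circle_mean f 0 0; rewrite expR0 => /(_ df cf e e0).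
by apply: evle_eq => k; rewrite cavgr0 -[0 +i* 0]/(0 : C) cexp0.
Qed.

(** The closed disc of radius [expR s1] misses [a]. The annulus around it becomes a strip containing
    exactly one logarithm [p] of [a], and cutting the circle at the angle [t1] puts [p] at the
    relative position 1/3 in both coordinates, as [goursat_punctured] asks. The rotation [u] depends
    on [a] alone. *)
Lemma mean_value (a : C) : a != 0 -> nr a < 1 -> exists2 u, nr u = 1 &
  forall f M, (forall z, nr z <= 1 -> z != 0 -> z != a -> differentiable f z) ->
    (forall z, nr z <= 1 -> nr (f z) <= M) -> {for 0, continuous f} ->
    forall e, 0 < e -> evle (fun k => cavg u k f - f 0) e.
Proof.
move=> a0 a1; have [p _ pa] := cexp_polar a0.
pose s0 := complex.Re p; pose t1 := complex.Im p - 2 * pi / 3.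
have s00 : s0 < 0 by rewrite -expR_lt1 -nr_cexp pa.
exists (cexp (0 +i* t1)); first by rewrite nr_cexp expR0.
move=> f M df bf cf e e0.
have e3 : 0 < e / 2 by lra.
(* This puts [s0] one third of the way from [s1] to [0], as [complex.Im p] is one third of the way
   from [t1] to [t1 + 2 * pi]. *)
pose s1 := 3 * s0 / 2.
have pi0 := pi_gt0 R.
have dfc z : complex.Re z <= 0 -> cexp z != a -> differentiable (f \o cexp) z.
  move=> z0 za; apply: differentiable_comp; first exact: cexp_diff.
  by apply: df => //; rewrite ?cexp_neq0// nr_cexp expR_le1.
have h1 : evle (fun k => cavgr (cexp (0 +i* t1)) k f 0 - cavgr (cexp (0 +i* t1)) k f s1) (e / 2).
  apply: annulus_evle e3 => e' e'0; rewrite sub0r.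
  apply: (goursat_punctured (M := M) (al := 1 / 3) (be := 1 / 3) _ _ _ _ e'0); [by left|by left| |].
    move=> x y x1 y1 xy; apply: dfc; first by rewrite /para/= /s1; nra.
    apply/negP => /eqP; rewrite -pa => /cexp_inj h; apply: xy.
    have : para (s1 +i* t1) (- s1)%:C tpi x y = p.
      by apply: h; rewrite /para/= /t1 ltr_norml; apply/andP; split; nra.
    move: @s0 @t1 s00 @s1 {h pa}; case: (p) => ps pt /= s00 [].
    rewrite mulr0 !mul0r !subr0 !mulr0 !add0r !addr0 => h1 h2.
    have y3 : y = 1 / 3 by apply: (mulfI (lt0r_neq0 pi0)); lra.
    have x3 : x = 1 / 3 by apply: (mulfI (ltr0_neq0 s00)); lra.
    by rewrite x3 y3.
  move=> x y x1 y1; apply: bf; rewrite nr_cexp expR_le1 /para/= /s1; nra.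
have h2 : evle (fun k => cavgr (cexp (0 +i* t1)) k f s1 - f 0) (e / 2).
  apply: (circle_mean _ _ cf e3) => z z1 z0; have zs : nr z < nr a.
    by rewrite (le_lt_trans z1)// -pa nr_cexp ltr_expR /s1 -/s0; lra.
  apply: df z0 _; first lra.
  by apply: contraTneq zs => ->; rewrite ltxx.
have -> : e = e / 2 + e / 2 by field.
apply: evle_eq (evleD h1 h2) => k; rewrite cavgr0; ring.
Qed.

End MeanValue.

(** * Difference quotients and Cauchy estimates on the unit disc *)

Section Cauchy.
Local Open Scope complex_scope.
Context {R : realType}.
Notation C := R[i].

Lemma diff_near_eq (V W : normedModType C) (f g : V -> W) (p : V) (d : R) :
  0 < d -> (forall v, nr (v - p) < d -> f v = g v) ->
  differentiable f p -> differentiable g p.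
Proof.
move=> d0 fg df; have cL : continuous ('d f p) by exact: diff_continuous.
apply: (diff_nr cL _).1 => e e0; have [d' d'0 h] := nr_diff df e0.
exists (Num.min d d'); first by rewrite lt_min d0.
move=> v; rewrite lt_min => /andP[vd vd'].
by rewrite -!fg; [exact: h|rewrite subrr nr0|rewrite addrC addKr].
Qed.

Lemma diff_mul (V : normedModType C) (f g : V -> C) (p : V) :
  differentiable f p -> differentiable g p -> differentiable (fun v => f v * g v) p.
Proof. exact: differentiableM. Qed.

Lemma diff_sub (V W : normedModType C) (f g : V -> W) (p : V) :
  differentiable f p -> differentiable g p -> differentiable (fun v => f v - g v) p.
Proof. exact: differentiableB. Qed.

Lemma diff_add (V W : normedModType C) (f g : V -> W) (p : V) :
  differentiable f p -> differentiable g p -> differentiable (fun v => f v + g v) p.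
Proof. exact: differentiableD. Qed.

Lemma diff_id (V : normedModType C) (p : V) : differentiable (fun v : V => v) p.
Proof. exact: ex_diff. Qed.

Lemma diff_const (V W : normedModType C) (a : W) (p : V) : differentiable (fun=> a) p.
Proof. exact: differentiable_cst. Qed.

Lemma diff_exp (V : normedModType C) (f : V -> C) n (p : V) :
  differentiable f p -> differentiable (fun v => f v ^+ n) p.
Proof.
move=> df; elim: n => [|n IH]; first exact: (@diff_const V C 1 p).
have -> : (fun v => f v ^+ n.+1) = (fun v => f v * f v ^+ n).
  by apply/funext => v; rewrite exprS.
exact: diff_mul df IH.
Qed.

Definition dq (f : C -> C) (a z : C) : C :=
  if z == a then 'd f a 1 else (f z - f a) / (z - a).

Lemma dq_mul f a z : (z - a) * dq f a z = f z - f a.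
Proof.
rewrite /dq; case: eqP => [->|/eqP za]; first by rewrite !subrr mul0r.
by rewrite mulrC mulfVK// subr_eq0.
Qed.

Lemma dq_diff f a z : z != a -> differentiable f z -> differentiable (dq f a) z.
Proof.
move=> za df.
apply: (@diff_near_eq _ _ (fun v => (f v - f a) * (v - a)^-1) _ _ (nr (z - a))).
- by rewrite nr_gt0 subr_eq0.
- move=> v vz; rewrite /dq; case: eqP => // va.
  by move: vz; rewrite va nr_distC ltxx.
- apply: diff_mul; first exact: (diff_sub df (diff_const _ _)).
  apply: differentiableV; last by rewrite subr_eq0.
  by apply: diff_sub; [exact: diff_id|exact: diff_const].
Qed.

Lemma dq_near f a : differentiable f a -> forall e, 0 < e -> exists2 d, 0 < d &
  forall z, nr (z - a) < d -> nr (dq f a z - 'd f a 1) <= e.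
Proof.
move=> df e e0; have [d d0 dP] := nr_diff df e0.
exists d => // z zd; rewrite /dq; case: eqP => [_|/eqP za].
  by rewrite subrr nr0 ltW.
have za0 : z - a != 0 by rewrite subr_eq0.
have zp : 0 < nr (z - a) by rewrite nr_gt0.
rewrite -(ler_pM2r zp) -nrM mulrBl mulfVK// mulrC -diffC1.
by have := dP _ zd; rewrite (addrC a) subrK.
Qed.

Lemma dq_cont f a : differentiable f a -> {for a, continuous (dq f a)}.
Proof.
move=> df; apply/nr_contP => e e0.
have e2 : 0 < e / 2 by lra.
have [d d0 dP] := dq_near df e2.
exists d => // z /dP; rewrite {3}/dq eqxx => /le_lt_trans; apply; lra.
Qed.

(** Near [a] the quotient is within [1] of the derivative; at distance at least [d], numerator and
    denominator are estimated separately. *)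
Lemma dq_bound f a M : differentiable f a ->
  (forall z, nr z <= 1 -> nr (f z) <= M) -> nr a <= 1 ->
  exists M', forall z, nr z <= 1 -> nr (dq f a z) <= M'.
Proof.
move=> df bf a1; have [d d0 dP] := dq_near df (@ltr01 R).
have M0 : 0 <= M by rewrite (le_trans (nr_ge0 _) (bf _ a1)).
exists (nr ('d f a 1) + 1 + 2 * M / d) => z z1.
have T0 : 0 <= 2 * M / d by rewrite divr_ge0 ?mulr_ge0// ltW.
have N0 := nr_ge0 ('d f a 1).
case: (ltrP (nr (z - a)) d) => zd.
  have := dP _ zd; have := nrD (dq f a z - 'd f a 1) ('d f a 1); rewrite subrK.
  lra.
have zp : 0 < nr (z - a) by rewrite (lt_le_trans d0).
suff : nr (dq f a z) <= 2 * M / d by lra.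
rewrite /dq; case: eqP => [za|_]; first by move: zp; rewrite za subrr nr0 ltxx.
rewrite nrM nrV; apply: ler_pM; rewrite ?invr_ge0 ?nr_ge0//.
  have := nrB (f z) (f a); have := bf z z1; have := bf a a1; lra.
by rewrite lef_pV2 ?posrE.
Qed.

Lemma evle_const (c : C) (M : R) (u : nat -> C) :
  (forall e, 0 < e -> evle (fun k => u k - c) e) -> (forall k, nr (u k) <= M) -> nr c <= M.
Proof.
move=> h b; rewrite leNgt; apply/negP => Mc.
have e0 : 0 < (nr c - M) / 2 by lra.
have [K HK] := h _ e0.
have := HK K (leqnn _); have := b K; have := nr_lerB c (u K); rewrite (nr_distC c).
lra.
Qed.

Lemma nr_sub1 (a z : C) : nr z = 1 -> nr a < 1 -> z - a != 0.
Proof.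
move=> z1 a1; rewrite -nr_gt0; have := nr_lerB z a; rewrite z1; lra.
Qed.

Lemma conjc_nr (z : C) : nr z = 1 -> conjc z = z^-1.
Proof.
move=> z1; rewrite invc_norm nrE z1 /= expr1n invr1 mul1r //.
Qed.

Lemma nrJ (z : C) : nr (conjc z) = nr z.
Proof. by rewrite /nr normcJ. Qed.

Lemma cavg_conj (u : C) k (f : C -> C) : conjc (cavg u k f) = cavg u k (fun z => conjc (f z)).
Proof.
rewrite /cavg rmorphM/= fmorphV/= rmorph_nat rmorph_sum//.
Qed.

(* The mean value property of [z * dq f a z], which vanishes at [0]. *)
Lemma cauchy_kernel (a : C) : a != 0 -> nr a < 1 -> exists2 u : C, nr u = 1 &
  (forall (f : C -> C) M, (forall z, nr z <= 1 -> z != 0 -> z != a -> differentiable f z) ->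
    (forall z, nr z <= 1 -> nr (f z) <= M) -> {for 0, continuous f} ->
    forall e, 0 < e -> evle (fun k => cavg u k f - f 0) e) /\
  (forall (f : C -> C) M, (forall z, nr z <= 1 -> differentiable f z) ->
    (forall z, nr z <= 1 -> nr (f z) <= M) ->
    forall e, 0 < e -> evle (fun k => cavg u k (fun z => f z * (z / (z - a))) - f a) e).
Proof.
move=> a0 a1; have [u u1 uP] := mean_value a0 a1; exists u => //; split=> //.
move=> f M df bf e e0.
have dfa : differentiable f a by apply/df/ltW.
have [M' bM'] := dq_bound dfa bf (ltW a1).
have e2 : 0 < e / 2 by lra.
pose h (z : C) : C := z * dq f a z.
have h1 : evle (fun k => cavg u k h - h 0) (e / 2).
  apply: (uP _ M') e2.
  - move=> z z1 z0 za; apply: diff_mul; first exact: diff_id.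
    exact: dq_diff za (df _ z1).
  - move=> z z1; rewrite nrM -[leRHS]mul1r ler_pM ?nr_ge0//.
    exact: bM'.
  - apply: differentiable_continuous; apply: diff_mul; first exact: diff_id.
    by apply: dq_diff; [rewrite eq_sym|apply: df; rewrite nr0].
(* The kernel [z / (z - a)] has a pole in the disc, but on the unit circle it is the conjugate of
   [g], which is holomorphic with [g 0 = 1]. Hence its averages tend to [1]. *)
pose g (z : C) : C := (1 - conjc a * z)^-1.
have g0 (z : C) : nr z <= 1 -> 1 - conjc a * z != 0.
  move=> z1; rewrite -nr_gt0; have := nr_lerB (1 : C) (conjc a * z).
  rewrite nr1 nrM nrJ; have : nr a * nr z <= nr a by rewrite ler_piMr ?nr_ge0.
  lra.
have gd (z : C) : nr z <= 1 -> differentiable g z.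
  move=> z1; apply: differentiableV; last exact: g0.
  apply: diff_sub; first exact: diff_const.
  by apply: diff_mul; [exact: diff_const|exact: diff_id].
(* Treated apart because the tolerance for [g] is divided by [nr (f a)]. *)
have [f0|f0] := eqVneq (f a) 0.
  apply: evle_le (evle_eq _ h1); first lra.
  move=> k; rewrite {2}/h mul0r f0 !subr0; apply: eq_cavg => z; rewrite u1 => z1.
  by rewrite /h -(subr0 (f z)) -f0 -dq_mul; field; exact: nr_sub1.
have fa0 : 0 < nr (f a) by rewrite nr_gt0.
have h2 : evle (fun k => cavg u k g - g 0) (e / 2 / nr (f a)).
  apply: (uP _ (1 - nr a)^-1) (divr_gt0 e2 fa0).
  - by move=> z z1 _ _; exact: gd.
  - move=> z z1; rewrite nrV lef_pV2 ?posrE; last 2 first.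
    + by rewrite nr_gt0 g0.
    + lra.
    have := nr_lerB (1 : C) (conjc a * z); rewrite nr1 nrM nrJ.
    have : nr a * nr z <= nr a by rewrite ler_piMr ?nr_ge0.
    lra.
  - by apply/differentiable_continuous/gd; rewrite nr0.
have h3 : evle (fun k => f a * (cavg u k (fun z => z / (z - a)) - 1)) (e / 2).
  have [K HK] := h2; exists K => k /HK; rewrite ler_pdivlMr// mulrC nrM.
  suff -> : cavg u k (fun z => z / (z - a)) - 1 = conjc (cavg u k g - g 0) by rewrite nrJ.
  rewrite rmorphB/= cavg_conj {2}/g mulr0 subr0 invr1 rmorph1; congr (_ - _).
  apply: eq_cavg => z; rewrite u1 => z1.
  have gJ : conjc (g z) = (1 - a * conjc z)^-1 by rewrite /g fmorphV rmorphB rmorphM rmorph1/= conjcK.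
  rewrite gJ conjc_nr//.
  have z0 : z != 0 by rewrite -nr_gt0 z1.
  by field; rewrite z0 nr_sub1.
have -> : e = e / 2 + e / 2 by field.
apply: evle_eq (evleD h1 h3) => k.
rewrite {2}/h mul0r subr0 mulrBr mulr1 addrA; congr (_ - _).
rewrite -cavgZ -cavgD; apply: eq_cavg => z; rewrite u1 => z1.
have -> : f z = f a + (z - a) * dq f a z by rewrite dq_mul; ring.
rewrite /h; field; exact: nr_sub1.
Qed.

(** Subtracting the averages for [f a] and [f 0] leaves the kernel [z / (z - a) - 1 = a / (z - a)],
    at most [2 * nr a] on the circle since [nr a <= 1 / 2]. *)
Lemma disc_lip (f : C -> C) M (a : C) : (forall z, nr z <= 1 -> differentiable f z) ->
    (forall z, nr z <= 1 -> nr (f z) <= M) -> nr a <= 1 / 2 ->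
  nr (f a - f 0) <= 2 * M * nr a.
Proof.
move=> df bf a2; have a1 : nr a < 1 by lra.
have [->|a0] := eqVneq a 0; first by rewrite subrr nr0 mulr0.
have M0 : 0 <= M by rewrite (le_trans (nr_ge0 _) (bf 0 _))// nr0.
have [u u1 [u2 u3]] := cauchy_kernel a0 a1.
have h1 : forall e, 0 < e -> evle (fun k => cavg u k f - f 0) e.
  apply: (u2 _ M); [by move=> z z1 _ _; exact: df|exact: bf|].
  by apply/differentiable_continuous/df; rewrite nr0.
apply: (@evle_const _ _ (fun k => cavg u k (fun z => f z * (z / (z - a))) - cavg u k f)).
  move=> e e0; have e2 : 0 < e / 2 by lra.
  have -> : e = e / 2 + e / 2 by field.
  have [K HK] := h1 _ e2.
  have h1' : evle (fun k => f 0 - cavg u k f) (e / 2) by exists K => k /HK; rewrite nr_distC.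
  apply: evle_eq (evleD (u3 f M df bf _ e2) h1') => k; ring.
move=> k; rewrite -cavgB; apply: cavg_le => z; rewrite u1 => z1.
have za := nr_sub1 z1 a1.
have -> : f z * (z / (z - a)) - f z = f z * (a / (z - a)) by field.
rewrite nrM nrM nrV (mulrC 2) -mulrA; apply: ler_pM; rewrite ?mulr_ge0 ?invr_ge0 ?nr_ge0 ?bf ?z1//.
rewrite ler_pdivrMr ?nr_gt0// -mulrA (mulrC (nr a)) mulrA ler_peMl ?nr_ge0//.
have := nr_lerB z a; rewrite z1; lra.
Qed.

(** Removing also the average of [dq f 0], which tends to the derivative at [0], leaves the kernel
    [a ^+ 2 / (z * (z - a))], at most [2 * nr a ^+ 2]. The other factor [2] is in the bound [2 * M]
    for [f z - f 0]. *)
Lemma disc_taylor (f : C -> C) M (a : C) : (forall z, nr z <= 1 -> differentiable f z) ->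
    (forall z, nr z <= 1 -> nr (f z) <= M) -> nr a <= 1 / 2 ->
  nr (f a - f 0 - a * 'd f 0 1) <= 4 * M * nr a ^+ 2.
Proof.
move=> df bf a2; have a1 : nr a < 1 by lra.
have [->|a0] := eqVneq a 0; first by rewrite subrr mul0r subr0 nr0 expr0n mulr0.
have M0 : 0 <= M by rewrite (le_trans (nr_ge0 _) (bf 0 _))// nr0.
have [u u1 [u2 u3]] := cauchy_kernel a0 a1.
pose g (z : C) : C := f z - f 0.
have dg z : nr z <= 1 -> differentiable g z.
  by move=> z1; apply: diff_sub; [exact: df|exact: diff_const].
have bg z : nr z <= 1 -> nr (g z) <= 2 * M.
  move=> z1; have := nrB (f z) (f 0); have := bf z z1; have := bf 0; rewrite nr0 => /(_ ler01).
  rewrite /g; lra.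
have d0 : differentiable f 0 by apply: df; rewrite nr0.
have h1 : forall e, 0 < e -> evle (fun k => cavg u k g - g 0) e.
  apply: (u2 _ (2 * M)); [by move=> z z1 _ _; exact: dg|exact: bg|].
  by apply/differentiable_continuous/dg; rewrite nr0.
have h2 : forall e, 0 < e -> evle (fun k => cavg u k (dq f 0) - dq f 0 0) e.
  have [M' HM'] := dq_bound d0 bf (ltac:(by rewrite nr0)).
  apply: (u2 _ M'); [|exact: HM'|exact: dq_cont].
  by move=> z z1 z0 _; exact: dq_diff z0 (df _ z1).
apply: (@evle_const _ _ (fun k => cavg u k (fun z => g z * (z / (z - a))) - cavg u k g - a * cavg u k (dq f 0))).
  move=> e e0; have e2 : 0 < e / 3 by lra.
  have -> : e = e / 3 + e / 3 + e / 3 by field.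
  have [K HK] := h1 _ e2.
  have h1' : evle (fun k => g 0 - cavg u k g) (e / 3) by exists K => k /HK; rewrite nr_distC.
  have ap : 0 < nr a by rewrite nr_gt0.
  have [K2 HK2] := h2 _ (divr_gt0 e2 ap).
  have h2' : evle (fun k => a * dq f 0 0 - a * cavg u k (dq f 0)) (e / 3).
    by exists K2 => k /HK2; rewrite ler_pdivlMr// -mulrBr nrM nr_distC mulrC.
  apply: evle_eq (evleD (evleD (u3 g _ dg bg _ e2) h1') h2') => k.
  have -> : dq f 0 0 = 'd f 0 1 by rewrite /dq eqxx.
  rewrite /g; ring.
move=> k; rewrite -cavgZ -!cavgB; apply: cavg_le => z; rewrite u1 => z1.
have za := nr_sub1 z1 a1.
have z0 : z != 0 by rewrite -nr_gt0 z1.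
have -> : g z * (z / (z - a)) - g z - a * dq f 0 z = g z * (a * (a / (z * (z - a)))).
  have := dq_mul f 0 z; rewrite subr0 -/(g z) => <-; field.
  by rewrite ?z0 ?za.
have -> : 4 * M * nr a ^+ 2 = (2 * M) * (nr a * (nr a * 2)) by ring.
rewrite !nrM nrV nrM z1 mul1r.
do 3 (apply: ler_pM; rewrite ?mulr_ge0 ?invr_ge0 ?nr_ge0 ?bg ?z1//).
rewrite -[leRHS]invrK lef_pV2 ?posrE ?invr_gt0 ?nr_gt0//.
have := nr_lerB z a; rewrite z1; lra.
Qed.

End Cauchy.

(** * Maximum principle, Schwarz-Pick lemma and flat functions on the disc *)

Section Disc.
Local Open Scope complex_scope.
Context {R : realType}.
Notation C := R[i].

Lemma nr_sqr (z : C) : nr z ^+ 2 = complex.Re z ^+ 2 + complex.Im z ^+ 2.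
Proof. by apply: (@complexI R); rewrite add_Re2_Im2 nrE rmorphXn. Qed.

Lemma nr_natC n : nr (n%:R : C) = n%:R.
Proof. by rewrite -(rmorph_nat (real_complex R)) nrR normr_nat. Qed.

Lemma moebius_identity (a z : C) :
  nr (1 + conjc a * z) ^+ 2 - nr (z + a) ^+ 2 = (1 - nr a ^+ 2) * (1 - nr z ^+ 2).
Proof. by rewrite !nr_sqr; case: a z => [a1 a2] [z1 z2] /=; ring. Qed.

Lemma moebius_den (a z : C) : nr a < 1 -> nr z <= 1 -> 1 + conjc a * z != 0.
Proof.
move=> a1 z1; rewrite -nr_gt0; have := nr_lerB (1 : C) (- (conjc a * z)).
rewrite opprK nr1 nrN nrM nrJ; have : nr a * nr z <= nr a by rewrite ler_piMr ?nr_ge0.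
lra.
Qed.

Lemma moebius_le1 (a z : C) : nr a < 1 -> nr z <= 1 ->
  nr ((z + a) / (1 + conjc a * z)) <= 1.
Proof.
move=> a1 z1; have d0 := moebius_den a1 z1.
rewrite nrM nrV ler_pdivrMr ?nr_gt0// mul1r -(@ler_pXn2r _ 2) ?nnegrE ?nr_ge0//.
rewrite -subr_ge0 moebius_identity; apply: mulr_ge0; rewrite subr_ge0.
  by rewrite expr_le1 ?nr_ge0// ltW.
by rewrite expr_le1 ?nr_ge0.
Qed.

Lemma moebius_lt1 (a z : C) : nr a < 1 -> nr z < 1 ->
  nr ((z + a) / (1 + conjc a * z)) < 1.
Proof.
move=> a1 z1; have d0 := moebius_den a1 (ltW z1).
rewrite nrM nrV ltr_pdivrMr ?nr_gt0// mul1r -(@ltr_pXn2r _ 2) ?nnegrE ?nr_ge0//.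
rewrite -subr_gt0 moebius_identity; apply: mulr_gt0; rewrite subr_gt0 expr_lt1 ?nr_ge0//.
Qed.

Lemma moebius_eq1 (a z : C) : nr a < 1 -> nr z = 1 ->
  nr ((z + a) / (1 + conjc a * z)) = 1.
Proof.
move=> a1 z1; have d0 : 1 + conjc a * z != 0 by rewrite moebius_den ?z1.
have : nr (1 + conjc a * z) ^+ 2 = nr (z + a) ^+ 2.
  by apply/eqP; rewrite -subr_eq0 moebius_identity z1 expr1n subrr mulr0.
move=> /eqP; rewrite eqrXn2 ?nr_ge0// => /eqP E.
by rewrite nrM nrV -E divff// nr_eq0.
Qed.

(** The disc automorphism [m] with [m 0 = a] carries roots of unity to sample points, which gives a
    discrete Poisson average. The exceptional point [b] is pulled back to [b'], and [b != a] keeps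
    [b'] off the centre, as [mean_value] demands. *)
Lemma moebius_mean (a b : C) : nr a < 1 -> nr b < 1 -> b != a ->
  exists2 p : nat -> nat -> C, (forall k j, nr (p k j) = 1) &
  forall (f : C -> C) M, (forall z, nr z <= 1 -> z != b -> differentiable f z) ->
    (forall z, nr z <= 1 -> nr (f z) <= M) ->
    forall e, 0 < e -> evle (fun k => (2 ^ k)%:R^-1 * \sum_(j < 2 ^ k) f (p k j) - f a) e.
Proof.
move=> a1 b1 ba; pose m (z : C) := (z + a) / (1 + conjc a * z).
pose b' : C := (b + - a) / (1 + conjc (- a) * b).
have na1 : nr (- a) < 1 by rewrite nrN.
have b'1 : nr b' < 1 by apply: moebius_lt1.
have d0 := moebius_den na1 (ltW b1).
have b'0 : b' != 0 by rewrite mulf_neq0 ?invr_eq0// subr_eq0.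
have [u u1 uP] := mean_value b'0 b'1.
exists (fun k j => m (pt u k j)); first by move=> k j; rewrite moebius_eq1// nr_pt.
move=> f M df bf e e0.
have m0 : m 0 = a by rewrite /m mulr0 addr0 add0r divr1.
have md z : nr z <= 1 -> differentiable m z.
  move=> z1; apply: diff_mul; first by apply: diff_add; [exact: diff_id|exact: diff_const].
  apply: differentiableV; last exact: moebius_den.
  by apply: diff_add; [exact: diff_const|apply: diff_mul; [exact: diff_const|exact: diff_id]].
have fmd z : nr z <= 1 -> z != b' -> differentiable (f \o m) z.
  move=> z1 zb; apply: differentiable_comp; first exact: md.
  apply: df; first exact: moebius_le1.
  apply: contraNneq zb => mb; apply/eqP; rewrite /b' -mb /m.
  have d1 := moebius_den a1 z1.
  have aa : 1 - conjc a * a != 0.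
    have -> : 1 - conjc a * a = 1 + conjc a * (- a) by ring.
    by rewrite moebius_den ?nrN ?ltW.
  have d2 : 1 + conjc (- a) * ((z + a) / (1 + conjc a * z)) =
     (1 - conjc a * a) / (1 + conjc a * z).
    by rewrite rmorphN/=; field.
  rewrite d2; field; rewrite ?aa ?d1 // ?andbT ?andTb.
have := uP (f \o m) M _ _ _ e e0.
rewrite /= m0 /cavg; apply.
- by move=> z z1 _ zb; exact: fmd.
- by move=> z z1; apply/bf/moebius_le1.
- by apply/differentiable_continuous/fmd; rewrite ?nr0// eq_sym.
Qed.

(** Maximum principle with an exceptional point: the interior bound [M] serves the convergence of
    the averages and leaves no trace in the conclusion. *)
Lemma moebius_bound (a b : C) (f : C -> C) (M B : R) : nr a < 1 -> nr b < 1 -> b != a ->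
  (forall z, nr z <= 1 -> z != b -> differentiable f z) ->
  (forall z, nr z <= 1 -> nr (f z) <= M) -> (forall z, nr z = 1 -> nr (f z) <= B) ->
  nr (f a) <= B.
Proof.
move=> a1 b1 ba df bf Bf; have [p p1 pP] := moebius_mean a1 b1 ba.
apply: (evle_const (pP f M df bf)) => k.
rewrite nrM nrV nr_natC ler_pdivrMl ?ltr0n ?expn_gt0// (le_trans (nr_sum _ _))//.
have -> : (2 ^ k)%:R * B = \sum_(j < 2 ^ k) B by rewrite sumr_const card_ord mulr_natl.
by apply: ler_sum => j _; apply: Bf.
Qed.

(** After composition with the automorphism moving [f 0] to [0], the quotient [dq g 0] is bounded by
    [1] on the circle, and [moebius_bound] applies with [0] as exceptional point. *)
Lemma schwarz_pick (f : C -> C) (a : C) : (forall z, nr z <= 1 -> differentiable f z) ->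
  (forall z, nr z <= 1 -> nr (f z) < 1) -> nr a < 1 ->
  nr ((f a - f 0) / (1 - conjc (f 0) * f a)) <= nr a.
Proof.
move=> df bf a1.
have [->|a0] := eqVneq a 0; first by rewrite subrr mul0r nr0.
pose c := - f 0; have c1 : nr c < 1 by rewrite nrN bf ?nr0.
pose g (z : C) := (f z + c) / (1 + conjc c * f z).
have dg z : nr z <= 1 -> differentiable g z.
  move=> z1; apply: diff_mul; first by apply: diff_add; [exact: df|exact: diff_const].
  apply: differentiableV; last by rewrite moebius_den// ltW ?bf.
  by apply: diff_add; [exact: diff_const|apply: diff_mul; [exact: diff_const|exact: df]].
have bg z : nr z <= 1 -> nr (g z) <= 1 by move=> z1; rewrite moebius_le1// ltW// bf.
have g0 : g 0 = 0 by rewrite /g subrr mul0r.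
have dg0 : differentiable g 0 by apply: dg; rewrite nr0.
have [M HM] := dq_bound dg0 bg (ltac:(by rewrite nr0)).
have := @moebius_bound a 0 (dq g 0) M 1 a1 _ _ _ HM.
rewrite nr0 ltr01 eq_sym a0 => /(_ isT isT) H.
have := dq_mul g 0 a; rewrite subr0 g0 subr0 => ga.
have -> : (f a - f 0) / (1 - conjc (f 0) * f a) = g a by rewrite /g /c rmorphN/= mulNr.
rewrite -ga nrM -[leRHS]mulr1 ler_wpM2l ?nr_ge0//; apply: H.
  by move=> z z1 z0; exact: dq_diff z0 (dg _ z1).
move=> z z1; have z0 : z != 0 by rewrite -nr_gt0 z1.
have := dq_mul g 0 z; rewrite subr0 g0 subr0 => /(congr1 (fun t => nr t)).
by rewrite nrM z1 mul1r => ->; rewrite bg ?z1.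
Qed.

(** The maximum principle for [f z / z ^+ k] replaces the constant [c], which varies with [k], by
    the bound [c0] of [f] on the circle, which does not. Then [c0 * nr a ^+ k] tends to [0]. *)
Lemma flat_zero (f : C -> C) : (forall z, nr z <= 1 -> differentiable f z) ->
  (forall k, exists c, forall z, nr z <= 1 -> nr (f z) <= c * nr z ^+ k) ->
  forall z, nr z < 1 -> f z = 0.
Proof.
move=> df ff a a1; have [c0 hc0] := ff 0%N.
have {hc0} c0P z : nr z <= 1 -> nr (f z) <= c0.
  by move=> /hc0; rewrite expr0 mulr1.
have [a0|a0] := eqVneq a 0.
  have [c hc] := ff 1%N; have := hc a (ltW a1); rewrite a0 nr0 expr0n mulr0 => h.
  by apply/eqP; rewrite -nr_eq0 eq_le h nr_ge0.
have h k : nr (f a) <= c0 * nr a ^+ k.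
  have [c hc] := ff k.
  have := @moebius_bound a 0 (fun z => f z / z ^+ k) (Num.max c c0) c0 a1.
  rewrite nr0 ltr01 eq_sym a0 => /(_ isT isT).
  rewrite nrM nrV nrX ler_pdivrMr ?exprn_gt0 ?nr_gt0//; apply.
  - move=> z z1 z0; apply: diff_mul; first exact: df.
    apply: differentiableV; last by rewrite expf_neq0.
    exact: (diff_exp k (diff_id z)).
  (* At [0] and for positive [k] the quotient has the value [0], because the inverse of [0] is
     [0]. *)
  - move=> z z1; have [->|z0] := eqVneq z 0.
      case: k hc => [|k] hc; last first.
        rewrite expr0n invr0 mulr0 nr0 le_max; apply/orP; right.
        by rewrite (le_trans (nr_ge0 _) (c0P 0 _))// nr0.
      by rewrite expr0 invr1 mulr1 le_max c0P ?orbT// nr0.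
    rewrite nrM nrV nrX ler_pdivrMr ?exprn_gt0 ?nr_gt0//.
    rewrite (le_trans (hc z z1))// ler_wpM2r ?exprn_ge0 ?nr_ge0//.
    by rewrite le_max lexx.
  - move=> z z1; rewrite nrM nrV nrX z1 expr1n invr1 mulr1 c0P// z1.
  done.
apply/eqP; rewrite -nr_eq0 eq_le nr_ge0 andbT leNgt; apply/negP => fa0.
have cp : 0 < c0 by rewrite (lt_le_trans fa0)// c0P// ltW.
have [N hN] : exists N, nr a ^+ N < nr (f a) / c0.
  have := @cvg_expr R (nr a); rewrite ger0_norm ?nr_ge0// => /(_ a1) /cvgrPdist_lt.
  move=> /(_ _ (divr_gt0 fa0 cp)) [N _ hN]; exists N.
  by have := hN N (leqnn N); rewrite /= sub0r normrN ger0_norm ?exprn_ge0 ?nr_ge0.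
have := h N; rewrite leNgt => /negP; apply.
by rewrite mulrC -ltr_pdivlMr.
Qed.

(** The mean value property of the inverse of [f]. *)
Lemma min_center (f : C -> C) (c : R) : 0 < c ->
  (forall z, nr z <= 1 -> z != 0 -> differentiable f z) -> {for 0, continuous f} ->
  (forall z, nr z <= 1 -> f z != 0) -> (forall z, nr z = 1 -> c <= nr (f z)) ->
  c <= nr (f 0).
Proof.
move=> c0 df cf f0 fc.
have f00 : f 0 != 0 by rewrite f0 ?nr0.
have := @evle_const R ((f 0)^-1) c^-1 (fun k => cavg 1 k (fun z => (f z)^-1)).
rewrite nrV lef_pV2 ?posrE ?nr_gt0//; apply.
  apply: (@mean_value0 _ (fun z => (f z)^-1)).
    by move=> z z1 z0; apply: differentiableV; [exact: df|exact: f0].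
  exact: (cvgV f00 cf).
move=> k; apply: cavg_le => z; rewrite nr1 => z1.
by rewrite nrV lef_pV2 ?posrE ?fc// nr_gt0 f0 ?z1.
Qed.

Lemma cauchy_limit (u : nat -> C) :
  (forall e, 0 < e -> exists K, forall k l, (K <= k)%N -> (K <= l)%N -> nr (u k - u l) <= e) ->
  exists l, forall e, 0 < e -> evle (fun k => u k - l) e.
Proof.
move=> h; have rcv (g : C -> R) : (forall z w, `|g z - g w| <= nr (z - w)) ->
    exists l, forall e, 0 < e -> exists K, forall k, (K <= k)%N -> `|g (u k) - l| <= e.
  move=> gl; have /cvg_ex[l gul] : cvgn (g \o u).
    apply/cauchy_cvgP/cauchy_ballP => e e0; have e2 : 0 < e / 2 by lra.
    have [K HK] := h _ e2; rewrite near_map2.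
    exists ([set k | (K <= k)%N], [set k | (K <= k)%N]) => /=; first by split; exists K.
    move=> [k l] /= [k1 l1]; rewrite /ball/=.
    by rewrite (le_lt_trans (gl _ _))// (le_lt_trans (HK _ _ k1 l1))//; lra.
  exists l => e e0; move/cvgrPdist_le: gul => /(_ _ e0)[K _ HK]; exists K => k kK.
  by rewrite distrC; exact: HK.
have reB (z w : C) : `|complex.Re z - complex.Re w| <= nr (z - w).
  by apply: le_trans (nr_Re _); case: z w => [? ?] [? ?].
have imB (z w : C) : `|complex.Im z - complex.Im w| <= nr (z - w).
  by apply: le_trans (nr_Im _); case: z w => [? ?] [? ?].
have [x hx] := rcv _ reB; have [y hy] := rcv _ imB.
exists (x +i* y) => e e0; have e2 : 0 < e / 2 by lra.
have [K1 h1] := hx _ e2; have [K2 h2] := hy _ e2.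
exists (maxn K1 K2) => k; rewrite geq_max => /andP[/h1 {}h1 /h2 {}h2].
rewrite (le_trans (nr_ReIm _))//; case: (u k) h1 h2 => /= a b.
lra.
Qed.

End Disc.

(** * Holomorphic functions on normed spaces *)

Section LocalEstimates.
Local Open Scope complex_scope.
Context {R : realType} {V : normedModType R[i]}.
Notation C := R[i].
Implicit Types (f : V -> C) (p u v w : V).

(** The radius [2 * r] leaves room for a disc of radius [r] about every point within [r] of [p]; the
    one-variable estimates are applied on these discs. *)
Definition tame (W : normedModType C) (f : V -> W) p (r M : R) :=
  forall z, nr (z - p) <= 2 * r -> differentiable f z /\ nr (f z) <= M.

Lemma diff_line (W : normedModType C) (f : V -> W) u w (t : C) :
  differentiable f (u + t *: w) ->
  differentiable (fun s : C => f (u + s *: w)) t /\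
  'd (fun s : C => f (u + s *: w)) t 1 = 'd f (u + t *: w) w.
Proof.
move=> df; pose L : C -> W := fun h => h *: 'd f (u + t *: w) w.
have lL : linear L by move=> a x y; rewrite /L scalerDl scalerA.
pose LM := GRing.isLinear.Build _ _ _ _ _ lL.
pose LL : {linear C -> W} := HB.pack L LM.
have cL : continuous LL by exact: scalel_continuous.
have [|d1 d2] := @diff_nr _ _ _ (fun s : C => f (u + s *: w)) t LL cL.
  move=> e e0; have e1 : 0 < e / (nr w + 1) by rewrite divr_gt0 ?ltr_wpDl ?nr_ge0.
  have [d d0 dP] := nr_diff df e1.
  have w1 : 0 < nr w + 1 by rewrite ltr_wpDl ?nr_ge0.
  exists (d / (nr w + 1)); first by rewrite divr_gt0.
  move=> h; rewrite ltr_pdivlMr// => hd.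
  have hw : nr (h *: w) < d.
    by rewrite nrZ (le_lt_trans _ hd)// ler_wpM2l ?nr_ge0// lerDl.
  rewrite scalerDl addrA; have := dP _ hw; rewrite linearZ.
  move=> /le_trans; apply; rewrite nrZ mulrAC ler_pdivrMr// -mulrA ler_wpM2l ?(ltW e0)//.
  by rewrite ler_wpM2l ?nr_ge0// lerDl.
by split=> //; rewrite d2 /= /L scale1r.
Qed.

(** This is [disc_lip] on the complex line through [u] along [w], with [w] rescaled to length [r];
    thus [nr w <= r / 2] becomes [nr a <= 1 / 2]. *)
Lemma lip_bound f p r M u w : 0 < r -> tame f p r M -> nr (u - p) <= r ->
  nr w <= r / 2 -> nr (f (u + w) - f u) <= 2 * M / r * nr w.
Proof.
move=> r0 tf up wr.
have [->|w0] := eqVneq w 0; first by rewrite addr0 subrr nr0 nr0 mulr0.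
have wp : 0 < nr w by rewrite nr_gt0.
pose w' : V := (r / nr w)%:C *: w; pose a : C := (nr w / r)%:C.
have w'r : nr w' = r by rewrite nrZ nrR ger0_norm ?divr_ge0 ?(ltW r0) ?(ltW wp)// mulfVK// gt_eqF.
have na : nr a = nr w / r by rewrite nrR ger0_norm ?divr_ge0 ?(ltW r0) ?(ltW wp).
have aw : a *: w' = w.
  rewrite /w' scalerA -rmorphM/= mulrA mulfVK ?gt_eqF// mulfV ?gt_eqF//.
  by rewrite rmorph1 scale1r.
have inb (z : C) : nr z <= 1 -> nr (u + z *: w' - p) <= 2 * r.
  move=> z1; rewrite addrAC (le_trans (nrD _ _))// nrZ w'r.
  have : nr z * r <= r by rewrite ler_piMl// ltW.
  lra.
have := @disc_lip R (fun z : C => f (u + z *: w')) M a.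
rewrite aw scale0r addr0 na => H; have -> : 2 * M / r * nr w = 2 * M * (nr w / r) by field; rewrite gt_eqF.
apply: H.
- by move=> z /inb/tf[df _]; exact: (diff_line df).1.
- by move=> z /inb/tf[].
- by rewrite ler_pdivrMr//; lra.
Qed.

Lemma taylor_bound f p r M u w : 0 < r -> tame f p r M -> nr (u - p) <= r ->
  nr w <= r / 2 -> nr (f (u + w) - f u - 'd f u w) <= 4 * M / r ^+ 2 * nr w ^+ 2.
Proof.
move=> r0 tf up wr.
have [->|w0] := eqVneq w 0.
  by rewrite addr0 subrr linear0 subr0 nr0 expr0n mulr0 nr0.
have wp : 0 < nr w by rewrite nr_gt0.
pose w' : V := (r / nr w)%:C *: w; pose a : C := (nr w / r)%:C.
have w'r : nr w' = r by rewrite nrZ nrR ger0_norm ?divr_ge0 ?(ltW r0) ?(ltW wp)// mulfVK// gt_eqF.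
have na : nr a = nr w / r by rewrite nrR ger0_norm ?divr_ge0 ?(ltW r0) ?(ltW wp).
have aw : a *: w' = w.
  rewrite /w' scalerA -rmorphM/= mulrA mulfVK ?gt_eqF// mulfV ?gt_eqF//.
  by rewrite rmorph1 scale1r.
have inb (z : C) : nr z <= 1 -> nr (u + z *: w' - p) <= 2 * r.
  move=> z1; rewrite addrAC (le_trans (nrD _ _))// nrZ w'r.
  have : nr z * r <= r by rewrite ler_piMl// ltW.
  lra.
have [dfu _] : differentiable f (u + 0 *: w') /\ nr (f (u + 0 *: w')) <= M.
  by apply/tf/inb; rewrite nr0.
have := @disc_taylor R (fun z : C => f (u + z *: w')) M a.
rewrite (diff_line dfu).2 aw !scale0r !addr0 na => H.
have -> : 4 * M / r ^+ 2 * nr w ^+ 2 = 4 * M * (nr w / r) ^+ 2 by field; rewrite gt_eqF.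
have E : 'd f u (a *: w') = a * 'd f u w' by rewrite linearZ.
rewrite aw in E; rewrite E.
apply: H.
- by move=> z /inb/tf[df _]; exact: (diff_line df).1.
- by move=> z /inb/tf[].
- by rewrite ler_pdivrMr//; lra.
Qed.

Lemma diff_bound f p r M u w : 0 < r -> tame f p r M -> nr (u - p) <= r ->
  nr w <= r / 2 -> nr ('d f u w) <= 4 * M / r * nr w.
Proof.
move=> r0 tf up wr; have M0 : 0 <= M.
  have [_ h] : differentiable f u /\ nr (f u) <= M by apply: tf; lra.
  exact: le_trans (nr_ge0 _) h.
have h1 := lip_bound r0 tf up wr; have h2 := taylor_bound r0 tf up wr.
have h3 : 4 * M / r ^+ 2 * nr w ^+ 2 <= 2 * M / r * nr w.
  have -> : 4 * M / r ^+ 2 * nr w ^+ 2 = 2 * M / r * nr w * (2 / r * nr w) by field; rewrite gt_eqF.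
  rewrite ler_piMr ?mulr_ge0 ?nr_ge0 ?invr_ge0 ?(ltW r0)//.
  by rewrite mulrAC ler_pdivrMr//; lra.
have h4 := nrB (f (u + w) - f u) (f (u + w) - f u - 'd f u w).
have E : f (u + w) - f u - (f (u + w) - f u - 'd f u w) = 'd f u w by ring.
rewrite E in h4.
have -> : 4 * M / r * nr w = 2 * M / r * nr w + 2 * M / r * nr w by ring.
lra.
Qed.

Lemma tame_near (W : normedModType C) (f : V -> W) p (d : R) : 0 < d ->
  (forall z, nr (z - p) < d -> differentiable f z) ->
  exists r M, [/\ 0 < r, 2 * r < d & tame f p r M].
Proof.
move=> d0 df; have dfp : differentiable f p by apply: df; rewrite subrr nr0.
have [d' d'0 dP] := (nr_contP _ _).1 (differentiable_continuous dfp) 1 ltr01.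
pose m := Num.min d d'; have m0 : 0 < m by rewrite lt_min d0.
have md : m <= d by rewrite ge_min lexx.
have md' : m <= d' by rewrite ge_min lexx orbT.
exists (m / 4), (nr (f p) + 1); split; [lra|lra|] => z zp; split.
  by apply: df; lra.
have := dP z; have := nrD (f z - f p) (f p); rewrite subrK.
have : nr (z - p) < d' by lra.
by move=> h h1 /(_ h); lra.
Qed.

Lemma tame_ge0 (W : normedModType C) (f : V -> W) p r M : 0 < r -> tame f p r M -> 0 <= M.
Proof.
move=> r0 tf; have [|_] := tf p; first by rewrite subrr nr0; lra.
exact: le_trans (nr_ge0 _).
Qed.

Lemma evle_uniq (l l' : C) (s : nat -> C) :
  (forall e, 0 < e -> evle (fun k => s k - l) e) ->
  (forall e, 0 < e -> evle (fun k => s k - l') e) -> l = l'.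
Proof.
move=> h h'; apply/eqP; rewrite -subr_eq0 -nr_eq0 eq_le nr_ge0 andbT leNgt.
apply/negP => l0; have e0 : 0 < nr (l - l') / 3 by lra.
have [K1 h1] := h _ e0; have [K2 h2] := h' _ e0.
have := h1 _ (leq_maxl K1 K2); have := h2 _ (leq_maxr K1 K2).
set a := s _; have := nrB (a - l') (a - l).
have -> : a - l' - (a - l) = l - l' by ring.
lra.
Qed.

(** The differential of the directional derivative is obtained as the limit of the maps [lam k],
    which are linear by construction and involve first differentials of [f] only. *)
Lemma dir_deriv_taylor f p r M v : 0 < r -> tame f p r M -> nr v <= r / 2 ->
  exists L : V -> C, [/\ linear L,
   forall w, nr w <= r / 2 -> nr (L w) <= 8 * M / r * nr w &
   forall w, nr w <= r / 2 -> nr ('d f (p + w) v - 'd f p v - L w) <= 8 * M / r ^+ 2 * nr w ^+ 2].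
Proof.
move=> r0 tf vr; have M0 := tame_ge0 r0 tf.
pose B := 8 * M / r ^+ 2; have B0 : 0 <= B by rewrite divr_ge0 ?sqr_ge0 ?mulr_ge0.
have dfz z : nr (z - p) <= 2 * r -> differentiable f z by move=> /tf[].
have lam_le (z : C) : nr z <= 1 -> nr (z *: v) <= r / 2.
  by move=> z1; rewrite nrZ (le_trans _ vr)// ler_piMl ?nr_ge0.
pose lam k w := cavg 1 k (fun t : C => ('d f (p + t *: v) w - 'd f p w) / t).
(* The derivative of [f] along [v] at [z] is the limit of the circle averages of
   [(f (z + t *: v) - f z) / t], in which [z] can be differentiated by [taylor_bound]. *)
have key w : nr w <= r / 2 -> forall e, 0 < e ->
    evle (fun k => 'd f (p + w) v - 'd f p v - lam k w) (B * nr w ^+ 2 + e).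
  move=> wr e e0; have e2 : 0 < e / 2 by lra.
  have cav u : nr (u - p) <= r / 2 ->
      evle (fun k => cavg 1 k (dq (fun t : C => f (u + t *: v)) 0) - 'd f u v) (e / 2).
    move=> up.
    have inb (z : C) : nr z <= 1 -> differentiable f (u + z *: v).
      move=> z1; apply: dfz; rewrite addrAC (le_trans (nrD _ _))//.
      by have := lam_le _ z1; lra.
    have df0 : differentiable (fun t : C => f (u + t *: v)) 0.
      by apply: (diff_line (inb 0 _)).1; rewrite nr0.
    have := @mean_value0 _ (dq (fun t : C => f (u + t *: v)) 0) _ (dq_cont df0) _ e2.
    rewrite {3}/dq eqxx (diff_line _).2 ?scale0r ?addr0; last first.
      by apply: dfz; lra.
    by apply=> z z1 z0; apply: dq_diff z0 _; exact: (diff_line (inb z z1)).1.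
  have c1 := cav (p + w); rewrite addrAC subrr add0r in c1.
  have c2 := cav p; rewrite subrr nr0 in c2.
  have {c1}[K1 c1] := c1 wr; have {c2}[K2 c2] := c2 (ltac:(lra)).
  exists (maxn K1 K2) => k; rewrite geq_max => /andP[/c1 {}c1 /c2 {}c2].
  set X := cavg _ _ _ in c1; set Y := cavg _ _ _ in c2.
  have h : nr (X - Y - lam k w) <= B * nr w ^+ 2.
    rewrite /X /Y /lam -!cavgB; apply: cavg_le => t; rewrite nr1 => t1.
    have t0 : t != 0 by rewrite -nr_gt0 t1.
    rewrite /dq (negPf t0) !subr0 !scale0r !addr0 -!mulrBl nrM nrV t1 invr1 mulr1.
    have tt1 : nr (p + t *: v - p) <= r.
      by rewrite addrAC subrr add0r; have := lam_le t; rewrite t1 => /(_ (lexx _)); lra.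
    have T1 := taylor_bound r0 tf tt1 wr.
    have pp : nr (p - p) <= r by rewrite subrr nr0 ltW.
    have T2 := taylor_bound r0 tf pp wr.
    have -> : f (p + w + t *: v) - f (p + w) - (f (p + t *: v) - f p) -
       ('d f (p + t *: v) w - 'd f p w) =
       (f (p + t *: v + w) - f (p + t *: v) - 'd f (p + t *: v) w)
       - (f (p + w) - f p - 'd f p w) by rewrite (addrAC p w); ring.
    rewrite (le_trans (nrB _ _))// (le_trans (lerD T1 T2))//.
    have -> : B * nr w ^+ 2 = 4 * M / r ^+ 2 * nr w ^+ 2 + 4 * M / r ^+ 2 * nr w ^+ 2.
      by rewrite /B; ring.
    exact: lexx.
  have -> : 'd f (p + w) v - 'd f p v - lam k w =
    (X - Y - lam k w) - (X - 'd f (p + w) v) + (Y - 'd f p v) by ring.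
  set q1 := X - _ - _; set q2 := X - 'd _ _ _; set q3 := Y - 'd _ _ _.
  have := nrD (q1 - q2) q3; have := nrB q1 q2; rewrite /q1 /q2 /q3; lra.
have lamZ k (x : C) w : lam k (x *: w) = x * lam k w.
  rewrite /lam -cavgZ; congr cavg; apply/funext => t.
  have sc (y z : C) : (y *: z : C) = y * z by [].
  by rewrite !linearZ/= !sc; ring.
have lamD k w1 w2 : lam k (w1 + w2) = lam k w1 + lam k w2.
  rewrite /lam -cavgD; congr cavg; apply/funext => t.
  by rewrite !linearD/=; ring.
have lim w : exists l, forall e, 0 < e -> evle (fun k => lam k w - l) e.
  apply: cauchy_limit => e e0.
  pose S := B * nr w ^+ 2 + 1 + nr w; have S1 : 0 <= B * nr w ^+ 2 by rewrite mulr_ge0 ?sqr_ge0.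
  have w0 := nr_ge0 w.
  have S0 : 0 < S by rewrite /S; lra.
  (* For [w] itself [key] leaves the fixed error [B * nr w ^+ 2]. For [x *: w] this error is of
     order [x ^+ 2], and dividing by [x], by homogeneity of [lam k], makes it small. *)
  pose x := Num.min (r / 2 / S) (e / (4 * S)).
  have r2 : 0 < r / 2 / S by rewrite divr_gt0//; lra.
  have e4 : 0 < e / (4 * S) by rewrite divr_gt0//; lra.
  have x0 : 0 < x by rewrite lt_min r2.
  have x1 : x * S <= r / 2 by rewrite -ler_pdivlMr// ge_min lexx.
  have x2 : x * (4 * S) <= e by rewrite -ler_pdivlMr ?mulr_gt0// ge_min lexx orbT.
  have nx : nr (x%:C : C) = x by rewrite nrR gtr0_norm.
  have xw : nr (x%:C *: w) <= r / 2.
    rewrite nrZ nx (le_trans _ x1)// ler_wpM2l ?(ltW x0)// /S; lra.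
  have xe : 0 < x * (e / 4) by rewrite mulr_gt0//; lra.
  have [K HK] := key _ xw _ xe; exists K => k l /HK hk /HK hl.
  rewrite !lamZ nrZ nx in hk hl.
  set D := 'd f _ v - _ in hk hl.
  have xD : x * nr (lam k w - lam l w) <= 2 * (B * (x * nr w) ^+ 2 + x * (e / 4)).
    rewrite -nx -nrM nx.
    have -> : x%:C * (lam k w - lam l w) = (D - x%:C * lam l w) - (D - x%:C * lam k w) by ring.
    by rewrite (le_trans (nrB _ _))//; lra.
  rewrite -(ler_pM2l x0) (le_trans xD)//.
  have : x * (x * (B * nr w ^+2)) <= x * (e / 4).
    rewrite ler_wpM2l ?(ltW x0)//; rewrite /S in x2; nra.
  rewrite exprMn expr2; lra.
have [L HL] := choice lim.
exists L; split.
  move=> a x y; apply: evle_uniq (HL (a *: x + y)) _ => e e0.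
  have e1 : 0 < e / 2 / (nr a + 1) by rewrite divr_gt0 ?ltr_wpDl ?nr_ge0//; lra.
  have a1 : 0 < nr a + 1 by rewrite ltr_wpDl ?nr_ge0.
  have e2 : 0 < e / 2 by lra.
  have -> : e = e / 2 + e / 2 by field.
  have [K HK] := HL x _ e1.
  have h1 : evle (fun k => a * (lam k x - L x)) (e / 2).
    exists K => k /HK; rewrite ler_pdivlMr// nrM mulrC => h.
    by rewrite (le_trans _ h)// ler_wpM2r ?nr_ge0// lerDl.
  apply: evle_eq (evleD h1 (HL y _ e2)) => k.
  by rewrite lamD lamZ -[a *: L x]/(a * L x); ring.
  move=> w wr; apply/ler_addgt0Pr => e e0.
  have [K /(_ _ (leqnn _)) hK] := HL w _ e0.
  have h : nr (lam K w) <= 8 * M / r * nr w.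
    apply: cavg_le => t; rewrite nr1 => t1; rewrite nrM nrV t1 invr1 mulr1.
    have tt1 : nr (p + t *: v - p) <= r.
      by rewrite addrAC subrr add0r; have := lam_le t; rewrite t1 => /(_ (lexx _)); lra.
    have pp : nr (p - p) <= r by rewrite subrr nr0 ltW.
    have := diff_bound r0 tf tt1 wr; have := diff_bound r0 tf pp wr.
    have := nrB ('d f (p + t *: v) w) ('d f p w).
    have -> : 8 * M / r * nr w = 4 * M / r * nr w + 4 * M / r * nr w by ring.
    lra.
  have := nrB (lam K w) (lam K w - L w).
  have -> : lam K w - (lam K w - L w) = L w by ring.
  lra.
move=> w wr; apply/ler_addgt0Pr => e e0.
have e2 : 0 < e / 2 by lra.
have [K1 h1] := key w wr _ e2; have [K2 h2] := HL w _ e2.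
have := h1 _ (leq_maxl K1 K2); have := h2 _ (leq_maxr K1 K2).
set a := lam _ _; set D := 'd f _ v - _ => g1 g2.
have -> : D - L w = (D - a) + (a - L w) by ring.
by rewrite (le_trans (nrD _ _))// -/B; lra.
Qed.

(** Iterated, this yields the higher directional derivatives behind [dirn]; for coordinate
    directions, the regularity of Jacobian entries. A multiple of [v] is short enough for
    [dir_deriv_taylor]. *)
Lemma dir_deriv_diff f p v (d : R) : 0 < d ->
  (forall z, nr (z - p) < d -> differentiable f z) ->
  differentiable (fun z => 'd f z v) p.
Proof.
move=> d0 df; have [r [M [r0 rd tf]]] := tame_near d0 df.
have M0 := tame_ge0 r0 tf.
pose s := r / 2 / (nr v + 1); have v1 : 0 < nr v + 1 by rewrite ltr_wpDl ?nr_ge0.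
have s0 : 0 < s by rewrite divr_gt0//; lra.
have ns : nr (s%:C : C) = s by rewrite nrR gtr0_norm.
have sC : (s%:C : C) != 0 by rewrite -nr_gt0 ns.
have sv : nr (s%:C *: v) <= r / 2.
  rewrite nrZ ns /s mulrAC ler_pdivrMr// ler_wpM2l//; lra.
clearbody s.
have [L [lL Lb HL]] := dir_deriv_taylor r0 tf sv.
have lL' : linear (fun w => s%:C^-1 * L w).
  by move=> a x y; rewrite lL -[a *: L x]/(a * L x) -[a *: (_ * _)]/(a * (_ * _)); ring.
pose LM := GRing.isLinear.Build _ _ _ _ _ lL'.
pose LL : {linear V -> C} := HB.pack (fun w => s%:C^-1 * L w) LM.
pose B := 8 * M / r ^+ 2; have B0 : 0 <= B by rewrite divr_ge0 ?sqr_ge0 ?mulr_ge0.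
pose B1 := 8 * M / r; have B10 : 0 <= B1 by rewrite divr_ge0 ?mulr_ge0// ltW.
have sp e : 0 < e -> forall b, 0 <= b -> 0 < Num.min (r / 2) (e * s / (b + 1)).
  by move=> e0 b b0; rewrite lt_min; apply/andP; split; apply: divr_gt0; rewrite ?mulr_gt0//; lra.
have cL : continuous LL.
  move=> q; apply/nr_contP => e e0; exists (Num.min (r / 2) (e * s / (B1 + 1))); first exact: sp.
  move=> w; rewrite lt_min => /andP[w1 w2]; rewrite -linearB /= nrM nrV ns mulrC ltr_pdivrMr//.
  rewrite (le_lt_trans (Lb _ (ltW w1)))// -/B1.
  move: w2; rewrite ltr_pdivlMr; last lra.
  have := nr_ge0 (w - q); lra.
apply: (diff_nr cL _).1 => e e0; exists (Num.min (r / 2) (e * s / (B + 1))); first exact: sp.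
move=> w; rewrite lt_min => /andP[w1 w2] /=.
have E z : 'd f z v = s%:C^-1 * 'd f z (s%:C *: v).
  by rewrite linearZ/= -[_ *: _]/(_ * _) mulKf.
rewrite !E -!mulrBr nrM nrV ns mulrC ler_pdivrMr//.
rewrite (le_trans (HL _ (ltW w1)))// -/B.
move: w2; rewrite ltr_pdivlMr; last lra.
have w0 := nr_ge0 w => w2.
have : nr w * (nr w * (B + 1)) <= nr w * (e * s) by rewrite ler_wpM2l// ltW.
have := sqr_ge0 (nr w); nra.
Qed.

End LocalEstimates.

(** * Vector-valued maps and Jacobian matrices *)

Section RowVectors.
Local Open Scope complex_scope.
Context {R : realType}.
Notation C := R[i].

Lemma nr_coord n (x : 'rV[C]_n) i : nr (x ord0 i) <= nr x.
Proof.
rewrite -lecR -!nrE [leRHS]/Num.norm/= mx_normE -[leLHS]nngE num_le.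
exact: (le_bigmax _ (fun i : 'I_1 * 'I_n => (`|x i.1 i.2|%:nng)) (ord0, i)).
Qed.

Lemma nr_row_le n (x : 'rV[C]_n) (K : R) : 0 <= K -> (forall i, nr (x ord0 i) <= K) -> nr x <= K.
Proof.
move=> K0 h; rewrite -lecR -!nrE [leLHS]/Num.norm/=.
have [/eqP ->|] := boolP (mx_norm x == 0); first by rewrite ler0c.
move=> /mx_norm_neq0[[i j] ->]/=.
by rewrite ord1 nrE lecR.
Qed.

Lemma bounded_linear_cont (V W : normedModType C) (L : {linear V -> W}) (k : R) :
  (forall w, nr (L w) <= k * nr w) -> continuous L.
Proof.
move=> h p; apply/nr_contP => e e0.
have k1 : 0 < `|k| + 1 by rewrite ltr_wpDl.
exists (e / (`|k| + 1)); first by rewrite divr_gt0.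
move=> v; rewrite ltr_pdivlMr// -linearB => vd.
rewrite (le_lt_trans (h _))// (le_lt_trans _ vd)// mulrC ler_wpM2l ?nr_ge0//.
by have := ler_norm k; lra.
Qed.

Lemma diff_row (V : normedModType C) m (f : V -> 'rV[C]_m) p :
  (forall j, differentiable (fun z => f z ord0 j) p) ->
  differentiable f p /\ forall w, 'd f p w = \row_j 'd (fun z => f z ord0 j) p w.
Proof.
move=> df; pose L w := \row_j 'd (fun z => f z ord0 j) p w.
have lL : linear L by move=> a x y; apply/rowP => j; rewrite !mxE linearP.
pose LM := GRing.isLinear.Build _ _ _ _ _ lL.
pose LL : {linear V -> 'rV[C]_m} := HB.pack L LM.
have /choice[k hk] : forall j, exists k : R, 0 < k /\ forall h, nr ('d (fun z => f z ord0 j) p h) <= k * nr h.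
  by move=> j; have [k k0 hk] := diff_lip (df j); exists k.
have cL : continuous LL.
  apply: (@bounded_linear_cont _ _ _ (\sum_j k j)) => w.
  have k0 : 0 <= \sum_j k j by apply: sumr_ge0 => j _; apply: ltW; exact: (hk j).1.
  apply: nr_row_le => [|j]; first by rewrite mulr_ge0 ?nr_ge0.
  rewrite mxE (le_trans ((hk j).2 w))// ler_wpM2r ?nr_ge0//.
  by rewrite (bigD1 j)//= lerDl sumr_ge0// => i _; apply: ltW; exact: (hk i).1.
have [|d1 d2] := @diff_nr _ _ _ f p LL cL; last first.
  by split=> // w; rewrite d2.
move=> e e0.
have : \forall h \near (0 : V), forall j, nr (f (p + h) ord0 j - f p ord0 j - 'd (fun z => f z ord0 j) p h) <= e * nr h.
  apply: filter_forall => j; have [d d0 dP] := nr_diff (df j) e0.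
  by apply/nr_nbhsP; exists d => // h; rewrite subr0 => /dP.
move=> /nr_nbhsP[d d0 dP]; exists d => // h hd.
have {dP} := dP h; rewrite subr0 => /(_ hd) H.
apply: nr_row_le => [|j]; first by rewrite mulr_ge0 ?nr_ge0// ltW.
by rewrite !mxE.
Qed.

Lemma diff_coord (V : normedModType C) m (f : V -> 'rV[C]_m) p j :
  differentiable f p -> differentiable (fun z => f z ord0 j) p.
Proof.
move=> df; apply: (@differentiable_comp _ _ _ _ f (fun x : 'rV[C]_m => x ord0 j)) => //.
exact: differentiable_coord.
Qed.

Lemma diff_coordE (V : normedModType C) m (f : V -> 'rV[C]_m) p j w :
  differentiable f p -> 'd (fun z => f z ord0 j) p w = 'd f p w ord0 j.
Proof.
move=> df; have [_ ->] := diff_row (fun j => diff_coord j df).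
by rewrite mxE.
Qed.

Lemma tame_coord (V : normedModType C) m (f : V -> 'rV[C]_m) p r M j :
  tame f p r M -> tame (fun z => f z ord0 j) p r M.
Proof.
move=> tf z /tf[df bf]; split; first exact: diff_coord.
exact: le_trans (nr_coord _ _) bf.
Qed.

Lemma taylor_bound_row (V : normedModType C) m (f : V -> 'rV[C]_m) p r M u w :
  0 < r -> tame f p r M -> nr (u - p) <= r -> nr w <= r / 2 ->
  nr (f (u + w) - f u - 'd f u w) <= 4 * M / r ^+ 2 * nr w ^+ 2.
Proof.
move=> r0 tf up wr; have M0 := tame_ge0 r0 tf.
have [|df _] := tf u; first by lra.
apply: nr_row_le; first by rewrite mulr_ge0 ?sqr_ge0// divr_ge0 ?sqr_ge0// mulr_ge0.
by move=> j; rewrite !mxE -diff_coordE//; exact: (taylor_bound r0 (tame_coord j tf) up wr).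
Qed.

Lemma cauchy_limit_row n (u : nat -> 'rV[C]_n) :
  (forall e : R, 0 < e -> exists K, forall k l, (K <= k)%N -> (K <= l)%N -> nr (u k - u l) <= e) ->
  exists l, forall e : R, 0 < e -> exists K, forall k, (K <= k)%N -> nr (u k - l) <= e.
Proof.
move=> h; have /choice[l hl] : forall j, exists l, forall e, 0 < e -> evle (fun k => u k ord0 j - l) e.
  move=> j; apply: cauchy_limit => e /h[K hK]; exists K => k k' kK k'K.
  by have := nr_coord (u k - u k') j; rewrite !mxE => /le_trans; apply; exact: hK.
exists (\row_j l j) => e e0.
have /choice[K hK] := fun j => hl j e e0.
exists (\max_j K j)%N => k kK; apply: nr_row_le => [|j]; first exact: ltW.
by rewrite !mxE; apply: hK; rewrite (leq_trans _ kK)// leq_bigmax.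
Qed.

Lemma mxBE m n (A B : 'M[C]_(m, n)) i j : (A - B) i j = A i j - B i j.
Proof. by rewrite !mxE. Qed.

(** A crude majorant of the operator norm, small as soon as all entries are. *)
Definition mxn m n (A : 'M[C]_(m, n)) : R := \sum_i \sum_j nr (A i j).

Lemma mxn_ge0 m n (A : 'M[C]_(m, n)) : 0 <= mxn A.
Proof. by apply: sumr_ge0 => i _; apply: sumr_ge0 => j _; rewrite nr_ge0. Qed.

Lemma nr_mulmx m n (A : 'M[C]_(m, n)) (w : 'rV[C]_m) : nr (w *m A) <= mxn A * nr w.
Proof.
apply: nr_row_le => [|j]; first by rewrite mulr_ge0 ?mxn_ge0 ?nr_ge0.
rewrite mxE (le_trans (nr_sum _ _))// /mxn big_distrl/=; apply: ler_sum => i _.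
rewrite nrM mulrC ler_pM ?nr_ge0 ?nr_coord//.
by rewrite (bigD1 j)//= lerDl sumr_ge0// => *; exact: nr_ge0.
Qed.

Lemma diff_sum (V : normedModType C) (I : Type) (s : seq I) (F : I -> V -> C) p :
  (forall i, differentiable (F i) p) -> differentiable (fun z => \sum_(i <- s) F i z) p.
Proof.
move=> dF; elim: s => [|i s IH].
  have -> : (fun z => \sum_(i <- [::]) F i z) = cst 0 by apply/funext => z; rewrite big_nil.
  exact: differentiable_cst.
have -> : (fun z => \sum_(j <- i :: s) F j z) = (fun z => F i z + \sum_(j <- s) F j z).
  by apply/funext => z; rewrite big_cons.
exact: diff_add (dF i) IH.
Qed.

Lemma diff_prod (V : normedModType C) (I : Type) (s : seq I) (F : I -> V -> C) p :
  (forall i, differentiable (F i) p) -> differentiable (fun z => \prod_(i <- s) F i z) p.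
Proof.
move=> dF; elim: s => [|i s IH].
  have -> : (fun z => \prod_(i <- [::]) F i z) = cst 1 by apply/funext => z; rewrite big_nil.
  exact: differentiable_cst.
have -> : (fun z => \prod_(j <- i :: s) F j z) = (fun z => F i z * \prod_(j <- s) F j z).
  by apply/funext => z; rewrite big_cons.
exact: diff_mul (dF i) IH.
Qed.

Lemma diff_det (V : normedModType C) n (M : V -> 'M[C]_n) p :
  (forall i j, differentiable (fun z => M z i j) p) -> differentiable (fun z => \det (M z)) p.
Proof.
move=> dM; apply: diff_sum => s; apply: diff_mul; first exact: diff_const.
by apply: diff_prod => i; exact: dM.
Qed.

Lemma jacobianE n m (f : 'rV[C]_n -> 'rV[C]_m) p w : 'd f p w = w *m 'J f p.
Proof. by rewrite /jacobian mul_rV_lin1. Qed.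

Lemma jacobian_entry n m (f : 'rV[C]_n -> 'rV[C]_m) p i j :
  'J f p i j = 'd f p (delta_mx ord0 i) ord0 j.
Proof. by rewrite /jacobian mxE. Qed.

Lemma jacobian_diff n m (f : 'rV[C]_n -> 'rV[C]_m) p (d : R) i j : 0 < d ->
  (forall z, nr (z - p) < d -> differentiable f z) ->
  differentiable (fun z => 'J f z i j) p.
Proof.
move=> d0 df.
apply: (@diff_near_eq _ _ _ (fun z => 'd (fun z => f z ord0 j) z (delta_mx ord0 i)) _ _ d d0).
  by move=> v vd; rewrite jacobian_entry diff_coordE//; exact: df.
by apply: (dir_deriv_diff _ d0) => z zd; apply/diff_coord/df.
Qed.

Lemma jacobian_near n m (f : 'rV[C]_n -> 'rV[C]_m) p (d e : R) : 0 < d -> 0 < e ->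
  (forall z, nr (z - p) < d -> differentiable f z) ->
  exists2 d', 0 < d' & forall z, nr (z - p) < d' -> mxn ('J f z - 'J f p) <= e.
Proof.
move=> d0 e0 df; pose N : R := (n * m)%:R + 1.
have N0 : 0 < N by rewrite ltr_wpDl.
have : \forall z \near p, forall ij : 'I_n * 'I_m, nr ('J f z ij.1 ij.2 - 'J f p ij.1 ij.2) < e / N.
  apply: (@filter_forall _ _ (fun ij z => nr ('J f z ij.1 ij.2 - 'J f p ij.1 ij.2) < e / N) (nbhs p) _) => -[i j] /=.
  have /nr_contP/(_ _ (divr_gt0 e0 N0))[d' d'0 h] := differentiable_continuous (jacobian_diff i j d0 df).
  by apply/nr_nbhsP; exists d'.
move=> /nr_nbhsP[d' d'0 h]; exists d' => // z /h{}h.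
rewrite /mxn (@le_trans _ _ (\sum_(i < n) \sum_(j < m) (e / N)))//.
  apply: ler_sum => i _; apply: ler_sum => j _.
  rewrite mxBE.
  exact: ltW (h (i, j)).
under eq_bigr do rewrite sumr_const card_ord.
rewrite sumr_const card_ord -!mulrnA -mulr_natr mulrAC ler_pdivrMr//.
rewrite ler_wpM2l ?(ltW e0)// /N mulnC; lra.
Qed.

Lemma inj_unitmx n (A : 'M[C]_n) : (forall w : 'rV[C]_n, w *m A = 0 -> w = 0) -> A \in unitmx.
Proof.
move=> h; rewrite -row_free_unit -kermx_eq0; apply/eqP/row_matrixP => i.
by rewrite row0; apply: h; apply/sub_kermxP; exact: row_sub.
Qed.

End RowVectors.

(** * The inverse function theorem *)

Section LocalInverse.
Local Open Scope complex_scope.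
Context {R : realType}.
Notation C := R[i].

Lemma newton_identity n (h k : 'rV[C]_n) (J A : 'M[C]_n) : A \in unitmx ->
  h - k *m invmx A = - ((k - h *m J + h *m (J - A)) *m invmx A).
Proof.
by move=> uA; rewrite mulmxBr addrA subrK mulmxBl mulmxK// opprB.
Qed.

Lemma near_unitmx n (A X : 'M[C]_n) (c : R) : A \in unitmx -> 0 < c ->
  (forall w : 'rV[C]_n, nr (w *m invmx A) <= c * nr w) -> mxn (X - A) <= 1 / (4 * c) ->
  X \in unitmx.
Proof.
move=> uA c0 hB hX; apply: inj_unitmx => w wX.
have h1 : nr (w *m A) <= 1 / (4 * c) * nr w.
  have -> : w *m A = - (w *m (X - A)) by rewrite mulmxBr wX sub0r opprK.
  by rewrite nrN; apply: le_trans (nr_mulmx _ _) _; rewrite ler_wpM2r ?nr_ge0.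
have h2 := hB (w *m A); rewrite -mulmxA mulmxV// mulmx1 in h2.
have h3 : c * nr (w *m A) <= 1 / 4 * nr w.
  have -> : 1 / 4 * nr w = c * (1 / (4 * c) * nr w) by field; rewrite gt_eqF.
  by rewrite ler_wpM2l// ltW.
by apply/eqP; rewrite -nr_eq0 eq_le nr_ge0 andbT; have := nr_ge0 w; lra.
Qed.

(** The inverse Jacobian is applied to the Taylor expansion of [f] at [psi y]; the Lipschitz bound
    turns a remainder small against the increment of [psi] into one small against [k]. *)
Lemma right_inverse_diff n (f psi : 'rV[C]_n -> 'rV[C]_n) y (c e : R) : 0 < c -> 0 < e ->
  differentiable f (psi y) -> 'J f (psi y) \in unitmx ->
  f (psi y) = y ->
  (forall k, nr k < e -> f (psi (y + k)) = y + k /\ nr (psi (y + k) - psi y) <= c * nr k) ->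
  differentiable psi y.
Proof.
move=> c0 e0 df uX fy hpsi; set x := psi y in df uX fy hpsi.
pose L : {linear 'rV[C]_n -> 'rV[C]_n} := mulmxr (invmx ('J f x)).
have cL : continuous L by apply: (@bounded_linear_cont _ _ _ _ (mxn (invmx ('J f x)))) => w; exact: nr_mulmx.
apply: (diff_nr cL _).1 => e' e'0.
pose cx := mxn (invmx ('J f x)); have cx0 : 0 <= cx := mxn_ge0 _.
have cx1 : 0 < cx + 1 by rewrite ltr_wpDl.
have k0 : 0 < e' / ((cx + 1) * c) by rewrite divr_gt0// mulr_gt0.
have [d1 d10 hd1] := nr_diff df k0.
exists (Num.min e (d1 / c)); first by rewrite lt_min e0 divr_gt0.
move=> k; rewrite lt_min => /andP[ke kd].
have [fx' h1] := hpsi _ ke; rewrite -/x; set x' := psi _ in fx' h1 *.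
have xd1 : nr (x' - x) < d1.
  by apply: le_lt_trans h1 _; rewrite mulrC -ltr_pdivlMr.
have := hd1 _ xd1; have -> : x + (x' - x) = x' by rewrite addrC subrK.
rewrite fx' fy [y + k - y]addrAC subrr add0r jacobianE => h2.
have -> : x' - x - L k = - ((k - (x' - x) *m 'J f x) *m invmx ('J f x)).
  by rewrite mulmxBl mulmxK// opprB.
rewrite nrN; apply: le_trans (nr_mulmx _ _) _; rewrite -/cx.
apply: le_trans (ler_wpM2l cx0 h2) _.
have h3 : e' / ((cx + 1) * c) * nr (x' - x) <= e' / (cx + 1) * nr k.
  have -> : e' / (cx + 1) * nr k = e' / ((cx + 1) * c) * (c * nr k).
    by field; rewrite !gt_eqF.
  by rewrite ler_wpM2l// ltW.
apply: le_trans (ler_wpM2l cx0 h3) _.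
rewrite mulrA ler_wpM2r ?nr_ge0// mulrCA ler_piMr ?(ltW e'0)//.
by rewrite ler_pdivrMr// mul1r lerDl.
Qed.

(** The first step is at most [de / 4] and later steps at least halve, so the iterates never leave
    the ball of radius [de / 2]. *)
Lemma contraction_fixpoint n (T : 'rV[C]_n -> 'rV[C]_n) p (de : R) : 0 < de ->
  (forall x y, nr (x - p) <= de -> nr (y - p) <= de -> nr (T x - T y) <= 1 / 2 * nr (x - y)) ->
  nr (T p - p) <= de / 4 -> exists2 l, nr (l - p) <= de / 2 & T l = l.
Proof.
move=> de0 Tsub a0; pose z k := iter k T p.
have h0 k : (0 : R) <= 2^-1 ^+ k by rewrite exprn_ge0.
have q_le k : de / 2 * (1 - 2^-1 ^+ k) <= de / 2.
  by rewrite ler_piMr ?divr_ge0 ?(ltW de0)// lerBlDr lerDl.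
have inv k : nr (z k - p) <= de / 2 * (1 - 2^-1 ^+ k) /\ nr (z k.+1 - z k) <= de / 4 * 2^-1 ^+ k.
  elim: k => [|k [IH1 IH2]].
    by split; rewrite expr0 ?mulr1// [1 - 1]subrr mulr0 /z/= subrr nr0.
  have ih1 : nr (z k.+1 - p) <= de / 2 * (1 - 2^-1 ^+ k.+1).
    have -> : z k.+1 - p = (z k.+1 - z k) + (z k - p) by rewrite addrA subrK.
    apply: le_trans (nrD _ _) _; apply: le_trans (lerD IH2 IH1) _; rewrite exprS; lra.
  split; first exact: ih1.
  have k1 : nr (z k - p) <= de by have := q_le k; lra.
  have k2 : nr (z k.+1 - p) <= de by have := q_le k.+1; lra.
  apply: le_trans (Tsub _ _ k2 k1) _; rewrite exprS; lra.
have tail k m : nr (z (m + k)%N - z k) <= de / 2 * (2^-1 ^+ k - 2^-1 ^+ (m + k)).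
  elim: m => [|m IH]; first by rewrite add0n subrr nr0 subrr mulr0.
  have -> : z (m.+1 + k)%N - z k = (z (m + k).+1 - z (m + k)%N) + (z (m + k)%N - z k).
    by rewrite addrA subrK.
  apply: le_trans (nrD _ _) _; apply: le_trans (lerD (inv _).2 IH) _; rewrite addSn exprS; lra.
have bound k : nr (z k - p) <= de / 2 := le_trans (inv k).1 (q_le k).
have [l hl] : exists l, forall e : R, 0 < e -> exists K, forall k, (K <= k)%N -> nr (z k - l) <= e.
  apply: cauchy_limit_row => e' e'0.
  have [K hK] := half_small (divr_gt0 e'0 de0).
  exists K => k k' kK k'K.
  have t (i : nat) : (K <= i)%N -> nr (z i - z K) <= e' / 2.
    move=> /subnK <-; apply: le_trans (tail _ _) _.
    have : de / 2 * 2^-1 ^+ K <= e' / 2.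
      by have := hK K (leqnn _); rewrite ler_pdivlMr// => g; lra.
    have : 0 <= de / 2 * 2^-1 ^+ (i - K + K) by rewrite mulr_ge0 ?divr_ge0 ?(ltW de0).
    lra.
  have -> : z k - z k' = (z k - z K) - (z k' - z K) by rewrite opprB addrA subrK.
  by apply: le_trans (nrB _ _) _; have := t _ kK; have := t _ k'K; lra.
have lp : nr (l - p) <= de / 2.
  apply/ler_addgt0Pr => e' /hl[K /(_ _ (leqnn _))hK].
  have -> : l - p = (z K - p) - (z K - l) by rewrite opprB [RHS]addrC addrA subrK.
  by apply: le_trans (nrB _ _) _; have := bound K; lra.
exists l; first exact: lp.
apply/eqP; rewrite -subr_eq0 -nr_eq0 eq_le nr_ge0 andbT; apply/ler_addgt0Pr => e' e'0.
have e2 : 0 < e' / 2 by lra.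
have [K hK] := hl _ e2; rewrite add0r.
have -> : T l - l = (z K.+1 - l) - (T (z K) - T l) by rewrite opprB [RHS]addrC addrA subrK.
have k1 : nr (z K - p) <= de by have := bound K; lra.
have l1 : nr (l - p) <= de by lra.
have := Tsub _ _ k1 l1; have := hK _ (leqnn K); have := hK K.+1 (leqnSn _).
have := nrB (z K.+1 - l) (T (z K) - T l); have := nr_ge0 (z K - l); lra.
Qed.

Lemma local_inverse n (f : 'rV[C]_n -> 'rV[C]_n) p (d : R) : 0 < d ->
  (forall z, nr (z - p) < d -> differentiable f z) -> 'J f p \in unitmx ->
  exists psi, exists2 e : R, 0 < e & psi (f p) = p /\ forall y, nr (y - f p) < e ->
    [/\ f (psi y) = y, nr (psi y - p) < d & differentiable psi y].
Proof.
move=> d0 df uA; have := fun e e0 => @jacobian_near _ _ _ f p d e d0 e0 df.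
move: uA; move: ('J f p) => A uA hJac; pose B := invmx A.
pose c := mxn B + 1; have c1 : 0 < c by rewrite ltr_wpDl ?mxn_ge0.
have hB (w : 'rV[C]_n) : nr (w *m B) <= c * nr w.
  by rewrite (le_trans (nr_mulmx _ _))// ler_wpM2r ?nr_ge0// lerDl.
have [r [M [r0 rd tf]]] := tame_near d0 df; have M0 := tame_ge0 r0 tf.
have c4 : 0 < 1 / (4 * c) by rewrite divr_gt0// mulr_gt0.
have [d' d'0 hJ] := hJac _ c4.
pose Q := 4 * M / r ^+ 2; have Q0 : 0 <= Q by rewrite divr_ge0 ?sqr_ge0 ?mulr_ge0.
have q0 : 0 < 1 / (8 * c * (Q + 1)) by rewrite divr_gt0// !mulr_gt0//; lra.
(* Both errors in [newton_identity] are to be at most [1 / (4 * c)] times [nr (x - y)], so that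
   applying [B] gives the contraction factor [1 / 2]. For the Taylor remainder this means
   [Q * (2 * de) * (4 * c) <= 1]. *)
have [de [de0 der ded' dq]] : exists de : R, [/\ 0 < de, de <= r / 4, de < d' & de <= 1 / (8 * c * (Q + 1))].
  exists (Num.min (r / 4) (Num.min (d' / 2) (1 / (8 * c * (Q + 1))))).
  rewrite !lt_min !ge_min !gt_min q0 !lexx !orbT.
  by split=> //; [apply/andP; split; [lra|apply/andP; split=> //; lra]|apply/orP; right; apply/orP; left; lra].
have dec : de * (8 * c * (Q + 1)) <= 1.
  by move: dq; rewrite ler_pdivlMr// !mulr_gt0//; lra.
have ball_diff x : nr (x - p) <= de -> differentiable f x by move=> h; apply: df; lra.
have strict x y : nr (x - p) <= de -> nr (y - p) <= de ->
    nr (x - y - (f x - f y) *m B) <= 1 / 2 * nr (x - y).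
  move=> xp yp.
  have xy : nr (x - y) <= 2 * de.
    have -> : x - y = (x - p) - (y - p) by rewrite opprB addrA subrK.
    by rewrite (le_trans (nrB _ _))//; lra.
  rewrite /B (newton_identity _ _ ('J f y) uA).
  rewrite nrN (le_trans (hB _))//.
  have yr : nr (y - p) <= r by lra.
  have xyr : nr (x - y) <= r / 2 by lra.
  have := taylor_bound_row r0 tf yr xyr.
  have -> : y + (x - y) = x by rewrite addrC subrK.
  rewrite jacobianE => h1.
  have h2 : nr ((x - y) *m ('J f y - A)) <= 1 / (4 * c) * nr (x - y).
    rewrite (le_trans (nr_mulmx _ _))// ler_wpM2r ?nr_ge0//; apply: hJ.
    by rewrite (le_lt_trans yp).
  have h3 : Q * nr (x - y) ^+ 2 <= 1 / (4 * c) * nr (x - y).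
    rewrite expr2 mulrA ler_wpM2r ?nr_ge0// ler_pdivlMr ?mulr_gt0//.
    have : Q * nr (x - y) * (4 * c) <= Q * (2 * de) * (4 * c).
      by apply: ler_wpM2r; [rewrite mulr_ge0// ltW|apply: ler_wpM2l].
    move=> /le_trans; apply; have : 0 <= de * c by rewrite mulr_ge0// ltW.
    by move: dec; clear; lra.
  have -> : 1 / 2 * nr (x - y) = c * (1 / (4 * c) * nr (x - y) + 1 / (4 * c) * nr (x - y)).
    by field; rewrite gt_eqF.
  rewrite ler_wpM2l ?(ltW c1)// (le_trans (nrD _ _))// lerD//.
  exact: le_trans h1 h3.
have lipi x y : nr (x - p) <= de -> nr (y - p) <= de -> nr (x - y) <= 2 * c * nr (f x - f y).
  move=> xp yp; have := strict x y xp yp; have := hB (f x - f y).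
  have := nrD (x - y - (f x - f y) *m B) ((f x - f y) *m B); rewrite subrK.
  lra.
(* Then [c * e = de / 4], the bound on the first step in [contraction_fixpoint]. *)
pose e := de / (4 * c).
have e0 : 0 < e by rewrite divr_gt0// mulr_gt0.
have ec : c * e = de / 4 by rewrite /e; field; rewrite gt_eqF.
have sol y : exists z, nr (y - f p) < e -> nr (z - p) <= de / 2 /\ f z = y.
  have [yp|] := ltP (nr (y - f p)) e; last by exists 0.
  (* Newton's iteration with the inverse Jacobian frozen at [p]. *)
  pose T z := z - (f z - y) *m B.
  have Tsub x x' : nr (x - p) <= de -> nr (x' - p) <= de -> nr (T x - T x') <= 1 / 2 * nr (x - x').
    move=> xp xp'; have -> : T x - T x' = x - x' - (f x - f x') *m B.
      have -> : f x - f x' = (f x - y) - (f x' - y) by rewrite opprB addrA subrK.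
      rewrite /T; move: (f x - y) (f x' - y) => a b.
      by rewrite mulmxBl !opprD !opprK addrACA.
    exact: strict.
  have [|l lp Tl] := contraction_fixpoint de0 Tsub.
    rewrite /T addrAC subrr sub0r nrN (le_trans (hB _))// -ec ler_wpM2l ?(ltW c1)//.
    by rewrite nr_distC ltW.
  exists l => _; split=> //.
  have flB : (f l - y) *m B = 0.
    have -> : (f l - y) *m B = l - T l by rewrite /T subKr.
    by rewrite Tl subrr.
  have uB : B \in unitmx by rewrite unitmx_inv.
  by apply/eqP; rewrite -subr_eq0 -[f l - y](mulmxK uB) flB mul0mx.
have [psi hpsi] := choice sol.
exists psi, e => //.
have fpe : nr (f p - f p) < e by rewrite subrr nr0.
split.
  have [h1 h2] := hpsi _ fpe.
  have := lipi (psi (f p)) p; rewrite h2 !subrr !nr0 mulr0 => /(_ _ _) h.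
  apply/eqP; rewrite -subr_eq0 -nr_eq0 eq_le nr_ge0 andbT h//; lra.
move=> y ye; have [xp fx] := hpsi _ ye; split=> //; first lra.
set x := psi y in xp fx.
have xde : nr (x - p) <= de by lra.
have uX : 'J f x \in unitmx by apply: (near_unitmx uA c1 hB); apply: hJ; lra.
have c2 : 0 < 2 * c by rewrite mulr_gt0.
have ey : 0 < e - nr (y - f p) by rewrite subr_gt0.
apply: (right_inverse_diff c2 ey (ball_diff _ xde) uX fx) => k ke.
have yke : nr (y + k - f p) < e by rewrite addrAC; apply: le_lt_trans (nrD _ _) _; lra.
have [xp' fx'] := hpsi _ yke; split; first exact: fx'.
have xde' : nr (psi (y + k) - p) <= de by lra.
by have := lipi _ _ xde' xde; rewrite fx fx' addrAC subrr add0r.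
Qed.

End LocalInverse.

(** * Compactness of the circle and the mean value inequality *)

Section Compactness.
Local Open Scope complex_scope.
Context {R : realType}.
Notation C := R[i].

(** Compactness of the segment of angles from [-pi] to [pi]. By monotonicity the constant may be
    sought among the powers [2^-1 ^+ n], so a near-covering argument along [n] tending to infinity
    applies. *)
Lemma circle_uniform (P : C -> R -> Prop) :
  (forall z e e', e' <= e -> P z e -> P z e') ->
  (forall z, nr z = 1 -> exists2 e : R, 0 < e &
     forall z', nr z' = 1 -> nr (z' - z) < e -> P z' e) ->
  exists2 e : R, 0 < e & forall z, nr z = 1 -> P z e.
Proof.
move=> Pmono Ploc.
have nri (t : R) : nr (cexp (0 +i* t)) = 1 by rewrite nr_cexp expR0.
have /compact_near_coveringP cpt := @segment_compact R (- pi) pi.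
have := cpt nat \oo (fun n t => P (cexp (0 +i* t)) (2^-1 ^+ n)) _.
have H : forall t : R, `[- pi, pi]%classic t ->
    \forall t' \near t & n \near \oo, P (cexp (0 +i* t')) (2^-1 ^+ n).
  move=> t _; have [e e0 eP] := Ploc _ (nri t).
  have [d d0 dP] := (nr_contP _ _).1 (differentiable_continuous (cexp_diff (0 +i* t))) _ e0.
  have [N hN] := half_small e0.
  exists (ball t d, [set n | (N <= n)%N]) => /=.
    by split; [exact: nbhsx_ballx|exists N].
  move=> [t' n] /= [tt' Nn]; apply: Pmono (hN _ Nn) _; apply: eP => //.
  apply: dP; have -> : (0 +i* t') - (0 +i* t) = 'i%C * (t' - t)%:C.
    by apply/eqP; rewrite eq_complex/=; apply/andP; split; apply/eqP; ring.
  rewrite nrM nrR; suff -> : nr ('i%C : C) = 1 by rewrite mul1r distrC.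
  by rewrite /nr normc_def/= expr0n/= add0r expr1n sqrtr1.
move=> /(_ _ H)[N _ hN].
exists (2^-1 ^+ N); first by rewrite exprn_gt0.
move=> z z1; have z0 : z != 0 by rewrite -nr_gt0 z1.
have [w wpi wz] := cexp_polar z0.
have w0 : complex.Re w = 0 by apply: expR_inj; rewrite expR0 -nr_cexp wz z1.
have -> : z = cexp (0 +i* complex.Im w) by rewrite -wz; case: (w) w0 => a b /= ->.
by apply: (hN N) => /=; rewrite ?leqnn// in_itv/= -ler_norml.
Qed.

Lemma circle_pos (f : C -> C) : (forall z, nr z = 1 -> {for z, continuous f}) ->
  (forall z, nr z = 1 -> f z != 0) ->
  exists2 c : R, 0 < c & forall z, nr z = 1 -> c <= nr (f z).
Proof.
move=> cf f0; apply: (@circle_uniform (fun z c => c <= nr (f z))).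
  by move=> z e e' h; exact: le_trans.
move=> z z1; have fz : 0 < nr (f z) by rewrite nr_gt0 f0.
have fz2 : 0 < nr (f z) / 2 by lra.
have [d d0 dP] := (nr_contP _ _).1 (cf z z1) _ fz2.
exists (Num.min d (nr (f z) / 2)); first by rewrite lt_min d0.
move=> z' z'1; rewrite lt_min => /andP[/dP h _].
rewrite ge_min; apply/orP; right.
have := nr_lerB (f z) (f z'); rewrite nr_distC in h; lra.
Qed.

(* Mean value inequality: subdivide the segment into N equal steps and let N tend to infinity. *)
Lemma chain_bound (W : normedModType C) (g : C -> W) (B K de : R) : 0 <= K ->
  (forall s t, nr s <= de -> nr t <= de ->
     nr (g t - g s) <= B * nr (t - s) + K * nr (t - s) ^+ 2) ->
  forall t, nr t <= de -> nr (g t - g 0) <= B * nr t.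
Proof.
move=> K0 h t td.
have key N : nr (g t - g 0) <= B * nr t + K * nr t ^+ 2 / N.+1%:R.
  pose N1 : R := N.+1%:R; have N0 : 0 < N1 by rewrite ltr0n.
  have Nn : N1 != 0 by rewrite gt_eqF.
  pose s (j : nat) : C := (j%:R / N1)%:C * t.
  have nrs j : (j <= N.+1)%N -> nr (s j) <= de.
    move=> jN; rewrite nrM nrR ger0_norm ?divr_ge0// ?(ltW N0)//.
    apply: le_trans td; rewrite ler_piMl ?nr_ge0// ler_pdivrMr// mul1r ler_nat//.
  have step j : (j < N.+1)%N -> nr (g (s j.+1) - g (s j)) <= B * (nr t / N1) + K * (nr t / N1) ^+ 2.
    move=> jN; have := h _ _ (nrs _ (ltnW jN)) (nrs _ jN).
    suff -> : nr (s j.+1 - s j) = nr t / N1 by [].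
    have -> : s j.+1 - s j = (N1^-1)%:C * t.
      by rewrite /s -mulrBl -rmorphB/= -mulrBl -natrB// subSnn mul1r.
    by rewrite nrM nrR ger0_norm ?invr_ge0 ?(ltW N0)// mulrC.
  have tot j : (j <= N.+1)%N -> nr (g (s j) - g (s 0%N)) <= (B * (nr t / N1) + K * (nr t / N1) ^+ 2) * j%:R.
    elim: j => [|j IH] jN; first by rewrite subrr nr0 mulr0.
    have -> : g (s j.+1) - g (s 0%N) = (g (s j.+1) - g (s j)) + (g (s j) - g (s 0%N)).
      by rewrite addrA subrK.
    apply: le_trans (nrD _ _) _; rewrite -natr1 mulrDr mulr1 addrC lerD ?step//.
    exact: IH (ltnW jN).
  have := tot N.+1 (leqnn _).
  have -> : s N.+1 = t by rewrite /s divff// mul1r.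
  have -> : s 0%N = 0 by rewrite /s mul0r mul0r.
  by move=> /le_trans; apply; rewrite -/N1 le_eqVlt; apply/orP; left; apply/eqP; field.
apply/ler_addgt0Pr => e e0.
pose q := K * nr t ^+ 2; have q0 : 0 <= q by rewrite mulr_ge0 ?sqr_ge0.
have [N qN] : exists N : nat, e^-1 * q < N%:R.
  by exists (Num.truncn (e^-1 * q)).+1; rewrite truncnS_gt.
apply: le_trans (key N) _; rewrite lerD2l ler_pdivrMr// -ler_pdivrMl// -/q.
by apply: le_trans (ltW qN) _; rewrite ler_nat.
Qed.

End Compactness.

(** * Osgood's theorem: injective holomorphic maps are biholomorphic *)

Section InjectiveHolomorphic.
Local Open Scope complex_scope.
Context {R : realType}.
Notation C := R[i].

(** If [F 1] is of order [nr z ^+ k], the mean value inequality makes [F 0] of order [nr z ^+ k.+1].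
    A whole tower of derivatives is carried along so that the induction can drop its bottom term. *)
Lemma flat_tower k (F : nat -> C -> C) (d : R) : 0 < d ->
  (forall j z, nr z < d -> differentiable (F j) z /\ 'd (F j) z 1 = F j.+1 z) ->
  (forall j, (j < k)%N -> F j 0 = 0) ->
  exists c de : R, [/\ 0 <= c, 0 < de & forall z, nr z < de -> nr (F 0%N z) <= c * nr z ^+ k].
Proof.
move=> d0; elim: k F => [|k IH] F hF F0.
  have dF z : nr (z - 0) < d -> differentiable (F 0%N) z by rewrite subr0 => /(hF 0%N)[].
  have [r [M [r0 rd tf]]] := tame_near d0 dF.
  exists M, r; split; [exact: tame_ge0 r0 tf|exact: r0|].
  by move=> z zr; rewrite expr0 mulr1; apply: (tf z _).2; rewrite subr0; lra.
have [c [de [c0 de0 hc]]] := IH (fun j => F j.+1) (fun j => hF j.+1) (fun j => F0 j.+1).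
have dF z : nr (z - 0) < d -> differentiable (F 0%N) z by rewrite subr0 => /(hF 0%N)[].
have [r [M [r0 rd tf]]] := tame_near d0 dF; have M0 := tame_ge0 r0 tf.
exists c, (Num.min de (r / 4)); split; [exact: c0|by rewrite lt_min de0; lra|].
move=> z; rewrite lt_min => /andP[zd zr].
have K0 : 0 <= 4 * M / r ^+ 2 by rewrite divr_ge0 ?sqr_ge0 ?mulr_ge0.
have := @chain_bound R _ (F 0%N) (c * nr z ^+ k) (4 * M / r ^+ 2) (nr z) K0 _ z (lexx _).
rewrite F0// subr0 (exprSr (nr z)) mulrA; apply=> s t sz tz.
have sr : nr (s - 0) <= r by rewrite subr0; lra.
have tsr : nr (t - s) <= r / 2 by apply: le_trans (nrB _ _) _; lra.
have := taylor_bound r0 tf sr tsr; have -> : s + (t - s) = t by ring.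
have := nrD (F 0%N t - F 0%N s - 'd (F 0%N) s (t - s)) ('d (F 0%N) s (t - s)); rewrite subrK.
have sd : nr s < d by lra.
rewrite (diffC1 _ s (t - s)) (hF _ _ sd).2 nrM.
have : nr (t - s) * nr (F 1%N s) <= nr (t - s) * (c * nr z ^+ k).
  rewrite ler_wpM2l ?nr_ge0//; apply: (le_trans (hc s _)); first by lra.
  by rewrite ler_wpM2l// lerXn2r ?nnegrE ?nr_ge0.
set q := 4 * M / r ^+ 2 * _ => h1 h2 h3; lra.
Qed.

Definition dirn (V : normedModType C) (a : V) k (g : V -> C) : V -> C :=
  iter k (fun h z => 'd h z a) g.

Lemma dirn_diff (V : normedModType C) (g : V -> C) y0 a (d : R) k :
  (forall z, nr (z - y0) < d -> differentiable g z) ->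
  forall z, nr (z - y0) < d -> differentiable (dirn a k g) z.
Proof.
move=> dg; elim: k => [|k IH] z zd; first exact: dg.
have d0 : 0 < d - nr (z - y0) by rewrite subr_gt0.
apply: (dir_deriv_diff _ d0) => w wd; apply: IH.
have -> : w - y0 = (w - z) + (z - y0) by rewrite addrA subrK.
by apply: le_lt_trans (nrD _ _) _; lra.
Qed.

Lemma identity_line (V : normedModType C) (g : V -> C) y0 a (r M d : R) : 0 < r -> 2 * r < d ->
  (forall z, nr (z - y0) < d -> differentiable g z) -> tame g y0 r M -> nr a <= r ->
  (forall k, dirn a k g y0 = 0) -> forall z : C, nr z < 1 -> g (y0 + z *: a) = 0.
Proof.
move=> r0 rd dg tg ar h.
pose F k (z : C) := dirn a k g (y0 + z *: a).
have inb (z : C) (c : R) : nr z <= c -> nr (y0 + z *: a - y0) <= c * r.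
  by move=> zc; rewrite addrAC subrr add0r nrZ ler_pM ?nr_ge0.
have hF j z : nr z < 2 -> differentiable (F j) z /\ 'd (F j) z 1 = F j.+1 z.
  move=> z2; apply: (@diff_line R V _ (dirn a j g)).
  by apply: (dirn_diff a j dg); apply: le_lt_trans (inb _ _ (ltW z2)) _.
have hF0 j : F j 0 = 0 by rewrite /F scale0r addr0 h.
have M0 := tame_ge0 r0 tg.
apply: (@flat_zero R (F 0%N)).
  by move=> z z1; apply: (hF 0%N z _).1; lra.
move=> k; have [c [de [c0 de0 hc]]] := @flat_tower k F 2 (ltac:(lra)) hF (fun j _ => hF0 j).
(* [c] serves where [nr z < de]; elsewhere [M] is at most [M / de ^+ k * nr z ^+ k]. *)
exists (c + M / de ^+ k) => z z1.
have q0 : 0 <= M / de ^+ k by rewrite divr_ge0// exprn_ge0// ltW.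
have p0 : 0 <= nr z ^+ k by rewrite exprn_ge0 ?nr_ge0.
have [zd|zd] := ltP (nr z) de.
  by apply: le_trans (hc z zd) _; rewrite ler_wpM2r// lerDl.
have gM : nr (F 0%N z) <= M.
  by apply: (tg _ _).2; apply: le_trans (inb z 1 z1) _; lra.
apply: le_trans gM _; rewrite mulrDl -[X in X <= _]add0r lerD ?mulr_ge0//.
rewrite mulrAC ler_pdivlMr ?exprn_gt0// ler_wpM2l// lerXn2r ?nnegrE ?nr_ge0//.
exact: ltW.
Qed.

(** A quantitative form of the implicit function theorem. Between two zeros differing by [w],
    Taylor's formula bounds ['d K z w] by [Q * nr w ^+ 2]; near [z0] the part of this bound
    proportional to [nr s] is absorbed by [s * 'd K z a]. *)
Lemma zero_lip (V : normedModType C) (K : V -> C) z0 a b (d : R) : 0 < d ->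
  (forall z, nr (z - z0) < d -> differentiable K z) -> 'd K z0 a != 0 ->
  exists eta c : R, [/\ 0 < eta, 0 <= c & forall z (s t : C),
    nr (z - z0) < eta -> nr (z + (s *: a + t *: b) - z0) < eta -> K z = 0 ->
    K (z + (s *: a + t *: b)) = 0 -> nr s <= c * nr t].
Proof.
move=> d0 dK ka; pose kap := nr ('d K z0 a).
have kap0 : 0 < kap by rewrite nr_gt0.
have kap2 : 0 < kap / 2 by lra.
have [e1 e10 h1] := (nr_contP _ _).1 (differentiable_continuous (dir_deriv_diff a d0 dK)) _ kap2.
have [e2 e20 h2] := (nr_contP _ _).1 (differentiable_continuous (dir_deriv_diff b d0 dK)) _ (@ltr01 R).
have [r [M [r0 rd tf]]] := tame_near d0 dK; have M0 := tame_ge0 r0 tf.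
pose Q := 4 * M / r ^+ 2; have Q0 : 0 <= Q by rewrite divr_ge0 ?sqr_ge0 ?mulr_ge0.
have a0 := nr_ge0 a; have b0 := nr_ge0 b.
have Qa : 0 <= Q * nr a by rewrite mulr_ge0.
have Qa8 : 0 < 8 * (Q * nr a + 1) by lra.
pose be := nr ('d K z0 b) + 1.
have be0 : 0 < be by rewrite /be; have := nr_ge0 ('d K z0 b); lra.
(* The last condition gives [2 * eta * Q * nr a <= kap / 4]: of the lower bound [kap / 2] for
   ['d K z a], [kap / 4] survives the absorption. *)
have [eta [eta0 et1 et2 etr etQ]] : exists eta : R, [/\ 0 < eta, eta <= e1, eta <= e2, eta <= r / 4 & eta <= kap / (8 * (Q * nr a + 1))].
  exists (Num.min (Num.min e1 e2) (Num.min (r / 4) (kap / (8 * (Q * nr a + 1))))).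
  by rewrite !lt_min !ge_min !lexx !orbT e10 e20 !divr_gt0// ?orbT.
have etQ' : eta * (8 * (Q * nr a + 1)) <= kap by move: etQ; rewrite ler_pdivlMr.
exists eta, ((be + 2 * eta * Q * nr b) * 4 / kap); split; first exact: eta0.
  have etb : 0 <= eta * Q * nr b by exact: (mulr_ge0 (mulr_ge0 (ltW eta0) Q0) b0).
  by apply: divr_ge0; [lra|exact: ltW].
move=> z s t zz wz Kz Kw.
set w := s *: a + t *: b in wz Kw.
have we : nr w < 2 * eta.
  have -> : w = (z + w - z0) - (z - z0) by rewrite opprB addrA subrK addrC addKr.
  by apply: le_lt_trans (nrB _ _) _; lra.
have wab : nr w <= nr s * nr a + nr t * nr b.
  by apply: le_trans (nrD _ _) _; rewrite !nrZ.
have zr : nr (z - z0) <= r by lra.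
have wr : nr w <= r / 2 by lra.
have := taylor_bound r0 tf zr wr; rewrite Kz Kw subrr sub0r nrN -/Q => hT.
have hdw : 'd K z w = s * 'd K z a + t * 'd K z b by rewrite /w linearD !linearZ.
have kz : kap / 2 <= nr ('d K z a).
  have := h1 z (lt_le_trans zz et1); have := nr_lerB ('d K z0 a) ('d K z a).
  by rewrite nr_distC -/kap; lra.
have bz : nr ('d K z b) <= be.
  have := h2 z (lt_le_trans zz et2); have := nrD ('d K z b - 'd K z0 b) ('d K z0 b).
  by rewrite subrK /be; lra.
have g1 : nr s * (kap / 2) <= nr ('d K z w) + nr t * be.
  apply: (@le_trans _ _ (nr (s * 'd K z a))); first by rewrite nrM ler_wpM2l ?nr_ge0.
  have -> : s * 'd K z a = 'd K z w - t * 'd K z b by rewrite hdw addrK.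
  apply: le_trans (nrB _ _) _; rewrite lerD2l nrM ler_wpM2l ?nr_ge0//.
have g2 : Q * nr w ^+ 2 <= Q * (2 * eta) * (nr s * nr a + nr t * nr b).
  rewrite expr2 mulrA; apply: ler_pM; last exact: wab.
  - exact: mulr_ge0 Q0 (nr_ge0 _).
  - exact: nr_ge0.
  - exact: ler_wpM2l Q0 _ _ (ltW we).
have s0 := nr_ge0 s.
have g3 : nr s * (eta * (8 * (Q * nr a + 1))) <= nr s * kap by rewrite ler_wpM2l.
have g4 : 0 <= nr s * eta by rewrite mulr_ge0// ltW.
rewrite mulrAC ler_pdivlMr//; clear - g1 g2 g3 g4 hT; lra.
Qed.

End InjectiveHolomorphic.

(** * Curves of zeros of a holomorphic function *)

Section ZeroCurves.
Local Open Scope complex_scope.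
Context {R : realType}.
Notation C := R[i].

(** [m.+1] is the least order at which some zero of [g] in the ball has a nonzero derivative along
    [a]; hence order [m] vanishes at every zero. The least order is not [0], as [g] vanishes at its
    zeros. *)
Lemma minimal_order (V : normedModType C) (g : V -> C) y0 a (d : R) k0 : 0 < d ->
  g y0 = 0 -> dirn a k0 g y0 != 0 ->
  exists m z0, [/\ nr (z0 - y0) < d, g z0 = 0, 'd (dirn a m g) z0 a != 0 &
     forall z, nr (z - y0) < d -> g z = 0 -> dirn a m g z = 0].
Proof.
move=> d0 gy0 k0P.
pose P m := `[< exists z, [/\ nr (z - y0) < d, g z = 0 & dirn a m g z != 0] >].
have exP : exists m, P m by exists k0; apply/asboolP; exists y0; rewrite subrr nr0.
case: (ex_minnP exP) => -[|m] /asboolP[z0 [z0d gz0 z0m]] mmin.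
  by rewrite /dirn/= gz0 eqxx in z0m.
exists m, z0; split; [exact: z0d|exact: gz0|exact: z0m|].
move=> z zd gz; apply/eqP/negPn/negP => h.
have : P m by apply/asboolP; exists z.
by move=> /mmin; rewrite ltnn.
Qed.

(* Hurwitz: near an isolated zero of [g] in the direction [a], the zero persists when the line is moved. *)
Lemma zero_persists (V : normedModType C) (g : V -> C) z0 a b (de r M : R) : 0 < r -> 0 < de ->
  tame g z0 r M -> de * nr a <= r -> g z0 = 0 ->
  (forall z : C, nr z <= de -> z != 0 -> g (z0 + z *: a) != 0) ->
  exists2 tau : R, 0 < tau & forall t : C, nr t <= tau ->
    exists2 z : C, nr z <= de & g (z0 + (z *: a + t *: b)) = 0.
Proof.
move=> r0 de0 tg ar gz0 ginj; have M0 := tame_ge0 r0 tg.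
have nde (u : C) : nr (de%:C * u) = de * nr u by rewrite nrM nrR gtr0_norm.
have ina (u : C) : nr u <= 1 -> nr (z0 + (de%:C * u) *: a - z0) <= r.
  move=> u1; rewrite addrAC subrr add0r nrZ nde; apply: le_trans ar.
  by rewrite ler_wpM2r ?nr_ge0// ler_piMr// ltW.
have cfg (u : C) (v : V) : differentiable g (z0 + v + (de%:C * u) *: a) ->
    differentiable (fun u : C => g (z0 + v + (de%:C * u) *: a)) u.
  move=> dg; have -> : (fun u : C => g (z0 + v + (de%:C * u) *: a)) = (fun u : C => g (z0 + v + u *: (de%:C *: a))).
    by apply/funext => w; rewrite scalerA mulrC.
  by apply: (diff_line _).1; rewrite scalerA mulrC.
have deC : (de%:C : C) != 0 by rewrite -nr_gt0 nrR gtr0_norm.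
have [c c0 hc] : exists2 c : R, 0 < c & forall u : C, nr u = 1 -> c <= nr (g (z0 + 0 + (de%:C * u) *: a)).
  apply: circle_pos => u u1.
    apply: differentiable_continuous; apply: cfg; apply: (tg _ _).1; rewrite addr0.
    by have := ina u; rewrite u1 => /(_ (lexx _)); lra.
  rewrite addr0; apply: ginj; first by rewrite nde u1 mulr1.
  by rewrite mulf_neq0// -nr_gt0 u1.
pose L := 2 * M / r; have L0 : 0 <= L by apply: divr_ge0; [lra|exact: ltW].
have b1 : 0 < nr b + 1 by rewrite ltr_wpDl ?nr_ge0.
have L1 : 0 < 4 * (L + 1) by lra.
exists (Num.min (r / 2) (c / (4 * (L + 1))) / (nr b + 1)).
  by rewrite divr_gt0// lt_min !divr_gt0.
move=> t; rewrite ler_pdivlMr// le_min => /andP[t1 t2].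
have tb : nr (t *: b) <= nr t * (nr b + 1).
  by rewrite nrZ ler_wpM2l ?nr_ge0// lerDl.
have tbr : nr (t *: b) <= r / 2 by exact: le_trans tb t1.
have tbc : L * nr (t *: b) <= c / 4.
  have : nr (t *: b) * (4 * (L + 1)) <= c by rewrite -ler_pdivlMr// (le_trans tb t2).
  have := nr_ge0 (t *: b); lra.
(* Without a zero on the moved disc, [min_center] would give modulus at least [c / 2] at its centre
   [z0 + t *: b], where [lip_bound] and [g z0 = 0] allow at most [c / 4]. *)
apply: contrapT => noz.
have {}noz (u : C) : nr u <= 1 -> g (z0 + t *: b + (de%:C * u) *: a) != 0.
  move=> u1; apply/eqP => gu; apply: noz; exists (de%:C * u).
    by rewrite nde ler_piMr// ltW.
  by rewrite [_ *: a + _]addrC addrA.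
have inab (u : C) : nr u <= 1 -> nr (z0 + t *: b + (de%:C * u) *: a - z0) <= 2 * r.
  move=> u1; have -> : z0 + t *: b + (de%:C * u) *: a - z0 = (z0 + (de%:C * u) *: a - z0) + t *: b.
    by rewrite (addrAC z0) (addrAC (z0 + _)).
  by apply: le_trans (nrD _ _) _; have := ina u u1; lra.
have c2 : 0 < c / 2 by lra.
have := @min_center R (fun u => g (z0 + t *: b + (de%:C * u) *: a)) (c / 2) c2 _ _ noz.
have df u : nr u <= 1 -> differentiable (fun u : C => g (z0 + t *: b + (de%:C * u) *: a)) u.
  by move=> u1; apply: cfg; apply: (tg _ _).1; exact: inab.
rewrite mulr0 scale0r addr0 => H.
have : c / 2 <= nr (g (z0 + t *: b)).
  apply: H.
  - by move=> z z1 _; exact: df.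
  - by apply/differentiable_continuous/df; rewrite nr0.
  - move=> u u1; have u1' : nr u <= 1 by rewrite u1.
    have := lip_bound r0 tg (ina u u1') tbr; rewrite -/L.
    have := hc u u1; rewrite addr0.
    have := nr_lerB (g (z0 + (de%:C * u) *: a)) (g (z0 + (de%:C * u) *: a + t *: b)).
    rewrite [z0 + _ *: b + _]addrAC (nr_distC (g (z0 + (de%:C * u) *: a))); lra.
have z0r : nr (z0 - z0) <= r by rewrite subrr nr0 ltW.
have := lip_bound r0 tg z0r tbr; rewrite gz0 subr0 -/L; lra.
Qed.

(* At a zero of [g] of minimal order along [a], all nearby zeros of [g] are simple zeros of one
   iterated derivative, so those in the plane of [a] and [b] form a Lipschitz curve; [E] has
   zero derivative along it, hence is constant on it. *)
Lemma no_curve (V : normedModType C) m (E : V -> 'rV[C]_m) (g : V -> C) y0 a b (r M d : R) :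
  0 < r -> 2 * r < d -> tame g y0 r M -> nr a <= r ->
  (forall z, nr (z - y0) < d -> differentiable E z) ->
  (forall z, nr (z - y0) < d -> differentiable g z) ->
  (forall s t : C, s *: a + t *: b = 0 -> t = 0) ->
  (forall z, nr (z - y0) < d -> g z = 0 -> 'd E z a = 0 /\ 'd E z b = 0) ->
  g y0 = 0 -> g (y0 + 2^-1 *: a) != 0 ->
  exists z z', [/\ nr (z - y0) < d, nr (z' - y0) < d, z != z' & E z = E z'].
Proof.
move=> r0 rd tg ar dE dg indep Ez gy0 ga.
have d0 : 0 < d by lra.
have [k0 hk0] : exists k, dirn a k g y0 != 0.
  apply: contrapT => h; move/eqP: ga; apply.
  apply: (identity_line r0 rd dg tg ar) => [k|].
    by apply/eqP/negPn/negP => hk; apply: h; exists k.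
  by rewrite nrV nr_natC; lra.
have [k [z0 [z0d gz0 ka kmin]]] := minimal_order d0 gy0 hk0.
pose K := dirn a k g; pose d1 := d - nr (z0 - y0).
have d10 : 0 < d1 by rewrite subr_gt0.
have sub z : nr (z - z0) < d1 -> nr (z - y0) < d.
  move=> zz; have -> : z - y0 = (z - z0) + (z0 - y0) by rewrite addrA subrK.
  by apply: le_lt_trans (nrD _ _) _; rewrite /d1 in zz; lra.
have dK z : nr (z - z0) < d1 -> differentiable K z by move=> /sub; exact: dirn_diff.
have [eta [c [eta0 c0 hlip]]] := zero_lip b d10 dK ka.
have [rg [Mg [rg0 rgd tgz]]] := tame_near d10 (fun z zz => dg z (sub z zz)).
have [rE [ME [rE0 rEd tE]]] := tame_near d10 (fun z zz => dE z (sub z zz)).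
have a0 := nr_ge0 a; have b0 := nr_ge0 b.
have a1 : 0 < nr a + 1 by lra.
have b1 : 0 < nr b + 1 by lra.
have [rho [rho0 rho1 rho2 rho3 rho4]] : exists rho : R, [/\ 0 < rho, rho <= eta / 4, rho <= rg, rho <= rE / 8 & rho <= d1 / 4].
  exists (Num.min (Num.min (eta / 4) rg) (Num.min (rE / 8) (d1 / 4))).
  by rewrite !lt_min !ge_min !lexx !orbT rg0 !divr_gt0.
pose de := rho / (nr a + 1).
have de0 : 0 < de by rewrite divr_gt0.
have dea : de * nr a <= rho.
  by rewrite /de mulrAC ler_pdivrMr// ler_wpM2l ?(ltW rho0)// lerDl.
have inz (z t : C) : nr z <= de -> nr t <= rho / (nr b + 1) -> nr (z0 + (z *: a + t *: b) - z0) <= 2 * rho.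
  move=> zde tb; rewrite addrAC subrr add0r; apply: le_trans (nrD _ _) _; rewrite !nrZ.
  have : nr z * nr a <= de * nr a by rewrite ler_wpM2r.
  have : nr t * nr b <= rho.
    have : nr t * (nr b + 1) <= rho by rewrite -ler_pdivlMr.
    have := nr_ge0 t; lra.
  lra.
(* The bound of [zero_lip] with [t = 0] isolates the zero [z0] on its line along [a]. *)
have inj1 (z : C) : nr z <= de -> z != 0 -> g (z0 + z *: a) != 0.
  move=> zde zn; apply/eqP => gz.
  have E0 : z *: a = z *: a + 0 *: b by rewrite scale0r addr0.
  have t0 : nr (0 : C) <= rho / (nr b + 1) by rewrite nr0 divr_ge0 ?ltW.
  have zz := inz z 0 zde t0.
  have : nr z <= c * nr (0 : C).
    apply: (hlip z0).
    - by rewrite subrr nr0.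
    - by apply: le_lt_trans zz _; lra.
    - exact: kmin.
    - apply: kmin; last by rewrite -E0.
      by apply: sub; apply: le_lt_trans zz _; lra.
  by rewrite nr0 mulr0 leNgt nr_gt0 zn.
have [tau tau0 htau] := zero_persists b rg0 de0 tgz (le_trans dea rho2) gz0 inj1.
(* One zero is picked for each [t] without any continuity; [zero_lip] makes the resulting curve
   Lipschitz afterwards. *)
have /choice[zeta hzeta] : forall t : C, exists z : C, nr t <= tau ->
    nr z <= de /\ g (z0 + (z *: a + t *: b)) = 0.
  move=> t; have [/htau[z z1 z2]|] := boolP (nr t <= tau); first by exists z.
  by exists 0.
pose T := Num.min tau (rho / (nr b + 1)).
have T0 : 0 < T by rewrite lt_min tau0 divr_gt0.
have Ttau : T <= tau by rewrite ge_min lexx.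
have Trho : T <= rho / (nr b + 1) by rewrite ge_min lexx orbT.
pose p t := z0 + (zeta t *: a + t *: b).
have pin t : nr t <= T -> nr (p t - z0) <= 2 * rho.
  move=> tT; apply: inz; last exact: le_trans tT Trho.
  exact: (hzeta t (le_trans tT Ttau)).1.
have pg t : nr t <= T -> g (p t) = 0.
  by move=> tT; exact: (hzeta t (le_trans tT Ttau)).2.
have pball t : nr t <= T -> nr (p t - y0) < d.
  by move=> tT; apply: sub; apply: le_lt_trans (pin t tT) _; lra.
have pd s t : p t - p s = (zeta t - zeta s) *: a + (t - s) *: b.
  by rewrite /p opprD addrACA subrr add0r opprD addrACA -!scalerBl.
have plip s t : nr s <= T -> nr t <= T -> nr (p t - p s) <= (c * nr a + nr b) * nr (t - s).
  move=> sT tT; have : nr (zeta t - zeta s) <= c * nr (t - s).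
    have Et : p s + ((zeta t - zeta s) *: a + (t - s) *: b) = p t by rewrite -pd addrC subrK.
    apply: (hlip (p s)); rewrite ?Et.
    - by apply: le_lt_trans (pin s sT) _; lra.
    - by apply: le_lt_trans (pin t tT) _; lra.
    - by apply: kmin (pball s sT) (pg s sT).
    - by apply: kmin (pball t tT) (pg t tT).
  move=> h; rewrite pd; apply: le_trans (nrD _ _) _; rewrite !nrZ.
  have : nr (zeta t - zeta s) * nr a <= c * nr (t - s) * nr a by rewrite ler_wpM2r.
  lra.
pose Q := 4 * ME / rE ^+ 2; have Q0 : 0 <= Q.
  by apply: divr_ge0; [rewrite mulr_ge0// (tame_ge0 rE0 tE)|exact: sqr_ge0].
have K0 : 0 <= Q * (c * nr a + nr b) ^+ 2 by rewrite mulr_ge0 ?sqr_ge0.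
(* The differential of [E] kills [a] and [b] at points of the curve, so only the quadratic remainder
   is left, and [chain_bound] with slope [0] gives constancy. *)
have step s t : nr s <= T -> nr t <= T ->
    nr (E (p t) - E (p s)) <= 0 * nr (t - s) + Q * (c * nr a + nr b) ^+ 2 * nr (t - s) ^+ 2.
  move=> sT tT; rewrite mul0r add0r.
  have pr : nr (p s - z0) <= rE by have := pin s sT; lra.
  have pr2 : nr (p t - p s) <= rE / 2.
    have -> : p t - p s = (p t - z0) - (p s - z0) by rewrite opprB addrA subrK.
    by apply: le_trans (nrB _ _) _; have := pin s sT; have := pin t tT; lra.
  have := taylor_bound_row rE0 tE pr pr2.
  have -> : p s + (p t - p s) = p t by rewrite addrC subrK.
  have [Ea Eb] := Ez _ (pball s sT) (pg s sT).
  have -> : 'd E (p s) (p t - p s) = 0.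
    by rewrite pd linearD !linearZ/= Ea Eb !scaler0 addr0.
  rewrite subr0 => /le_trans; apply; rewrite -/Q -mulrA ler_wpM2l// -exprMn.
  by rewrite lerXn2r ?nnegrE ?plip ?nr_ge0// mulr_ge0 ?nr_ge0// addr_ge0// mulr_ge0.
have nT : nr (T%:C : C) = T by rewrite nrR gtr0_norm.
have hT : nr (T%:C : C) <= T by rewrite nT.
have h0 : nr (0 : C) <= T by rewrite nr0 ltW.
have hE := chain_bound K0 step hT; rewrite mul0r in hE.
exists (p T%:C), (p 0); split; [exact: pball|exact: pball| |].
  apply/eqP => pp; have := pd 0 T%:C; rewrite pp subrr => /esym/indep.
  rewrite subr0 => /(congr1 (fun z : C => nr z)); rewrite nT nr0 => T00.
  by rewrite T00 ltxx in T0.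
by apply/eqP; rewrite -subr_eq0 -nr_eq0 eq_le nr_ge0 hE.
Qed.

End ZeroCurves.

(** * Injective functions of one variable *)

Section OneVariable.
Local Open Scope complex_scope.
Context {R : realType}.
Notation C := R[i].
Lemma deriv_small (e : C -> C) (d eps : R) : 0 < d ->
  (forall z, nr (z - 0) < d -> differentiable e z) -> 'd e 0 1 = 0 -> 0 < eps ->
  exists2 eta : R, 0 < eta & forall z, nr z < eta -> nr ('d e z 1) < eps.
Proof.
move=> d0 de e00 eps0; pose G (z : C) : C := 'd e z 1.
have G0 : G 0 = 0 by exact: e00.
have cG : {for 0, continuous G}.
  exact: differentiable_continuous (dir_deriv_diff (1 : C) d0 de).
have [eta eta0 h] := (nr_contP _ _).1 cG _ eps0.
by exists eta => // z zeta; have := h z; rewrite !subr0 G0 subr0; exact.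
Qed.

(* If [e'] vanishes at [0], take [z0 -> 0] with [e' z0 != 0]: the quotient [dq e z0] has no zero,
   is bounded below on a circle around [z0], but tends to [0] at the centre. *)
Lemma inj_deriv_neq0 (e : C -> C) (d : R) : 0 < d ->
  (forall z, nr z < d -> differentiable e z) ->
  (forall z w, nr z < d -> nr w < d -> e z = e w -> z = w) ->
  'd e 0 1 != 0.
Proof.
move=> d0 de ie; apply/eqP => e00.
have de' z : nr (z - 0) < d -> differentiable e z by rewrite subr0; exact: de.
have [r [M [r0 rd te]]] := tame_near d0 de'; have M0 := tame_ge0 r0 te.
have rC : nr (r%:C : C) = r by rewrite nrR gtr0_norm.
have rn0 : (r%:C : C) != 0 by rewrite -nr_gt0 rC.
have [c c0 hc] : exists2 c : R, 0 < c & forall u : C, nr u = 1 -> c <= nr (e (r%:C * u) - e 0).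
  apply: (@circle_pos R (fun u => e (r%:C * u) - e 0)) => u u1.
    have ru : nr (r%:C * u) < d by rewrite nrM rC u1 mulr1; lra.
    apply: differentiable_continuous; apply: diff_sub; last exact: diff_const.
    have := @diff_line R C C e 0 r%:C u; rewrite add0r.
    have -> : (fun s : C => e (0 + s *: r%:C)) = (fun u => e (r%:C * u)).
      by apply/funext => s; rewrite add0r mulrC.
    by rewrite -[u *: _]/(u * _) mulrC => h; exact: (h (de _ ru)).1.
  rewrite subr_eq0; apply/eqP => /ie h; have /eqP : r%:C * u = 0.
    by apply: h; [rewrite nrM rC u1 mulr1; lra|rewrite nr0].
  by rewrite mulf_eq0 (negPf rn0)/= -nr_eq0 u1 oner_eq0.
pose L := 2 * M / r; have L0 : 0 <= L by apply: divr_ge0; [lra|exact: ltW].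
have c2r : 0 < c / (4 * r) by rewrite divr_gt0// mulr_gt0.
have [d1 d10 hd1] := deriv_small d0 de' e00 c2r.
have L1 : 0 < 8 * (L + 1) by lra.
(* Moving the centre from [0] to [z0] costs at most [2 * (c / 8)] on the circle, so the quotient
   stays above [c / (2 * r)] there, while [eta < d1] keeps the derivative at [z0] below
   [c / (4 * r)]. *)
have [eta [eta0 eta1 eta2 eta3]] : exists eta : R, [/\ 0 < eta, eta < d1, eta <= r / 8 & eta <= c / (8 * (L + 1))].
  exists (Num.min (d1 / 2) (Num.min (r / 8) (c / (8 * (L + 1))))).
  rewrite !lt_min !ge_min !lexx !orbT !divr_gt0//; split=> //.
  by rewrite gt_min; apply/orP; left; lra.
have etaL : eta * (8 * (L + 1)) <= c by rewrite -ler_pdivlMr.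
(* Otherwise the derivative vanishes near [0] and [e] is constant there, against injectivity. *)
have [z0 z0e z0n] : exists2 z0, nr z0 <= eta & 'd e z0 1 != 0.
  apply: contrapT => h.
  have K0 : 0 <= 4 * M / r ^+ 2 by apply: divr_ge0; [lra|exact: sqr_ge0].
  have st (s t : C) : nr s <= eta -> nr t <= eta ->
      nr (e t - e s) <= 0 * nr (t - s) + 4 * M / r ^+ 2 * nr (t - s) ^+ 2.
    move=> sT tT; rewrite mul0r add0r.
    have sr : nr (s - 0) <= r by rewrite subr0; lra.
    have tsr : nr (t - s) <= r / 2 by apply: le_trans (nrB _ _) _; lra.
    have := taylor_bound r0 te sr tsr; have -> : s + (t - s) = t by ring.
    have -> : 'd e s (t - s) = 0; last by rewrite subr0.
    rewrite diffC1; have -> : 'd e s 1 = 0; last by rewrite mulr0.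
    by apply/eqP/negPn/negP => hs; apply: h; exists s.
  have ne : nr (eta%:C : C) = eta by rewrite nrR gtr0_norm.
  have he : nr (eta%:C : C) <= eta by rewrite ne.
  have := chain_bound K0 st he; rewrite mul0r => ee.
  have /ie E : e eta%:C = e 0 by apply/eqP; rewrite -subr_eq0 -nr_eq0 eq_le nr_ge0 ee.
  have : nr (eta%:C : C) = 0 by rewrite E ?nr0// ne; lra.
  by rewrite ne => ee0; rewrite ee0 ltxx in eta0.
have z0d : differentiable e z0 by apply: de; lra.
pose H u := dq e z0 (z0 + r%:C * u).
have nru u : nr (r%:C * u) = r * nr u by rewrite nrM rC.
have inb u : nr u <= 1 -> nr (z0 + r%:C * u) < d.
  move=> u1; apply: le_lt_trans (nrD _ _) _; rewrite nru.
  have : r * nr u <= r by rewrite ler_piMr// ltW.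
  lra.
have hu u : u != 0 -> z0 + r%:C * u != z0.
  move=> u0; rewrite -subr_eq0 addrAC subrr add0r mulf_neq0//.
have c4 : 0 < c / (2 * r) by rewrite divr_gt0// mulr_gt0.
have lin_d u : differentiable (fun u : C => z0 + r%:C * u) u.
  by apply: diff_add; [exact: diff_const|apply: diff_mul; [exact: diff_const|exact: diff_id]].
have : c / (2 * r) <= nr (H 0).
  apply: min_center c4 _ _ _ _.
  - move=> u u1 u0; apply: (@differentiable_comp _ _ _ _ (fun u : C => z0 + r%:C * u) (dq e z0)); first exact: lin_d.
    by apply: dq_diff (hu u u0) _; exact: de (inb u u1).
  - apply: (@continuous_comp _ _ _ (fun u : C => z0 + r%:C * u) (dq e z0)).
      exact: differentiable_continuous (lin_d 0).
    by rewrite mulr0 addr0; exact: dq_cont.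
  - move=> u u1; rewrite /H; have [->|u0] := eqVneq u 0.
      by rewrite mulr0 addr0 /dq eqxx.
    rewrite /dq (negPf (hu u u0)) mulf_neq0// ?invr_eq0 subr_eq0 ?hu//.
    by apply: contraNneq (hu u u0) => /ie -> //; [exact: inb|lra].
  - move=> u u1; have u0 : u != 0 by rewrite -nr_gt0 u1.
    rewrite /H /dq (negPf (hu u u0)) nrM nrV.
    have -> : z0 + r%:C * u - z0 = r%:C * u by ring.
    rewrite nru u1 mulr1 ler_pdivlMr//.
    have -> : c / (2 * r) * r = c / 2 by field; rewrite gt_eqF.
    have pr : nr (r%:C * u - 0) <= r by rewrite subr0 nru u1 mulr1.
    have qr : nr z0 <= r / 2 by lra.
    have z0' : nr (0 - 0 : C) <= r by rewrite subr0 nr0 ltW.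
    have h1 := lip_bound r0 te pr qr.
    have := lip_bound r0 te z0' qr; rewrite add0r => h2.
    have := hc u u1 => h3.
    have Lz : L * nr z0 <= c / 8.
      have : L * nr z0 <= L * eta by rewrite ler_wpM2l.
      lra.
    rewrite -/L in h1 h2.
    have -> : e (z0 + r%:C * u) - e z0 = (e (r%:C * u) - e 0) + ((e (r%:C * u + z0) - e (r%:C * u)) - (e z0 - e 0)).
      by rewrite (addrC z0); ring.
    set A := e (r%:C * u) - e 0 in h3 *; set B1 := _ - e (r%:C * u) in h1 *; set B2 := e z0 - e 0 in h2 *.
    have := nr_lerB A (- (B1 - B2)); rewrite opprK nrN.
    have := nrB B1 B2; lra.
rewrite /H mulr0 addr0 /dq eqxx.
have h1 := hd1 _ (le_lt_trans z0e eta1).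
have : c / (2 * r) = 2 * (c / (4 * r)) by field; rewrite gt_eqF.
lra.
Qed.

End OneVariable.

(** * Singular Jacobians of injective maps in several variables *)

Section Osgood.
Local Open Scope complex_scope.
Context {R : realType}.
Notation C := R[i].

(** As [w *m X = w - w *m Y], this vector lies in the row spaces of both [X] and [B]. These span
    everything, so by the rank condition they meet only in [0]. *)
Lemma split_kernel n (X Y B : 'M[C]_n) (w : 'rV[C]_n) : X + Y = 1%:M -> (Y <= B)%MS ->
  (\rank X + \rank B <= n)%N -> (w <= B)%MS -> w *m X = 0.
Proof.
move=> XY YB rXB wB.
have wX : (w *m X <= X :&: B)%MS.
  rewrite sub_capmx submxMl /=.
  have -> : w *m X = w - w *m Y by rewrite -[w in w - _]mulmx1 -XY mulmxDr addrK.
  by rewrite addmx_sub// eqmx_opp (submx_trans (submxMl _ _)).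
have full : (n <= \rank (X + B)%MS)%N.
  rewrite -[X in (X <= _)%N](mxrank1 C n); apply: mxrankS; rewrite -XY.
  by rewrite addmx_sub_adds.
have : \rank (X :&: B)%MS = 0%N.
  have := mxrank_sum_cap X B => h.
  apply/eqP; rewrite -leqn0 -(leq_add2l n) addn0 (leq_trans _ rXB)// -h.
  by rewrite leq_add2r.
move=> /eqP; rewrite mxrank_eq0 => /eqP X0.
by move: wX; rewrite X0 submx0 => /eqP.
Qed.

(** In the factorisation of [A] through its rank idempotent, the complementary idempotent supplies
    exactly the missing rank. *)
Lemma complement_matrix n (A : 'M[C]_n) : exists2 B : 'M[C]_n,
  A + B \in unitmx & \rank B = (n - \rank A)%N.
Proof.
exists (col_ebase A *m copid_mx (\rank A) *m row_ebase A).
  rewrite -[X in X + _]mulmx_ebase -mulmxDl -mulmxDr /copid_mx addrC subrK mulmx1.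
  by rewrite unitmx_mul col_ebase_unit row_ebase_unit.
rewrite mxrankMfree ?row_free_unit ?row_ebase_unit//.
rewrite (eqmxMfull _ _) ?row_full_unit ?col_ebase_unit//.
by rewrite rank_copid_mx// rank_leq_row.
Qed.

Lemma diff_addE (V W : normedModType C) (f g : V -> W) p w :
  differentiable f p -> differentiable g p ->
  'd (fun v => f v + g v) p w = 'd f p w + 'd g p w.
Proof. by move=> df dg; have := diffD df dg => /(congr1 (fun L => L w)). Qed.

(* [f \o psi] is the identity modulo the row space of [B]. *)
Lemma straighten n (f : 'rV[C]_n -> 'rV[C]_n) p (d : R) (B : 'M[C]_n) : 0 < d ->
  (forall z, nr (z - p) < d -> differentiable f z) -> 'J f p + B \in unitmx ->
  exists psi, exists2 e : R, 0 < e & psi (f p) = p /\ forall y, nr (y - f p) < e ->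
    [/\ f (psi y) + (psi y - p) *m B = y, nr (psi y - p) < d, differentiable psi y,
        differentiable (f \o psi) y &
        'J psi y *m 'J f (psi y) + 'J psi y *m B = 1%:M /\
        forall w, 'd (f \o psi) y w = w *m ('J psi y *m 'J f (psi y))].
Proof.
move=> d0 df uAB; pose H z := f z + (z - p) *m B.
have dB z : differentiable (fun z => (z - p) *m B) z /\ forall w, 'd (fun z => (z - p) *m B) z w = w *m B.
  pose L : {linear 'rV[C]_n -> 'rV[C]_n} := mulmxr B.
  have cL : continuous L by apply: (@bounded_linear_cont _ _ _ _ (mxn B)) => w; exact: nr_mulmx.
  have [|d1 d2] := @diff_nr _ _ _ (fun z => (z - p) *m B) z L cL.
    move=> e e0; exists 1 => // h _ /=.
    by rewrite [z + h - p]addrAC mulmxDl [_ + h *m B]addrC addrK subrr nr0 mulr_ge0 ?nr_ge0// ltW.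
  by split=> // w; rewrite d2.
have dH z : nr (z - p) < d -> differentiable H z by move=> /df dfz; exact: diff_add dfz (dB z).1.
have dHE z w : nr (z - p) < d -> 'd H z w = w *m ('J f z + B).
  move=> /df dfz; apply: (etrans (diff_addE w dfz (dB z).1)).
  exact: etrans (f_equal2 +%R (jacobianE f z w) ((dB z).2 w)) (esym (mulmxDr _ _ _)).
have JH z : nr (z - p) < d -> 'J H z = 'J f z + B.
  move=> zd; apply/row_matrixP => i; rewrite !rowE -jacobianE dHE//.
have Hp : H p = f p by rewrite /H subrr mul0mx addr0.
have pp : nr (p - p) < d by rewrite subrr nr0.
have uH : 'J H p \in unitmx by rewrite JH.
have [psi [e e0 [psip hpsi]]] := local_inverse d0 dH uH.
rewrite Hp in psip hpsi.
exists psi, e => //; split; first exact: psip.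
move=> y ye; have [Hy psid dpsi] := hpsi y ye.
have dfp := df _ psid.
have dfpsi : differentiable (f \o psi) y by exact: differentiable_comp dpsi dfp.
split; [exact: Hy|exact: psid|exact: dpsi|exact: dfpsi|split].
  have dHpsi : differentiable (H \o psi) y by exact: differentiable_comp dpsi (dH _ psid).
  have e1 : 0 < e - nr (y - f p) by rewrite subr_gt0.
  have dI : 'd (H \o psi) y = id :> ('rV[C]_n -> 'rV[C]_n).
    have cI : continuous (idfun : {linear 'rV[C]_n -> 'rV[C]_n}) by move=> ?.
    apply: (diff_nr cI _).2 => e' e'0; exists (e - nr (y - f p)) => // h he /=.
    have [-> _ _] := hpsi (y + h) (ltac:(rewrite addrAC; apply: le_lt_trans (nrD _ _) _; lra)).
    by rewrite Hy (addrAC y h) subrr add0r subrr nr0 mulr_ge0 ?nr_ge0// ltW.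
  have PE (w : 'rV[C]_n) : w *m ('J psi y *m ('J f (psi y) + B)) = w.
    have jw : w *m 'J psi y = 'd psi y w := esym (jacobianE psi y w).
    rewrite mulmxA jw.
    apply: (etrans (esym (dHE (psi y) ('d psi y w) psid))).
    have c := diff_comp dpsi (dH _ psid).
    exact: (etrans (esym (congr1 (fun L => L w) c)) (congr1 (fun L => L w) dI)).
  rewrite -mulmxDr; apply/row_matrixP => i; apply: (etrans (rowE _ _)).
  by apply: (etrans (PE _)); rewrite rowE mulmx1.
move=> w; have c := diff_comp dpsi dfp.
apply: (etrans (congr1 (fun L => L w) c)); apply: (etrans (jacobianE f _ _)).
have jw : w *m 'J psi y = 'd psi y w := esym (jacobianE psi y w).
by rewrite mulmxA jw.
Qed.

(* At a singular point [p] of maximal rank, [straighten] with [B] a complement of ['J f p]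
   makes the derivative of [E = f \o psi] vanish on the row space [W] of [B] at every singular
   point nearby.  If [W] is a line this contradicts [inj_deriv_neq0]; otherwise the singular
   set contains a curve parallel to [W], or all of [W], on which [E] is constant. *)
Lemma osgood n (f : 'rV[C]_n -> 'rV[C]_n) (U : set 'rV[C]_n) :
  open U -> (forall z, U z -> differentiable f z) -> set_inj U f ->
  forall p, U p -> 'J f p \in unitmx.
Proof.
move=> oU dU injU p0 Up0; apply: contrapT => /negP sing0.
pose P r := `[< exists p, [/\ U p, 'J f p \notin unitmx & \rank ('J f p) = r] >].
have exP : exists r, P r by exists (\rank ('J f p0)); apply/asboolP; exists p0.
have bndP r : P r -> (r <= n)%N by move=> /asboolP[q [_ _ <-]]; exact: rank_leq_row.
case: (ex_maxnP exP bndP) => r /asboolP[p [Up singp rp]] rmax.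
have [d d0 dP] := (nr_openP U).1 oU _ Up.
have df z : nr (z - p) < d -> differentiable f z by move=> /dP; exact: dU.
have [B uAB rB] := complement_matrix ('J f p); rewrite rp in rB.
have rn : (r < n)%N.
  rewrite ltn_neqAle bndP ?andbT; last by apply/asboolP; exists p.
  by apply: contraNneq singp => rE; rewrite -row_free_unit -row_leq_rank rp rE.
have [psi [e e0 [psip hpsi]]] := straighten d0 df uAB.
set y0 := f p in psip hpsi; pose E := f \o psi.
pose g y := \det ('J f (psi y)).
have gE y : g y = 0 -> 'J f (psi y) \notin unitmx.
  by move=> gy; rewrite unitmxE unitfE -/(g y) gy eqxx.
have gy0 : g y0 = 0 by apply/eqP; move: singp; rewrite unitmxE unitfE negbK /g psip.
have injE y y' : nr (y - y0) < e -> nr (y' - y0) < e -> E y = E y' -> y = y'.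
  move=> ye ye' Ey; have [h1 h2 _ _ _] := hpsi y ye; have [h1' h2' _ _ _] := hpsi y' ye'.
  have pp : psi y = psi y' by apply: injU; [exact: mem_set (dP _ h2)|exact: mem_set (dP _ h2')|exact: Ey].
  by rewrite -h1 -h1' pp.
have dE y : nr (y - y0) < e -> differentiable E y by move=> /hpsi[].
have dg y : nr (y - y0) < e -> differentiable g y.
  move=> ye; have [_ h2 h3 _ _] := hpsi y ye.
  apply: (@differentiable_comp _ _ _ _ psi (fun z => \det ('J f z))); first exact: h3.
  apply: diff_det => i j; have d1 : 0 < d - nr (psi y - p) by rewrite subr_gt0.
  apply: (jacobian_diff i j d1) => z zd; apply: df.
  have -> : z - p = (z - psi y) + (psi y - p) by rewrite addrA subrK.
  by apply: le_lt_trans (nrD _ _) _; lra.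
(* Maximality of [r] enters here: it bounds the rank of ['J f] at every nearby singular point, which
   is the rank condition of [split_kernel]. *)
have kerE y w : nr (y - y0) < e -> g y = 0 -> (w <= B)%MS -> 'd E y w = 0.
  move=> ye gy wB; have [_ h2 _ _ [h4 h5]] := hpsi y ye.
  rewrite h5; apply: (split_kernel h4) wB; first exact: submxMl.
  rewrite rB; have : (\rank ('J psi y *m 'J f (psi y)) <= r)%N.
    apply: leq_trans (mxrankM_maxr _ _) _; apply: rmax; apply/asboolP.
    by exists (psi y); split; [exact: dP|exact: gE|].
  by move=> h; apply: leq_trans (leq_add h (leqnn _)) _; rewrite subnKC// ltnW.
have yy0 : nr (y0 - y0) < e by rewrite subrr nr0.
have [r2|r1] := ltnP 1 (n - r).
  have [rg [Mg [rg0 rge tg]]] := tame_near e0 dg.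
  have [a [aB ar ga]] : exists a : 'rV[C]_n, [/\ (a <= B)%MS, nr a <= rg & g (y0 + 2^-1 *: a) != 0].
    (* Otherwise [g] vanishes near [y0] on the whole translate of the row space of [B]; by [kerE]
       the map [E] is then constant on a segment, against injectivity. *)
    apply: contrapT => h.
    have g0 w : (w <= B)%MS -> nr w <= rg / 2 -> g (y0 + w) = 0.
      move=> wB wr; apply/eqP/negPn/negP => gw; apply: h; exists (2 *: w); split.
      - exact: scalemx_sub.
      - by rewrite nrZ nr_natC; lra.
      - by rewrite scalerA mulVf ?scale1r// pnatr_eq0.
    have [w wB w0] : exists2 w : 'rV[C]_n, (w <= B)%MS & w != 0.
      have : B != 0 by rewrite -mxrank_eq0 rB -lt0n ltnW.
      by move=> /rowV0Pn.
    have [rE [ME [rE0 rEe tE]]] := tame_near e0 dE.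
    have wp : 0 < nr w by rewrite nr_gt0.
    pose de := Num.min (rg / 2) (rE / 4) / nr w.
    have m0 : 0 < Num.min (rg / 2) (rE / 4) by rewrite lt_min !divr_gt0.
    have de0 : 0 < de by rewrite divr_gt0.
    have small (t : C) : nr t <= de -> nr (t *: w) <= rg / 2 /\ nr (t *: w) <= rE / 4.
      move=> td; have : nr (t *: w) <= Num.min (rg / 2) (rE / 4) by rewrite nrZ -ler_pdivlMr.
      by rewrite le_min => /andP[].
    have ME0 := tame_ge0 rE0 tE.
    have K0 : 0 <= 4 * ME / rE ^+ 2 * nr w ^+ 2.
      by apply: mulr_ge0; [apply: divr_ge0; [lra|exact: sqr_ge0]|exact: sqr_ge0].
    have st (s t : C) : nr s <= de -> nr t <= de ->
        nr (E (y0 + t *: w) - E (y0 + s *: w)) <= 0 * nr (t - s) + 4 * ME / rE ^+ 2 * nr w ^+ 2 * nr (t - s) ^+ 2.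
      move=> /small[s1 s2] /small[t1 t2]; rewrite mul0r add0r.
      have sr : nr (y0 + s *: w - y0) <= rE by rewrite addrAC subrr add0r; lra.
      have tsr : nr ((t - s) *: w) <= rE / 2.
        by rewrite scalerBl; apply: le_trans (nrB _ _) _; lra.
      have := taylor_bound_row rE0 tE sr tsr.
      have -> : y0 + s *: w + (t - s) *: w = y0 + t *: w by rewrite -addrA -scalerDl addrC [s + _]addrC subrK addrC.
      rewrite kerE ?subr0; first 1 last.
      - by rewrite addrAC subrr add0r; lra.
      - by apply: g0 s1; exact: scalemx_sub.
      - exact: scalemx_sub.
      by rewrite nrZ exprMn => /le_trans; apply; rewrite -[X in _ <= X]mulrA [_ ^+ 2 * _ ^+ 2]mulrC.
    have nde : nr (de%:C : C) = de by rewrite nrR gtr0_norm.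
    have hde : nr (de%:C : C) <= de by rewrite nde.
    have := chain_bound K0 st hde; rewrite mul0r scale0r addr0 => hE.
    have : y0 + de%:C *: w = y0.
      apply: injE => //; first by rewrite addrAC subrr add0r; have := (small _ hde).1; lra.
      by apply/eqP; rewrite -subr_eq0 -nr_eq0 eq_le nr_ge0 hE.
    move=> /eqP; rewrite -subr_eq0 addrAC subrr add0r scaler_eq0 (negPf w0) orbF -nr_eq0 nde.
    by rewrite gt_eqF.
  have [b bB bna] : exists2 b : 'rV[C]_n, (b <= B)%MS & ~~ (b <= a)%MS.
    have : ~~ (B <= a)%MS.
      apply/negP => /mxrankS; rewrite rB => h.
      by have := leq_trans h (rank_leq_row a); rewrite leqNgt r2.
    by move=> /row_subPn[i hi]; exists (row i B) => //; exact: row_sub.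
  have indep (s t : C) : s *: a + t *: b = 0 -> t = 0.
    move=> st; apply/eqP/negPn/negP => t0; move/negP: bna; apply.
    have -> : b = (- (t^-1 * s)) *: a.
      apply: (scalerI t0); rewrite scalerA mulrN mulrA mulfV// mul1r scaleNr.
      by apply/eqP; rewrite eq_sym -subr_eq0 -opprD oppr_eq0 st.
    exact: scalemx_sub.
  have Ez z : nr (z - y0) < e -> g z = 0 -> 'd E z a = 0 /\ 'd E z b = 0.
    by move=> ze gz; split; apply: kerE.
  have [z [z' [ze z'e zz Ezz]]] := no_curve rg0 rge tg ar dE dg indep Ez gy0 ga.
  by move/eqP: zz; apply; exact: injE.
have rB1 : \rank B = 1%N by rewrite rB; apply/eqP; rewrite eqn_leq r1 subn_gt0.
have [w wB w0] : exists2 w : 'rV[C]_n, (w <= B)%MS & w != 0.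
  have : B != 0 by rewrite -mxrank_eq0 rB1.
  by move=> /rowV0Pn.
have Bw : (B <= w)%MS.
  by rewrite -(mxrank_leqif_sup wB).2 rB1 rank_rV w0.
have [i wi] : exists i, w ord0 i != 0 by apply/rV0Pn.
pose h (t : C) := E (y0 + t *: w) ord0 i.
have wp : 0 < nr w by rewrite nr_gt0.
have inb (t : C) : nr t < e / nr w -> nr (y0 + t *: w - y0) < e.
  by move=> te; rewrite addrAC subrr add0r nrZ -ltr_pdivlMr.
have dEi (t : C) : nr t < e / nr w -> differentiable (fun z => E z ord0 i) (y0 + t *: w).
  by move=> te; apply: diff_coord; exact: dE (inb t te).
(* [E y] differs from [y] by an element of the row space of [B], here the line of [w]. So [E] maps
   the line through [y0] into itself, and injectivity passes to the single coordinate [h]. *)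
have mult (t : C) : nr t < e / nr w -> exists c, E (y0 + t *: w) = y0 + c *: w.
  move=> te; have [h1 _ _ _ _] := hpsi _ (inb t te).
  set v := psi (y0 + t *: w) - p in h1.
  have /sub_rVP[c hc] : (v *m B <= w)%MS.
    exact: submx_trans (submxMl _ _) Bw.
  exists (t - c); rewrite scalerBl -hc addrA -[y0 + t *: w in RHS]h1 addrK.
  by [].
have ew : 0 < e / nr w by rewrite divr_gt0.
have := @inj_deriv_neq0 R h (e / nr w) ew.
have -> : 'd h 0 1 = 0.
  have h0 : nr (0 : C) < e / nr w by rewrite nr0.
  rewrite (diff_line (dEi 0 h0)).2 scale0r addr0 diff_coordE; last exact: dE.
  by rewrite kerE// mxE.
rewrite eqxx => H; suff : false by []; apply: H.
  by move=> t te; exact: (diff_line (dEi t te)).1.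
move=> s t se te; rewrite /h; have [c Ec] := mult s se; have [c' Ec'] := mult t te.
rewrite Ec Ec' !mxE => /addrI/(mulIf wi) cc.
have : y0 + s *: w = y0 + t *: w.
  by apply: injE; [exact: inb|exact: inb|rewrite Ec Ec' cc].
move=> /addrI/eqP; rewrite -subr_eq0 -scalerBl scaler_eq0 (negPf w0) orbF subr_eq0.
by move=> /eqP.
Qed.

(** Injectivity identifies the set-theoretic inverse [g] with the differentiable one from
    [local_inverse], available because [osgood] makes the Jacobian invertible. *)
Lemma inverse_holomorphic n (f g : 'rV[C]_n -> 'rV[C]_n) (U : set 'rV[C]_n) q (eps : R) :
  open U -> (forall z, U z -> differentiable f z) -> set_inj U f -> 0 < eps ->
  (forall y, nr (y - q) < eps -> U (g y) /\ f (g y) = y) -> differentiable g q.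
Proof.
move=> oU dU injU eps0 hg.
have [Up fp] : U (g q) /\ f (g q) = q by apply: hg; rewrite subrr nr0.
have [d d0 dP] := (nr_openP U).1 oU _ Up.
have df z : nr (z - g q) < d -> differentiable f z by move=> /dP; exact: dU.
have [psi [e e0 [_ hpsi]]] := local_inverse d0 df (osgood oU dU injU Up).
rewrite fp in hpsi.
have m0 : 0 < Num.min e eps by rewrite lt_min e0.
apply: (@diff_near_eq _ _ _ psi g _ _ m0).
  move=> y; rewrite lt_min => /andP[ye yeps].
  have [h1 h2 _] := hpsi y ye; have [h3 h4] := hg y yeps.
  by apply: injU; [exact: mem_set (dP _ h2)|exact: mem_set|rewrite h1 h4].
by have [|_ _] := hpsi q; first by rewrite subrr nr0.
Qed.

End Osgood.

(** * Carathéodory balls and the squeezing function *)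

Section Hyperbolic.
Local Open Scope complex_scope.
Context {R : realType}.

Lemma tanh_bounds (r : R) : 0 < r -> 0 < tanh r < 1.
Proof.
move=> r0; have p1 := expR_gt0 r; have p2 := expR_gt0 (- r).
have lt12 : expR (- r) < expR r by rewrite ltr_expR; lra.
rewrite /tanh divr_gt0 ?subr_gt0 ?addr_gt0//= ltr_pdivrMr ?addr_gt0//; lra.
Qed.

Lemma artanh_lt_tanh (r x : R) : 0 <= x -> x < tanh r -> tanh r < 1 -> artanh x < r.
Proof.
move=> x0 xr r1; have p1 := expR_gt0 r; have p2 := expR_gt0 (- r).
have x1 : x < 1 by lra.
have q0 : 0 < (1 + x) / (1 - x) by rewrite divr_gt0//; lra.
rewrite /artanh ltr_pdivrMr// -ltr_expR lnK ?posrE//.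
have ee : expR r * expR (- r) = 1 by rewrite -expRD subrr expR0.
have -> : r * 2 = r + r by ring.
rewrite expRD ltr_pdivrMr; last lra.
have xr' : x * (expR r + expR (- r)) < expR r - expR (- r).
  by move: xr; rewrite /tanh ltr_pdivlMr// addr_gt0.
have : x * (expR r + expR (- r)) * expR r < (expR r - expR (- r)) * expR r by rewrite ltr_pM2r.
nra.
Qed.

Lemma artanh_le (x y : R) : 0 <= x -> x <= y -> y < 1 -> artanh x <= artanh y.
Proof.
move=> x0 xy y1; rewrite /artanh ler_pM2r ?invr_gt0//.
have x1 : x < 1 by lra.
rewrite ler_ln ?posrE; [|rewrite divr_gt0//; lra|rewrite divr_gt0//; lra].
rewrite ler_pdivrMr; last lra.
by rewrite mulrAC ler_pdivlMr; nra.
Qed.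

End Hyperbolic.

(** * The weighted action of the scalars *)

Section WeightedAction.
Local Open Scope complex_scope.
Context {R : realType} {n : nat} (d : 'I_n -> nat).
Notation C := R[i].
Implicit Types (z : 'rV[C]_n) (l : C).

Definition wact l z : 'rV[C]_n := \row_i (l ^+ d i * z ord0 i).

Lemma wactM l m z : wact l (wact m z) = wact (l * m) z.
Proof. by apply/rowP => i; rewrite !mxE exprMn mulrA. Qed.

Lemma wact1 z : wact 1 z = z.
Proof. by apply/rowP => i; rewrite !mxE expr1n mul1r. Qed.

Lemma wactK l : l != 0 -> cancel (wact l) (wact l^-1).
Proof. by move=> l0 z; rewrite wactM mulVf// wact1. Qed.

Lemma wactVK l : l != 0 -> cancel (wact l^-1) (wact l).
Proof. by move=> l0 z; rewrite wactM mulfV// wact1. Qed.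

Lemma wact0 z : (forall i, (0 < d i)%N) -> wact 0 z = 0.
Proof. by move=> hd; apply/rowP => i; rewrite !mxE expr0n gtn_eqF// mul0r. Qed.

Lemma wact_diff_scal z l : differentiable (fun l => wact l z) l.
Proof.
apply: (diff_row _).1 => j.
have -> : (fun l : C => wact l z ord0 j) = (fun l => l ^+ d j * z ord0 j).
  by apply/funext => m; rewrite mxE.
by apply: diff_mul; [apply: diff_exp; exact: diff_id|exact: diff_const].
Qed.

Lemma wact_diff_vec l z : differentiable (wact l) z.
Proof.
apply: (diff_row _).1 => j.
have -> : (fun z => wact l z ord0 j) = (fun z => l ^+ d j * z ord0 j).
  by apply/funext => m; rewrite mxE.
by apply: diff_mul; [exact: diff_const|exact: differentiable_coord].
Qed.

Lemma balanced0 (D : set 'rV[C]_n) : (forall i, (0 < d i)%N) -> D !=set0 -> d_balanced d D -> D 0.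
Proof.
move=> hd [z Dz] bD; have := bD z 0 Dz; rewrite normr0 => /(_ ler01).
by rewrite -[\row_i _]/(wact 0 z) wact0.
Qed.

Lemma balancedP (D : set 'rV[C]_n) z l : d_balanced d D -> D z -> nr l <= 1 -> D (wact l z).
Proof. by move=> bD Dz l1; apply: bD => //; rewrite nrE lecR. Qed.

(** Openness leaves room to expand [z] slightly. The factor [t < 1] turns the weak Schwarz-Pick
    inequality, taken over a supremum, into the strict one that defines the ball. *)
Lemma wact_shrink (D : set 'rV[C]_n) z : open D -> D z ->
  exists2 t : R, 0 < t < 1 & exists2 z', D z' & z = wact t%:C z'.
Proof.
move=> oD Dz; have [e e0 eP] := (nr_openP D).1 oD z Dz.
have /nr_contP/(_ e e0)[de de0 deP] := differentiable_continuous (wact_diff_scal z 1).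
pose s := 1 + de / 2; have s1 : 1 < s by rewrite /s; lra.
have s0 : s != 0 by rewrite gt_eqF//; lra.
exists s^-1; first by rewrite invr_gt0 invf_lt1; lra.
exists (wact s%:C z).
  apply: eP; have := deP s%:C; rewrite wact1; apply.
  have -> : s%:C - 1 = (de / 2)%:C :> C by rewrite /s rmorphD rmorph1/= addrC addKr.
  by rewrite nrR ger0_norm; lra.
by rewrite wactM -rmorphM/= mulVf// rmorph1 wact1.
Qed.

(* The Schwarz-Pick lemma along the disc [l |-> wact l z']. *)
Lemma caratheodory_wact (D : set 'rV[C]_n) z (rho r : R) : (forall i, (0 < d i)%N) ->
  open D -> d_balanced d D -> 0 < rho < 1 -> rho = tanh r -> D z ->
  caratheodory_ball D 0 r (wact rho%:C z).
Proof.
move=> hd oD bD /andP[rho0 rho1] rhoE Dz.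
have nrho : nr (rho%:C : C) = rho by rewrite nrR gtr0_norm.
split; first by apply: balancedP => //; rewrite nrho ltW.
have [t /andP[t0 t1] [z' Dz' ->]] := wact_shrink oD Dz.
have rt0 : 0 < rho * t by rewrite mulr_gt0.
have rt1 : rho * t < rho by rewrite gtr_pMr.
apply: (@le_lt_trans _ _ ((artanh (rho * t))%:E)%E); last first.
  by rewrite lte_fin artanh_lt_tanh -?rhoE// ltW.
apply: ge_ereal_sup => _ [f [hf fD] <-]; rewrite lee_fin.
pose phi (l : C) := f (wact l z').
have inD l : nr l <= 1 -> D (wact l z') by exact: balancedP.
have dphi l : nr l <= 1 -> differentiable phi l.
  move=> l1; apply: (@differentiable_comp _ _ _ _ (fun l => wact l z') f).
    exact: wact_diff_scal.
  exact: hf (inD l l1).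
have bphi l : nr l <= 1 -> nr (phi l) < 1.
  move=> l1; have : unit_disc (phi l) by apply: fD; exists (wact l z') => //; exact: inD.
  by rewrite /unit_disc/= nrE ltcR.
pose a : C := (rho * t)%:C.
have na : nr a = rho * t by rewrite nrR gtr0_norm.
have a1 : nr a < 1 by rewrite na; lra.
have := schwarz_pick dphi bphi a1; rewrite na => h.
have E : wact rho%:C (wact t%:C z') = wact a z' by rewrite wactM /a rmorphM.
rewrite /poincare; have pE (x : C) : complex.Re `|x| = nr x by [].
rewrite pE; apply: artanh_le; [exact: nr_ge0| |lra].
rewrite E; have -> : f 0 = phi 0 by rewrite /phi wact0.
rewrite -/(phi a).
move: h; rewrite !nrM !nrV nr_distC.
exact.
Qed.

End WeightedAction.

(** * From Carathéodory balls to the squeezing function *)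

Section SqueezingBound.
Local Open Scope complex_scope.
Context {R : realType} {n : nat} (d : 'I_n -> nat).
Notation C := R[i].

Lemma bounded_nr (D : set 'rV[C]_n) : bounded_set D -> exists B : R, forall z, D z -> nr z <= B.
Proof.
move=> [M [Mreal hM]]; exists (complex.Re M + 1) => z Dz.
have ME : M = (complex.Re M)%:C by rewrite RRe_real.
have := hM (complex.Re M + 1)%:C; rewrite {1}ME ltcR ltrDl ltr01 => /(_ isT z Dz) /=.
by rewrite nrE lecR.
Qed.

Lemma convex_mid (D : set 'rV[C]_n) x y : convex_set D -> D x -> D y -> D (2^-1 *: (x + y)).
Proof.
move=> cD Dx Dy.
have h0 : (0 : C) <= 2^-1 by rewrite invr_ge0.
have h1 : (2^-1 : C) <= 1 by rewrite invf_le1// ler1n.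
have := cD x y (Itv01 h0 h1) (mem_set Dx) (mem_set Dy); rewrite inE.
rewrite /conv/=; congr D; rewrite scalerDr; congr (_ + _ *: _).
by rewrite /unstable.onem; field.
Qed.

(** An average of [2 ^ k] points is an iterated midpoint. *)
Lemma convex_dyadic (D : set 'rV[C]_n) k (s : nat -> 'rV[C]_n) : convex_set D ->
  (forall j, D (s j)) -> D (((2 ^ k)%:R)^-1 *: \sum_(j < 2 ^ k) s j).
Proof.
move=> cD; elim: k s => [|k IH] s Ds.
  by rewrite expn0 big_ord1 invr1 scale1r.
have -> : ((2 ^ k.+1)%:R : C)^-1 *: \sum_(j < 2 ^ k.+1) s j =
    2^-1 *: (((2 ^ k)%:R : C)^-1 *: \sum_(j < 2 ^ k) s j + ((2 ^ k)%:R : C)^-1 *: \sum_(j < 2 ^ k) s (2 ^ k + j)%N).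
  rewrite -scalerDr scalerA -invfM -natrM -expnS; congr (_ *: _).
  by rewrite expnS mul2n -addnn big_split_ord.
apply: (convex_mid cD (IH s Ds)).
exact: (IH (fun j => s (2 ^ k + j)%N) (fun j => Ds _)).
Qed.

(* [z |-> f (wact z^L z')] vanishes to order [L] at [0], so dividing its [i]-th
   coordinate by [z ^ d i] leaves a holomorphic map [G]; it sends the unit circle into [D],
   hence, by the discrete Poisson averages and convexity, the disc too. *)
Lemma weighted_schwarz (D Om : set 'rV[C]_n) (f : 'rV[C]_n -> 'rV[C]_n) z' (L : nat) (eta : R) :
  (forall i, (0 < d i <= L)%N) -> open D -> d_balanced d D -> convex_set D -> bounded_set D ->
  d_balanced d Om -> Om z' -> holo_map Om D f -> f 0 = 0 -> 0 < eta < 1 ->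
  exists2 q, D q & f (wact d (eta ^+ L)%:C z') = wact d eta%:C q.
Proof.
move=> hdL oD bD cD bdD bOm Omz [df fOm] f0 /andP[eta0 eta1].
have hd i : (0 < d i)%N by case/andP: (hdL i).
have [B hB] := bounded_nr bdD.
have inO (l : C) : nr l <= 1 -> Om (wact d l z') by exact: balancedP.
have fD (l : C) : nr l <= 1 -> D (f (wact d l z')) by move=> /inO Ol; apply: fOm; exists (wact d l z').
pose phi i (l : C) := f (wact d l z') ord0 i.
have dphi i l : nr l <= 1 -> differentiable (phi i) l.
  move=> l1; apply: (@differentiable_comp _ _ _ _ (fun l => wact d l z') (fun z => f z ord0 i)).
    exact: wact_diff_scal.
  by apply: diff_coord; exact: df (inO l l1).
have bphi i l : nr l <= 1 -> nr (phi i l) <= B.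
  by move=> /fD/hB; apply: le_trans; exact: nr_coord.
have phi0 i : phi i 0 = 0 by rewrite /phi wact0// f0 mxE.
pose g i (z : C) := z ^+ (L - d i) * dq (phi i) 0 (z ^+ L).
have phiE i (z : C) : phi i (z ^+ L) = z ^+ d i * g i z.
  rewrite /g mulrA -exprD subnKC; last by case/andP: (hdL i).
  by have := dq_mul (phi i) 0 (z ^+ L); rewrite subr0 phi0 subr0.
pose G (z : C) : 'rV[C]_n := \row_i g i z.
have fG z : f (wact d (z ^+ L) z') = wact d z (G z).
  by apply/rowP => i; rewrite -[LHS]/(phi i (z ^+ L)) phiE !mxE.
have pw1 (z : C) k : nr z <= 1 -> nr (z ^+ k) <= 1.
  by move=> z1; rewrite nrX exprn_ile1 ?nr_ge0.
have n01 : nr (0 : C) <= 1 by rewrite nr0.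
have dg i (z : C) : nr z <= 1 -> z != 0 -> differentiable (g i) z.
  move=> z1 z0; apply: diff_mul; first exact: diff_exp (diff_id z).
  apply: (@differentiable_comp _ C C C (fun z : C => z ^+ L) (dq (phi i) 0)).
    exact: diff_exp (diff_id z).
  by apply: dq_diff; [rewrite expf_neq0|exact: dphi (pw1 z L z1)].
have /choice[M hM] i : exists M, forall z, nr z <= 1 -> nr (g i z) <= M.
  have [M hM] := dq_bound (dphi i 0 n01) (bphi i) n01.
  exists M => z z1; rewrite nrM -[leRHS]mul1r ler_pM ?nr_ge0//; first exact: pw1.
  exact: hM (pw1 z L z1).
have GD (z : C) : nr z = 1 -> D (G z).
  move=> z1; have z0 : z != 0 by rewrite -nr_gt0 z1.
  have -> : G z = wact d z^-1 (f (wact d (z ^+ L) z')) by rewrite fG wactK.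
  by apply: balancedP; [exact: bD|apply: fD; rewrite pw1 ?z1|rewrite nrV z1 invr1].
have cG (z : C) : nr z = 1 -> {for z, continuous G}.
  move=> z1; apply: differentiable_continuous; apply: (diff_row _).1 => j.
  have -> : (fun z => G z ord0 j) = g j by apply/funext => w; rewrite mxE.
  by apply: dg; rewrite ?z1// -nr_gt0 z1.
(* A uniform margin around the image of the circle, to compensate the error of a finite average. *)
have [eps eps0 hE] : exists2 e : R, 0 < e & forall z : C, nr z = 1 -> forall b, nr b < e -> D (G z + b).
  apply: (@circle_uniform R (fun z e => forall b, nr b < e -> D (G z + b))).
    by move=> z e e' ee h b be; apply: h; exact: lt_le_trans be ee.
  move=> z z1; have [e e0 eP] := (nr_openP D).1 oD _ (GD z z1).
  have e2 : 0 < e / 2 by lra.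
  have [de de0 deP] := (nr_contP _ _).1 (cG z z1) _ e2.
  exists (Num.min de (e / 2)); first by rewrite lt_min de0.
  move=> w w1; rewrite lt_min => /andP[/deP wz _] b; rewrite lt_min => /andP[_ be].
  apply: eP; rewrite addrAC; apply: le_lt_trans (nrD _ _) _; lra.
have neta : nr (eta%:C : C) = eta by rewrite nrR gtr0_norm.
have etaC0 : (eta%:C : C) != 0 by rewrite -nr_gt0 neta.
have e1 : nr (eta%:C : C) < 1 by rewrite neta.
have z1 : nr (0 : C) < 1 by rewrite nr0.
(* The exceptional point is [0], where [g i] inherits the centre of [dq (phi i) 0]. *)
have [p p1 hp] := @moebius_mean R eta%:C 0 e1 z1 (ltac:(by rewrite eq_sym)).
exists (G eta%:C); last by rewrite rmorphXn/= fG.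
have eps2 : 0 < eps / 2 by lra.
have /choice[K hK] i := hp (g i) (M i) (dg i) (hM i) _ eps2.
(* The sample points are common to all coordinates, so a single [k] serves them all. *)
pose k := (\max_i K i)%N.
pose A : 'rV[C]_n := ((2 ^ k)%:R)^-1 *: \sum_(j < 2 ^ k) G (p k j).
have AG : nr (G eta%:C - A) < eps.
  apply: (@le_lt_trans _ _ (eps / 2)); last by lra.
  apply: nr_row_le => [|i]; first exact: ltW.
  have -> : (G eta%:C - A) ord0 i = g i eta%:C - ((2 ^ k)%:R)^-1 * \sum_(j < 2 ^ k) g i (p k j).
    rewrite mxBE !mxE summxE; congr (_ - _ * _); apply: eq_bigr => j _; by rewrite mxE.
  by rewrite nr_distC; apply: hK; rewrite leq_bigmax.
(* Translating every sample by the error of the average makes the average exact, and the margin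
   keeps the samples in [D]. *)
have -> : G eta%:C = ((2 ^ k)%:R)^-1 *: \sum_(j < 2 ^ k) (G (p k j) + (G eta%:C - A)).
  rewrite big_split/= scalerDr -/A sumr_const card_ord -(scaler_nat (2 ^ k) (G eta%:C - A)) scalerA mulVf ?scale1r.
    by rewrite addrC subrK.
  by rewrite pnatr_eq0 -lt0n expn_gt0.
by apply: (@convex_dyadic D k (fun j => G (p k j) + (G eta%:C - A))) => // j; exact: hE.
Qed.

Lemma minkowski_lt (Om : set 'rV[C]_n) z (s : R) : (forall i, (0 < d i)%N) ->
  open Om -> Om 0 -> d_minkowski d Om z < s ->
  exists2 t : R, 0 < t < s & exists2 z', Om z' & z = wact d t%:C z'.
Proof.
move=> hd oO O0; have [e e0 eP] := (nr_openP Om).1 oO _ O0.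
rewrite /d_minkowski => /inf_lt; case.
  (* The infimum of an empty set would be a default value, so a member is exhibited: [t >= 1] gives
     [t ^+ d i >= t], and [nr z / t < e]. *)
  pose t := nr z / e + 1; have t1 : 1 <= t by rewrite lerDr divr_ge0 ?nr_ge0// ltW.
  exists t; split; first by lra.
  apply: eP; rewrite subr0; apply: (@le_lt_trans _ _ (nr z / t)); last first.
    rewrite ltr_pdivrMr; last lra.
    rewrite /t mulrDr mulr1 mulrCA divff ?gt_eqF// mulr1; lra.
  have t0 : 0 < t by lra.
  apply: nr_row_le => [|i]; first by rewrite divr_ge0 ?nr_ge0// ltW.
  rewrite mxE nrM nrV nrX nrR gtr0_norm// ler_pM ?nr_ge0 ?invr_ge0 ?exprn_ge0 ?nr_coord// ?(ltW t0)//.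
  rewrite lef_pV2 ?posrE ?exprn_gt0//.
  by have := hd i; case: (d i) => // k _; rewrite exprS ler_peMr ?(ltW t0)// exprn_ege1.
move=> t [t0 Ot] ts; exists t; first by rewrite t0.
eexists; first exact: Ot.
apply/rowP => i; rewrite !mxE mulrC divfK// expf_neq0//.
by rewrite -nr_gt0 nrR gtr0_norm.
Qed.

Lemma squeezing_member (D Om : set 'rV[C]_n) (f : 'rV[C]_n -> 'rV[C]_n) (L : nat) (r : R) :
  (forall i, (0 < d i <= L)%N) -> (0 < L)%N ->
  domain D -> bounded_set D -> d_balanced d D -> convex_set D ->
  domain Om -> d_balanced d Om -> homogeneous Om ->
  0 < r -> holo_inj Om D f -> caratheodory_ball D 0 r `<=` f @` Om ->
  exists F, [/\ holo_inj D Om F, F 0 = 0 & d_sublevel d Om (tanh r ^+ L) `<=` F @` D].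
Proof.
move=> hdL L0 [D0 oD _] bdD bD cD [nO0 oO _] bO homO r0 [[df fD] fi] ballf.
have hd i : (0 < d i)%N by case/andP: (hdL i).
have D00 := balanced0 hd D0 bD; have O00 := balanced0 hd nO0 bO.
move: (tanh_bounds r0); move rhoE: (tanh r) => rho /andP[rho0 rho1].
have nrho : nr (rho%:C : C) = rho by rewrite nrR gtr0_norm.
have rhoC : (rho%:C : C) != 0 by rewrite -nr_gt0 nrho.
have inball z : D z -> caratheodory_ball D 0 r (wact d rho%:C z).
  by apply: caratheodory_wact; rewrite ?rho0.
have [w0 Ow0 fw0] : exists2 w, Om w & f w = 0.
  by have /ballf[w Ow fw] := inball 0 D00; exists w => //; rewrite fw; apply/rowP => i; rewrite !mxE mulr0.
have [psi [[dpsi psiO] [psi' [[_ psi'O] psiK psiVK]]] psi0] := homO 0 w0 O00 Ow0.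
pose f0 := f \o psi.
have Opsi z : Om z -> Om (psi z) by move=> Oz; apply: psiO; exists z.
have df0 z : Om z -> differentiable f0 z.
  by move=> Oz; apply: differentiable_comp; [exact: dpsi|exact: df (Opsi z Oz)].
have f0D z : Om z -> D (f0 z) by move=> Oz; apply: fD; exists (psi z) => //; exact: Opsi.
have f0i : set_inj Om f0.
  move=> x y; rewrite !inE => Ox Oy fxy.
  have := fi _ _ (mem_set (Opsi x Ox)) (mem_set (Opsi y Oy)) fxy.
  by move=> /(congr1 psi'); rewrite !psiK ?inE.
have f00 : f0 0 = 0 by rewrite /f0/= psi0.
have /choice[g hg] q : exists x, caratheodory_ball D 0 r q -> Om x /\ f0 x = q.
  have [qb|] := pselect (caratheodory_ball D 0 r q); last by exists 0.
  have [w Ow fw] := ballf q qb; exists (psi' w) => _; split; first by apply: psi'O; exists w.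
  by rewrite /f0/= psiVK ?inE.
exists (fun z => g (wact d rho%:C z)).
have hgD z : D z -> Om (g (wact d rho%:C z)) /\ f0 (g (wact d rho%:C z)) = wact d rho%:C z.
  by move=> /inball/hg.
have inv_rho z : wact d rho%:C (wact d rho%:C^-1 z) = z by exact: wactVK.
split.
- split; [split|].
  + move=> z Dz; apply: (@differentiable_comp _ _ _ _ (wact d rho%:C) g).
      exact: wact_diff_vec.
    (* [inverse_holomorphic] needs [g] to invert [f0] on a full neighbourhood. It is found inside
       the dilate of [D] by [rho], whose openness comes from that of [D]. *)
    have [e e0 eP] := (nr_openP D).1 oD z Dz.
    have /nr_contP/(_ e e0)[de de0 deP] := differentiable_continuous (wact_diff_vec d rho%:C^-1 (wact d rho%:C z)).
    apply: (inverse_holomorphic oO df0 f0i de0) => y yde.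
    have Dy : D (wact d rho%:C^-1 y) by apply: eP; have := deP y yde; rewrite (wactK d rhoC).
    by have := hgD _ Dy; rewrite inv_rho.
  + by move=> _ [z Dz <-]; exact: (hgD z Dz).1.
  + move=> x y; rewrite !inE => Dx Dy gxy.
    have := (hgD x Dx).2; rewrite gxy (hgD y Dy).2 => /(congr1 (wact d rho%:C^-1)).
    by rewrite !(wactK d rhoC).
- have [h1 h2] := hgD 0 D00.
  by apply: f0i; rewrite ?inE// h2 f00; apply/rowP => i; rewrite !mxE mulr0.
move=> z /= zL; have [t /andP[t0 tL] [z' Oz' zE]] := minkowski_lt hd oO O00 zL.
(* The [L]-th root of [t], below [rho] since [t < rho ^+ L]. Hence dilation by [eta] is dilation by
   [rho] after dilation by [eta / rho < 1], which preserves [D]. *)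
pose eta := expR (ln t / L%:R).
have L0R : (L%:R : R) != 0 by rewrite pnatr_eq0 -lt0n.
have etaL : eta ^+ L = t by rewrite -expRM_natl mulrC divfK// lnK.
have eta0 : 0 < eta by exact: expR_gt0.
have etarho : eta < rho by rewrite -(@ltr_pXn2r _ L) ?nnegrE ?(ltW eta0) ?(ltW rho0)// etaL.
have t1 : t <= 1 by rewrite -etaL exprn_ile1 ?(ltW eta0)//; lra.
have eta01 : 0 < eta < 1 by apply/andP; split; lra.
have hm : holo_map Om D f0 by split=> [//|_ [x Ox <-]]; exact: f0D.
have [q Dq] := weighted_schwarz hdL oD bD cD bdD bO Oz' hm f00 eta01.
rewrite etaL -zE => fz.
have Oz : Om z by rewrite zE; apply: balancedP => //; rewrite nrR gtr0_norm.
have Dq' : D (wact d (eta / rho)%:C q).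
  apply: balancedP => //; rewrite nrR ger0_norm ?divr_ge0 ?ltW//.
  by rewrite ltr_pdivrMr// mul1r.
exists (wact d (eta / rho)%:C q) => //.
have [h1 h2] := hgD _ Dq'; apply: f0i; rewrite ?inE//.
by rewrite h2 fz wactM -rmorphM/= mulrC divfK// gt_eqF.
Qed.

End SqueezingBound.

Unset Implicit Arguments.

(* Convexity over R[i] is the usual one: 0 <= l <= 1 in R[i] forces l real. *)
Theorem theorem5p2 (R : realType) (n : nat) (hn : (2 <= n)%N)
    (d : 'I_n -> nat) (hd : forall i, (0 < d i)%N)
    (D Omega : set 'rV[R[i]]_n)
    (hD : domain D) (hDb : bounded_set D)
    (hDd : d_balanced d D) (hDc : convex_set D)
    (hO : domain Omega) (hOb : bounded_set Omega)
    (hOd : d_balanced d Omega) (hOc : convex_set Omega)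
    (hOh : homogeneous Omega) :
  fridman D Omega 0 ^+ (\max_(i < n) d i)%N <= squeezing d D Omega 0.
Proof.
have n0 : (0 < n)%N by apply: leq_trans hn.
set L := (\max_(i < n) d i)%N.
have hdL i : (0 < d i <= L)%N by rewrite hd /L; exact: (leq_bigmax i).
have L0 : (0 < L)%N by case/andP: (hdL (Ordinal n0)) => h1 h2; exact: leq_trans h1 h2.
rewrite /fridman /squeezing; set SQ := (X in _ <= sup X); set A := (X in sup X ^+ _).
have ubS : has_ubound SQ by exists 1 => x [].
have AS x : A x -> 0 < x /\ x ^+ L <= sup SQ.
  move=> [r [r0 [f fi ballf]] <-]; have /andP[t0 t1] := tanh_bounds r0.
  split=> //; have [F HF] := squeezing_member hdL L0 hD hDb hDd hDc hO hOd hOh r0 fi ballf.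
  apply: (ub_le_sup ubS); split; [exact: exprn_gt0| |by exists F].
  by rewrite exprn_ile1 ?ltW.
(* The supremum of the empty set is [0] by default, and [0 ^+ L = 0] because [L] is positive. *)
have [A0|/set0P[x Ax]] := eqVneq A set0.
  rewrite A0 sup0 expr0n gtn_eqF//=.
  have [->|/set0P[y Sy]] := eqVneq SQ set0; first by rewrite sup0.
  by apply: le_trans (ub_le_sup ubS Sy); case: Sy => /ltW.
have [x0 xS] := AS x Ax.
have S0 : 0 < sup SQ by apply: lt_le_trans xS; exact: exprn_gt0.
(* Bounding [A] by the [L]-th root of [sup SQ] moves the power past the supremum. *)
pose s := expR (ln (sup SQ) / L%:R).
have s0 : 0 < s by exact: expR_gt0.
have sL : s ^+ L = sup SQ by rewrite -expRM_natl mulrC divfK ?lnK// pnatr_eq0 -lt0n.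
have ubA : ubound A s.
  move=> y /AS[y0 yS]; rewrite -(@ler_pXn2r _ L) ?nnegrE ?(ltW y0) ?(ltW s0)//.
  by rewrite sL.
have As : sup A <= s by apply: ge_sup => //; exists x.
have Apos : 0 <= sup A.
  by apply: le_trans (ltW x0) _; apply: (ub_le_sup _ Ax); exists s.
by rewrite -sL lerXn2r ?nnegrE ?(ltW s0).
Qed.
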